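(* Let $M$ be a Riemannian manifold with universal cover $\mathbb R^{n+1}$ and torsion-free fundamental group, and let $T\subset M$ be an irreducible Anosov $n$-torus (in particular, $T$ may be any codimension one Anosov $n$-torus). Then one of the following holds: (a) either $T$ is incompressible in $M$, or (b) $n\ge 3$, $T$ is totally compressible, and $T$ can be embedded into $\mathbb S^{n+1}=\mathbb R^{n+1}\sqcup\{\infty\}$ by taking a lift to $\mathbb R^{n+1}$. Moreover, denoting by $\tilde T\subset\mathbb S^{n+1}$ the image of such an embedding, $\tilde T$ splits $\mathbb S^{n+1}$ into two components $N_1$ and $N_2$, one of which, say $N_1$, is simply connected, while $N_2$ has incompressible boundary; also $H_1(N_2)\simeq H_1(\partial N_2)$. Furthermore, identify $\pi_1(\partial N_2)$ with its image in $\pi_1(N_2)$ under the map induced by inclusion, and let $G:=[\pi_1(N_2),\pi_1(N_2)]\rtimes\pi_1(\partial N_2)$, where $\pi_1(\partial N_2)$ acts on $[\pi_1(N_2),\pi_1(N_2)]$ by conjugation. Then $G\simeq\pi_1(N_2)$ and $\pi_1(\partial N_2)$ normally generates $G$.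
   Context: An embedded $n$-torus $T\subset M$ is called an Anosov torus if there is a diffeomorphism $g:M\to M$ with $g(T)=T$ such that $(g|_T)_*:\pi_1(T)\to\pi_1(T)\cong\mathbb Z^n$ is given by a hyperbolic integer matrix (no eigenvalue of modulus $1$). An Anosov torus is irreducible if $g$ can be chosen so that the characteristic polynomial of this matrix is irreducible; it is codimension one Anosov if $g$ can be chosen so that the stable or the unstable subspace of this hyperbolic matrix is one-dimensional. A submanifold $S\subset M$ with inclusion $i:S\hookrightarrow M$ is incompressible if $i_*:\pi_1(S)\to\pi_1(M)$ is injective, and totally compressible if $\ker i_*=\pi_1(S)$. A lift of $T$ means a lift $\tilde i:T\to\mathbb R^{n+1}$ of the inclusion $i:T\hookrightarrow M$ to the universal cover. $N_1,N_2$ are regarded as compact manifolds with boundary, namely the closures of the two components of $\mathbb S^{n+1}\setminus\tilde T$ (equivalently up to homotopy, the components of the complement of an open tubular neighborhood of $\tilde T$), so that $\partial N_j$ is a copy of $\tilde T$; $N_2$ has incompressible boundary if $\pi_1(\partial N_2)\to\pi_1(N_2)$ is injective. A subgroup normally generates a group if its normal closure is the whole group. *)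

(* Defs.v *)
From HB Require Import structures.
From mathcomp Require Import all_boot all_order all_fingroup all_algebra all_field.
From mathcomp Require Import freeg generic_quotient ring_quotient.
From mathcomp Require Import all_classical all_reals all_analysis.
From mathcomp Require Import lra.

Set Implicit Arguments.
Unset Strict Implicit.
Unset Printing Implicit Defensive.

Import Order.TTheory GRing.Theory Num.Theory.
Import numFieldNormedType.Exports.

Local Open Scope classical_set_scope.
Local Open Scope ring_scope.
Local Open Scope quotient_scope.

(* A path is a continuous map on [0, 1]; it is extended to the whole line by
   its end points, so that concatenation and homotopies need no restriction. *)
Record path (R : realType) (X : topologicalType) (x y : X) := Path {
  path_fun :> R -> X;
  path_cts : continuous path_fun;
  path_le0 : forall t, t <= 0 -> path_fun t = x;
  path_ge1 : forall t, 1 <= t -> path_fun t = y }.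

HB.instance Definition _ (R : realType) (X : topologicalType) (x y : X) :=
  gen_eqMixin (path R x y).
HB.instance Definition _ (R : realType) (X : topologicalType) (x y : X) :=
  gen_choiceMixin (path R x y).

Definition homotopic (R : realType) (X : topologicalType) (x y : X)
    (p q : path R x y) : Prop :=
  exists H : R * R -> X,
    [/\ continuous H,
        forall t, H (0, t) = p t,
        forall t, H (1, t) = q t,
        forall s t, t <= 0 -> H (s, t) = x &
        forall s t, 1 <= t -> H (s, t) = y].

Section Pasting.
Context {R : realType} {Z X : topologicalType}.

Lemma continuous_paste (f g : Z -> X) (h : Z -> R) (c : R) :
  continuous f -> continuous g -> continuous h ->
  (forall z, h z = c -> f z = g z) ->
  continuous (fun z => if h z <= c then f z else g z).
Proof.
move=> cf cg ch fg; set k := fun z => _.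
have cA : closed [set z | h z <= c].
  exact: (closed_comp (fun z _ => ch z) (@closed_le R c)).
have cB : closed [set z | c <= h z].
  exact: (closed_comp (fun z _ => ch z) (@closed_ge R c)).
apply/continuous_subspace_setT.
have <- : [set z | h z <= c] `|` [set z | c <= h z] = setT.
  by apply/seteqP; split=> z //= _; apply/orP; exact: le_total.
apply: withinU_continuous => //.
- apply: (@subspace_eq_continuous _ _ _ f); last exact: continuous_subspaceT.
  by move=> z /set_mem /= zc; rewrite /from_subspace /k zc.
- apply: (@subspace_eq_continuous _ _ _ g); last exact: continuous_subspaceT.
  move=> z /set_mem /= cz; rewrite /from_subspace /k; case: ifPn => // zc.
  by rewrite fg//; apply/eqP; rewrite eq_le zc.
Qed.

Lemma continuous_compfun {Y : topologicalType} (f : Y -> X) (g : Z -> Y) :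
  continuous f -> continuous g -> continuous (fun z => f (g z)).
Proof. by move=> cf cg z; apply: continuous_comp; [exact: cg|exact: cf]. Qed.

Lemma continuous_pairfun {Y : topologicalType} (f : Z -> X) (g : Z -> Y) :
  continuous f -> continuous g -> continuous (fun z => (f z, g z)).
Proof. by move=> cf cg z; apply: cvg_pair; [exact: cf|exact: cg]. Qed.

Lemma continuous_affine (f : Z -> R) (a b : R) :
  continuous f -> continuous (fun z => a * f z + b).
Proof.
move=> cf z.
have cMf : (a * f y @[y --> z] --> a * f z) by exact: (cvgMl_tmp (cf z)).
by apply: (cvgD cMf); exact: cvg_cst.
Qed.

Lemma continuous_minfun (f g : Z -> R) :
  continuous f -> continuous g -> continuous (fun z => Num.min (f z) (g z)).
Proof. by move=> cf cg z; exact: (@continuous_min R Z f g z (cf z) (cg z)). Qed.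

Lemma continuous_maxfun (f g : Z -> R) :
  continuous f -> continuous g -> continuous (fun z => Num.max (f z) (g z)).
Proof. by move=> cf cg z; exact: (@continuous_max R Z f g z (cf z) (cg z)). Qed.

End Pasting.


Section PathAlgebra.
Context {R : realType} {X : topologicalType}.
Implicit Types x y z w : X.

Let idc : continuous (fun t : R => t). Proof. by move=> z; exact: cvg_id. Qed.
Let fstc : continuous (@fst R R). Proof. by move=> z; exact: cvg_fst. Qed.
Let sndc : continuous (@snd R R). Proof. by move=> z; exact: cvg_snd. Qed.

Definition path_cst x : path R x x :=
  @Path R X x x (fun=> x) (fun=> cvg_cst _) (fun _ _ => erefl) (fun _ _ => erefl).

Section Cat.
Variables (x y z : X) (p : path R x y) (q : path R y z).

Definition path_cat_fun (t : R) : X :=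
  if t <= 2^-1 then p (2 * t) else q (2 * t - 1).

Lemma path_cat_cts : continuous path_cat_fun.
Proof.
apply: (@continuous_paste _ _ _ _ _ id) => //.
- have c2 : continuous (fun t : R => 2 * t + 0) by exact: continuous_affine.
  rewrite (_ : (fun t => _) = fun t => p (2 * t + 0)); last first.
    by apply/funext => t; rewrite addr0.
  by apply: continuous_compfun => //; exact: path_cts.
- by apply: continuous_compfun; [exact: path_cts|exact: continuous_affine].
- by move=> t ->; rewrite divff ?pnatr_eq0// subrr path_ge1// path_le0.
Qed.

Lemma path_cat_le0 t : t <= 0 -> path_cat_fun t = x.
Proof.
by move=> t0; rewrite /path_cat_fun ifT ?path_le0//; lra.
Qed.

Lemma path_cat_ge1 t : 1 <= t -> path_cat_fun t = z.
Proof.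
move=> t1; rewrite /path_cat_fun ifF ?path_ge1//; first lra.
by apply/negbTE; rewrite -ltNge; lra.
Qed.

Definition path_cat : path R x z := Path path_cat_cts path_cat_le0 path_cat_ge1.

End Cat.

Section Inv.
Variables (x y : X) (p : path R x y).

Let inv_cts : continuous (fun t : R => p (1 - t)).
Proof.
rewrite (_ : (fun t => _) = fun t => p (-1 * t + 1)); last first.
  by apply/funext => t; congr (p _); lra.
by apply: continuous_compfun; [exact: path_cts | exact: continuous_affine].
Qed.

Let inv_le0 t : t <= 0 -> p (1 - t) = y.
Proof. by move=> t0; apply: path_ge1; lra. Qed.

Let inv_ge1 t : 1 <= t -> p (1 - t) = x.
Proof. by move=> t0; apply: path_le0; lra. Qed.

Definition path_inv : path R y x := Path inv_cts inv_le0 inv_ge1.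

End Inv.

Lemma homotopic_eqfun x y (p q : path R x y) : p =1 q -> homotopic p q.
Proof.
move=> pq; exists (fun st => p st.2); split=> //.
- by apply: continuous_compfun => //; exact: path_cts.
- by move=> s t t0; rewrite path_le0.
- by move=> s t t0; rewrite path_ge1.
Qed.

Lemma homotopic_refl x y (p : path R x y) : homotopic p p.
Proof. exact: homotopic_eqfun. Qed.

Lemma homotopic_sym x y (p q : path R x y) : homotopic p q -> homotopic q p.
Proof.
move=> [H [cH H0 H1 Hx Hy]]; exists (fun st => H (-1 * st.1 + 1, st.2)).
split.
- apply: continuous_compfun => //; apply: continuous_pairfun => //.
  exact: continuous_affine.
- by move=> t /=; rewrite mulr0 add0r H1.
- by move=> t /=; rewrite mulr1 addNr H0.
- by move=> s t /= t0; exact: Hx.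
- by move=> s t /= t0; exact: Hy.
Qed.

Lemma homotopic_trans x y (q p r : path R x y) :
  homotopic p q -> homotopic q r -> homotopic p r.
Proof.
move=> [H [cH H0 H1 Hx Hy]] [K [cK K0 K1 Kx Ky]].
exists (fun st => if st.1 <= 2^-1 then H (2 * st.1 + 0, st.2)
                  else K (2 * st.1 + (-1), st.2)); split.
- apply: continuous_paste => //.
  + apply: continuous_compfun => //; apply: continuous_pairfun => //.
    exact: continuous_affine.
  + apply: continuous_compfun => //; apply: continuous_pairfun => //.
    exact: continuous_affine.
  + by move=> [s t] /= ->; rewrite divff ?pnatr_eq0// subrr addr0 H1 K0.
- by move=> t /=; rewrite ifT ?mulr0 ?addr0 ?H0//; lra.
- move=> t /=; rewrite ifF ?mulr1; last by apply/negbTE; rewrite -ltNge; lra.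
  by rewrite (_ : 2 - 1 = 1 :> R) ?K1//; lra.
- by move=> s t /= t0; case: ifP => _; [exact: Hx|exact: Kx].
- by move=> s t /= t0; case: ifP => _; [exact: Hy|exact: Ky].
Qed.

Lemma homotopic_cat x y z (p p' : path R x y) (q q' : path R y z) :
  homotopic p p' -> homotopic q q' ->
  homotopic (path_cat p q) (path_cat p' q').
Proof.
move=> [H [cH H0 H1 Hx Hy]] [K [cK K0 K1 Kx Ky]].
exists (fun st => if st.2 <= 2^-1 then H (st.1, 2 * st.2 + 0)
                  else K (st.1, 2 * st.2 + (-1))); split.
- apply: continuous_paste => //.
  + apply: continuous_compfun => //; apply: continuous_pairfun => //.
    exact: continuous_affine.
  + apply: continuous_compfun => //; apply: continuous_pairfun => //.
    exact: continuous_affine.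
  + by move=> [s t] /= ->; rewrite divff ?pnatr_eq0// subrr addr0 Hy// Kx.
- by move=> t /=; rewrite addr0 H0 K0.
- by move=> t /=; rewrite addr0 H1 K1.
- by move=> s t /= t0; rewrite ifT ?Hx//; lra.
- move=> s t /= t1; rewrite ifF ?Ky//; first lra.
  by apply/negbTE; rewrite -ltNge; lra.
Qed.

Lemma homotopic_inv x y (p q : path R x y) :
  homotopic p q -> homotopic (path_inv p) (path_inv q).
Proof.
move=> [H [cH H0 H1 Hx Hy]]; exists (fun st => H (st.1, -1 * st.2 + 1)); split.
- apply: continuous_compfun => //; apply: continuous_pairfun => //.
  exact: continuous_affine.
- by move=> t /=; rewrite H0; congr (p _); lra.
- by move=> t /=; rewrite H1; congr (q _); lra.
- by move=> s t /= t0; apply: Hy; lra.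
- by move=> s t /= t0; apply: Hx; lra.
Qed.

Let clamp (s : R) : R := Num.max 0 (Num.min 1 s).

Let clampc : continuous (fun z : R * R => clamp z.1).
Proof.
by apply: continuous_maxfun; [move=> z; exact: cvg_cst|
  apply: continuous_minfun => // z; exact: cvg_cst].
Qed.

Let clamp0 : clamp 0 = 0.
Proof. by rewrite /clamp min_r ?ler01// maxxx. Qed.

Let clamp1 : clamp 1 = 1.
Proof. by rewrite /clamp minxx max_r ?ler01. Qed.

Let clamp01 s : 0 <= clamp s <= 1.
Proof. by rewrite /clamp le_max lexx /= ge_max ler01 ge_min lexx. Qed.

Lemma homotopic_line x y w z (p : path R x y) (u v : R -> R) (q r : path R w z) :
  continuous u -> continuous v ->
  (forall t, p (u t) = q t) -> (forall t, p (v t) = r t) ->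
  (forall s t, 0 <= s <= 1 -> t <= 0 -> p (u t + s * (v t - u t)) = w) ->
  (forall s t, 0 <= s <= 1 -> 1 <= t -> p (u t + s * (v t - u t)) = z) ->
  homotopic q r.
Proof.
move=> cu cv uq vr pw pz.
exists (fun st => p (u st.2 + clamp st.1 * (v st.2 - u st.2))); split.
- apply: continuous_compfun; first exact: path_cts.
  have cu2 : continuous (fun st : R * R => u st.2) by exact: continuous_compfun.
  have cv2 : continuous (fun st : R * R => v st.2) by exact: continuous_compfun.
  move=> st; apply: cvgD; first exact: cu2.
  by apply: cvgM; [exact: clampc|apply: cvgB; [exact: cv2|exact: cu2]].
- by move=> t /=; rewrite clamp0 mul0r addr0.
- by move=> t /=; rewrite clamp1 mul1r addrC subrK.
- by move=> s t /= t0; rewrite pw.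
- by move=> s t /= t1; rewrite pz.
Qed.

Lemma homotopic_reparam x y (p q : path R x y) (u : R -> R) :
  continuous u -> (forall t, t <= 0 -> u t <= 0) ->
  (forall t, 1 <= t -> 1 <= u t) -> (forall t, p (u t) = q t) ->
  homotopic p q.
Proof.
move=> cu u0 u1 uq; apply: (@homotopic_line _ _ _ _ p id u) => //.
- move=> s t /andP[s0 s1] t0; apply: path_le0; have := u0 _ t0; nra.
- move=> s t /andP[s0 s1] t1; apply: path_ge1; have := u1 _ t1; nra.
Qed.

Lemma homotopic_cst_cat x y (p : path R x y) :
  homotopic (path_cat (path_cst x) p) p.
Proof.
apply: homotopic_sym; apply: (@homotopic_reparam _ _ _ _ (fun t => 2 * t + (-1))).
- exact: continuous_affine.
- by move=> t t0; lra.
- by move=> t t1; lra.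
- move=> t; rewrite /= /path_cat_fun; case: ifP => //= t2.
  by rewrite path_le0//; lra.
Qed.

Lemma homotopic_cat_cst x y (p : path R x y) :
  homotopic (path_cat p (path_cst y)) p.
Proof.
apply: homotopic_sym; apply: (@homotopic_reparam _ _ _ _ (fun t => 2 * t + 0)).
- exact: continuous_affine.
- by move=> t t0; lra.
- by move=> t t1; lra.
- move=> t; rewrite /= /path_cat_fun addr0; case: ifPn => //=.
  by rewrite -ltNge => t2; rewrite path_ge1//; lra.
Qed.

Lemma homotopic_catA x y z w (p : path R x y) (q : path R y z) (r : path R z w) :
  homotopic (path_cat p (path_cat q r)) (path_cat (path_cat p q) r).
Proof.
pose u (t : R) := Num.min (2 * t + 0) (Num.min (1 * t + 4^-1) (2^-1 * t + 2^-1)).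
have uE t : [\/ t <= 4^-1 /\ u t = 2 * t,
                4^-1 < t <= 2^-1 /\ u t = t + 4^-1 |
                2^-1 < t /\ u t = 2^-1 * t + 2^-1].
  rewrite /u; case: (leP t 4^-1) => t4.
    by apply: Or31; split=> //; rewrite !min_l ?addr0 //; lra.
  case: (leP t 2^-1) => t2.
    apply: Or32; split=> //.
    by rewrite (@min_l _ _ (1 * t + _)) ?min_r ?mul1r//; lra.
  apply: Or33; split=> //.
  by rewrite (@min_r _ _ (1 * t + _)) ?min_r//; lra.
apply: (@homotopic_reparam _ _ _ _ u).
- apply: continuous_minfun; first exact: continuous_affine.
  by apply: continuous_minfun; exact: continuous_affine.
- by move=> t t0; have [[? ->]|[? ->]|[? ->]] := uE t; lra.
- by move=> t t0; have [[? ->]|[? ->]|[? ->]] := uE t; lra.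
- move=> t; rewrite /= /path_cat_fun /= /path_cat_fun.
  have [[t4 ->]|[t4 ->]|[t2 ->]] := uE t.
  + have -> : 2 * t <= 2^-1 by lra.
    have -> : t <= 2^-1 by lra.
    by [].
  + have -> : (t + 4^-1 <= 2^-1) = false by apply/negbTE; rewrite -ltNge; lra.
    have -> : 2 * (t + 4^-1) - 1 <= 2^-1 by lra.
    have -> : t <= 2^-1 by lra.
    have -> : (2 * t <= 2^-1) = false by apply/negbTE; rewrite -ltNge; lra.
    by congr (q _); lra.
  + have -> : (2^-1 * t + 2^-1 <= 2^-1) = false.
      by apply/negbTE; rewrite -ltNge; lra.
    have -> : (2 * (2^-1 * t + 2^-1) - 1 <= 2^-1) = false.
      by apply/negbTE; rewrite -ltNge; lra.
    have -> : (t <= 2^-1) = false by apply/negbTE; rewrite -ltNge; lra.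
    by congr (r _); lra.
Qed.

Lemma homotopic_catV x y (p : path R x y) :
  homotopic (path_cat p (path_inv p)) (path_cst x).
Proof.
pose u (t : R) := Num.min (2 * t + 0) (-2 * t + 2).
have uE t : (t <= 2^-1 /\ u t = 2 * t) \/ (2^-1 < t /\ u t = 2 - 2 * t).
  rewrite /u; case: (leP t 2^-1) => t2; [left|right]; split => //.
    by rewrite min_l ?addr0 //; lra.
  by rewrite min_r; lra.
apply: (@homotopic_line _ _ _ _ p u (fun=> 0)).
- by apply: continuous_minfun; exact: continuous_affine.
- by move=> t; exact: cvg_cst.
- move=> t; rewrite /= /path_cat_fun /=; have [[t2 ->]|[t2 ->]] := uE t.
    by rewrite t2.
  rewrite ifF; last by apply/negbTE; rewrite -ltNge.
  by congr (p _); lra.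
- by move=> t /=; rewrite path_le0.
- by move=> s t /andP[s0 s1] t0; apply: path_le0; case: (uE t) => -[? ->]; nra.
- by move=> s t /andP[s0 s1] t1; apply: path_le0; case: (uE t) => -[? ->]; nra.
Qed.

Lemma homotopic_catVl x y (p : path R x y) :
  homotopic (path_cat (path_inv p) p) (path_cst y).
Proof.
apply: homotopic_trans (homotopic_catV (path_inv p)).
apply: homotopic_cat; first exact: homotopic_refl.
by apply: homotopic_eqfun => t /=; congr (p _); lra.
Qed.

End PathAlgebra.

Section FundamentalGroup.
Context (R : realType) {X : topologicalType}.

Definition loop_equiv (x : X) : rel (path R x x) :=
  fun p q => `[< homotopic p q >].

Lemma loop_equiv_is_equiv x : equiv_class_of (@loop_equiv x).
Proof.
split.
- by move=> p; apply/asboolP; exact: homotopic_refl.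
- by move=> p q; apply/asboolP/asboolP; exact: homotopic_sym.
- move=> q p r /asboolP pq /asboolP qr; apply/asboolP.
  exact: homotopic_trans pq qr.
Qed.

Canonical loop_equivalence x := EquivRelPack (loop_equiv_is_equiv x).

Definition pi1 (x : X) : Type := {eq_quot (@loop_equiv x)}.

HB.instance Definition _ x := Choice.on (pi1 x).
HB.instance Definition _ x := EqQuotient.on (pi1 x).

Definition pi1_class x (p : path R x x) : pi1 x := \pi_(pi1 x) p.

Lemma pi1_classP x (p q : path R x x) :
  pi1_class p = pi1_class q <-> homotopic p q.
Proof.
split; last by move=> pq; apply/eqmodP/asboolP.
by move=> /eqmodP/asboolP.
Qed.

Lemma pi1_reprK x (a : pi1 x) : pi1_class (repr a) = a.
Proof. exact: reprK. Qed.

Lemma pi1_repr_class x (p : path R x x) : homotopic (repr (pi1_class p)) p.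
Proof. by apply/pi1_classP; rewrite pi1_reprK. Qed.

Definition pi1_mul x (a b : pi1 x) : pi1 x :=
  pi1_class (path_cat (repr a) (repr b)).
Definition pi1_one x : pi1 x := pi1_class (path_cst x).
Definition pi1_inv x (a : pi1 x) : pi1 x := pi1_class (path_inv (repr a)).

Lemma pi1_mulE x (p q : path R x x) :
  pi1_mul (pi1_class p) (pi1_class q) = pi1_class (path_cat p q).
Proof. by apply/pi1_classP; apply: homotopic_cat; exact: pi1_repr_class. Qed.

Lemma pi1_invE x (p : path R x x) :
  pi1_inv (pi1_class p) = pi1_class (path_inv p).
Proof. by apply/pi1_classP; apply: homotopic_inv; exact: pi1_repr_class. Qed.

Lemma pi1_mulA x : associative (@pi1_mul x).
Proof.
move=> a b c; rewrite -[a]pi1_reprK -[b]pi1_reprK -[c]pi1_reprK !pi1_mulE.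
by apply/pi1_classP; exact: homotopic_catA.
Qed.

Lemma pi1_mul1 x : left_id (pi1_one x) (@pi1_mul x).
Proof.
move=> a; rewrite -[a]pi1_reprK /pi1_one !pi1_mulE.
by apply/pi1_classP; exact: homotopic_cst_cat.
Qed.

Lemma pi1_mulr1 x : right_id (pi1_one x) (@pi1_mul x).
Proof.
move=> a; rewrite -[a]pi1_reprK /pi1_one !pi1_mulE.
by apply/pi1_classP; exact: homotopic_cat_cst.
Qed.

Lemma pi1_mulV x : left_inverse (pi1_one x) (@pi1_inv x) (@pi1_mul x).
Proof.
move=> a; rewrite -[a]pi1_reprK pi1_invE !pi1_mulE.
by apply/pi1_classP; exact: homotopic_catVl.
Qed.

Lemma pi1_mulrV x : right_inverse (pi1_one x) (@pi1_inv x) (@pi1_mul x).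
Proof.
move=> a; rewrite -[a]pi1_reprK pi1_invE !pi1_mulE.
by apply/pi1_classP; exact: homotopic_catV.
Qed.

HB.instance Definition _ x := isGroup.Build (pi1 x)
  (@pi1_mulA x) (@pi1_mul1 x) (@pi1_mulr1 x) (@pi1_mulV x) (@pi1_mulrV x).

End FundamentalGroup.

Section InducedMap.
Context (R : realType) {X Y : topologicalType} (f : continuousType X Y).

Section PathMap.
Variables (x y : X) (p : path R x y).

Let map_cts : continuous (fun t => f (p t)).
Proof. by apply: continuous_compfun; [exact: cts_fun|exact: path_cts]. Qed.

Let map_le0 t : t <= 0 -> f (p t) = f x.
Proof. by move=> t0; rewrite path_le0. Qed.

Let map_ge1 t : 1 <= t -> f (p t) = f y.
Proof. by move=> t1; rewrite path_ge1. Qed.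

Definition path_map : path R (f x) (f y) := Path map_cts map_le0 map_ge1.
End PathMap.

Lemma homotopic_map x y (p q : path R x y) :
  homotopic p q -> homotopic (path_map p) (path_map q).
Proof.
move=> [H [cH H0 H1 Hx Hy]]; exists (fun st => f (H st)); split.
- by apply: continuous_compfun => //; exact: cts_fun.
- by move=> t; rewrite H0.
- by move=> t; rewrite H1.
- by move=> s t t0; rewrite Hx.
- by move=> s t t1; rewrite Hy.
Qed.

Definition pi1_map (x : X) (a : pi1 R x) : pi1 R (f x) :=
  pi1_class (path_map (repr a)).

Lemma pi1_mapE x (p : path R x x) :
  pi1_map (pi1_class p) = pi1_class (path_map p).
Proof. by apply/pi1_classP; apply: homotopic_map; exact: pi1_repr_class. Qed.

Lemma pi1_mapM x : {morph @pi1_map x : a b / (a * b)%g >-> (a * b)%g}.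
Proof.
move=> a b; rewrite -[a]pi1_reprK -[b]pi1_reprK.
rewrite -[LHS]/(pi1_map (pi1_mul _ _)) -[RHS]/(pi1_mul _ _).
rewrite pi1_mulE !pi1_mapE pi1_mulE; apply/pi1_classP.
by apply: homotopic_eqfun => t /=; rewrite /path_cat_fun; case: ifP.
Qed.

HB.instance Definition _ x :=
  isMultiplicative.Build (pi1 R x) (pi1 R (f x)) (@pi1_map x) (@pi1_mapM x).

End InducedMap.

Section Inclusions.
Context {X : topologicalType}.

Definition set_incl (A : set X) : A -> X := set_val.

Lemma set_incl_continuous (A : set X) : continuous (@set_incl A).
Proof. exact: initial_continuous. Qed.

HB.instance Definition _ (A : set X) :=
  isContinuous.Build A X (@set_incl A) (@set_incl_continuous A).

Definition sub_incl (A B : set X) (AB : A `<=` B) (a : A) : B :=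
  exist _ (val a) (mem_set (AB _ (set_mem (valP a)))).

Lemma sub_incl_continuous (A B : set X) (AB : A `<=` B) :
  continuous (sub_incl AB).
Proof.
apply/continuousP => _ [V oV <-].
by move/continuousP: (@set_incl_continuous A); exact.
Qed.

HB.instance Definition _ (A B : set X) (AB : A `<=` B) :=
  isContinuous.Build A B (@sub_incl A B AB) (@sub_incl_continuous A B AB).

End Inclusions.

Definition path_connected (R : realType) (X : topologicalType) :=
  forall x y : X, inhabited (path R x y).

Definition simply_connected (R : realType) (X : topologicalType) :=
  path_connected R X /\ forall (x : X) (a : pi1 R x), a = 1%g.

Definition torsion_free (G : groupType) :=
  forall (a : G) (k : nat), (0 < k)%N -> (a ^+ k)%g = 1%g -> a = 1%g.

Definition incompressible (R : realType) (X : topologicalType) (S : set X) :=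
  forall x : S, injective (@pi1_map R _ _ (@set_incl X S) x).

Definition totally_compressible (R : realType) (X : topologicalType)
    (S : set X) :=
  forall (x : S) (a : pi1 R x), pi1_map (@set_incl X S) a = 1%g.

Section Groups.

Definition is_subgroup (G : groupType) (K : set G) :=
  K 1%g /\ forall a b, K a -> K b -> K (a * b^-1)%g.

Definition is_normal_subgroup (G : groupType) (K : set G) :=
  is_subgroup K /\ forall a g, K a -> K (a ^ g)%g.

Definition normally_generates (G : groupType) (S : set G) :=
  smallest (@is_normal_subgroup G) S = setT.

Definition group_iso (G H : groupType) :=
  exists f : {multiplicative G -> H}, bijective f.

Definition derived (G : groupType) : set G :=
  smallest (@is_subgroup G) [set c | exists a b : G, c = [~ a, b]%g].
Arguments derived G : clear implicits.

Section Derived.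
Variable G : groupType.

Lemma derived_group : is_subgroup (derived G).
Proof.
split; first by move=> K [[]].
by move=> a b da db K KS; apply: (KS.1).2; [exact: da|exact: db].
Qed.

Lemma derived_comm (a b : G) : derived G [~ a, b]%g.
Proof. by move=> K [_]; apply; exists a, b. Qed.

Lemma derived_conj (a g : G) : derived G a -> derived G (a ^ g)%g.
Proof.
move=> da.
have -> : (a ^ g = a * [~ a, g])%g by rewrite commgEl mulgA mulgV mul1g.
have [d1 dM] := derived_group.
rewrite -[[~ a, g]%g]invgK; apply: (dM) => //.
by rewrite -[X in derived G X]mul1g; apply: dM => //; exact: derived_comm.
Qed.

Definition in_derived : {pred G} := mem (derived G).

Lemma in_derived_group_closed : group_closed in_derived.
Proof.
have [d1 dM] := derived_group.
split; first exact/mem_set.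
by move=> a b /set_mem da /set_mem db; apply/mem_set; exact: dM.
Qed.

Record derived_type := DerivedType {
  derived_val :> G; _ : derived_val \in in_derived }.

HB.instance Definition _ := [isSub for derived_val].
HB.instance Definition _ := [Choice of derived_type by <:].
HB.instance Definition _ := SubChoice_isSubGroup.Build
  G in_derived derived_type in_derived_group_closed.

End Derived.

Record group_action (H K : groupType) := GroupAction {
  gact :> H -> K -> K;
  gactg1 : forall k, gact 1%g k = k;
  gactgM : forall h h' k, gact (h * h')%g k = gact h (gact h' k);
  gactM : forall h k k', gact h (k * k')%g = (gact h k * gact h k')%g }.

(* Pairs (k, h) stand for k h: (k, h) (k', h') = (k . h(k'), h h'). *)
Definition semidirect (H K : groupType) (act : group_action H K) : Type :=
  (K * H)%type.

Section Semidirect.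
Variables (H K : groupType) (act : group_action H K).

Local Notation sd := (semidirect act).

HB.instance Definition _ := Choice.copy sd (K * H)%type.

Definition sd_mul (a b : sd) : sd := (a.1 * act a.2 b.1, a.2 * b.2)%g.
Definition sd_one : sd := (1, 1)%g.
Definition sd_inv (a : sd) : sd := (act a.2^-1 a.1^-1, a.2^-1)%g.

Let gact1 h : act h 1%g = 1%g.
Proof. by apply: (mulgI (act h 1%g)); rewrite -gactM !mulg1. Qed.

Lemma sd_mulA : associative sd_mul.
Proof. by move=> a b c; rewrite /sd_mul /= gactM gactgM !mulgA. Qed.

Lemma sd_mul1 : left_id sd_one sd_mul.
Proof. by case=> k h; rewrite /sd_mul /= gactg1 !mul1g. Qed.

Lemma sd_mulr1 : right_id sd_one sd_mul.
Proof. by case=> k h; rewrite /sd_mul /= gact1 !mulg1. Qed.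

Lemma sd_mulV : left_inverse sd_one sd_inv sd_mul.
Proof. by case=> k h; rewrite /sd_mul /= -gactM !mulVg gact1. Qed.

Lemma sd_mulrV : right_inverse sd_one sd_inv sd_mul.
Proof.
by case=> k h; rewrite /sd_mul /sd_inv /= -gactgM mulgV gactg1 mulgV.
Qed.

HB.instance Definition _ := isGroup.Build sd
  sd_mulA sd_mul1 sd_mulr1 sd_mulV sd_mulrV.

Definition sd_inr (h : H) : sd := (1, h)%g.

End Semidirect.

(* A morphism f : H -> G lets H act on [G, G] by k |-> f(h) k f(h)^-1; recall
   that k ^ g stands for g^-1 k g. *)
Section ConjAction.
Variables (H G : groupType) (f : {multiplicative H -> G}).

Let conj_in (h : H) (k : derived_type G) :
  ((k : G) ^ (f h)^-1)%g \in @in_derived G.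
Proof. by apply/mem_set; apply: derived_conj; exact: set_mem (valP k). Qed.

Definition conj_fun (h : H) (k : derived_type G) : derived_type G :=
  DerivedType (conj_in h k).

Let conj1 k : conj_fun 1%g k = k.
Proof.
have f1 : f 1%g = 1%g by apply: (mulgI (f 1%g)); rewrite -gmulfM !mulg1.
by apply: val_inj; rewrite /= f1 invg1 conjg1.
Qed.

Let conjM h h' k : conj_fun (h * h')%g k = conj_fun h (conj_fun h' k).
Proof. by apply: val_inj; rewrite /= gmulfM invgM conjgM. Qed.

Let conj_morph h k k' : conj_fun h (k * k')%g = (conj_fun h k * conj_fun h k')%g.
Proof. by apply: val_inj; rewrite /= conjMg. Qed.

Definition conj_action : group_action H (derived_type G) :=
  GroupAction conj1 conjM conj_morph.

End ConjAction.

End Groups.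

Lemma continuous_mx (Z T : topologicalType) (m n : nat) (f : Z -> 'M[T]_(m, n)) :
  (forall i j, continuous (fun z => f z i j)) -> continuous f.
Proof.
move=> cf z A [P fP PA].
suff : \forall y \near z, forall i j, P i j (f y i j).
  by apply: filterS => y Py; apply: PA => i j; exact: Py.
by apply: filter_forall => i; apply: filter_forall => j; exact: (cf i j z _ (fP i j)).
Qed.

Section SingularHomology.
Context (R : realType).

Definition std_simplex (k : nat) : set 'rV[R]_k.+1 :=
  [set v | (forall i, 0 <= v 0 i) /\ \sum_i v 0 i = 1].
Arguments std_simplex k : clear implicits.

Definition coface_row (k : nat) (i : 'I_k.+2) (v : 'rV[R]_k.+1) :
    'rV[R]_k.+2 :=
  \row_j (if unlift i j is Some j' then v 0 j' else 0).

Lemma coface_in (k : nat) (i : 'I_k.+2) (v : std_simplex k) :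
  coface_row i (val v) \in std_simplex k.+1.
Proof.
have [v0 v1] := set_mem (valP v); apply/mem_set; split.
  by move=> j; rewrite mxE; case: unlift.
rewrite (bigD1_ord i)//= mxE unlift_none add0r -[RHS]v1.
by apply: eq_bigr => j _; rewrite mxE liftK.
Qed.

Definition coface (k : nat) (i : 'I_k.+2) (v : std_simplex k) :
    std_simplex k.+1 :=
  exist _ (coface_row i (val v)) (coface_in i v).

Lemma coface_continuous (k : nat) (i : 'I_k.+2) : continuous (coface i).
Proof.
apply/continuousP => _ [V oV <-].
suff : continuous (fun v : std_simplex k => coface_row i (val v)).
  by move/continuousP; exact.
apply: continuous_mx => i0 j; case: (unliftP i j) => [j' ->|->].
- rewrite (_ : (fun z => _) = fun v : std_simplex k => (val v : 'rV_k.+1) 0 j').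
    apply: (@continuous_compfun _ _ _ (fun M : 'rV[R]_k.+1 => M 0 j')
      (@set_incl _ (std_simplex k))).
      exact: coord_continuous.
    exact: set_incl_continuous.
  by apply/funext => v; rewrite mxE liftK.
- have -> : (fun v : std_simplex k => coface_row i (val v) i0 i) = fun=> 0.
    by apply/funext => v; rewrite mxE unlift_none.
  exact: cst_continuous.
Qed.

HB.instance Definition _ (k : nat) (i : 'I_k.+2) :=
  isContinuous.Build (std_simplex k) (std_simplex k.+1) (@coface k i)
    (@coface_continuous k i).

Definition singular_simplex (k : nat) (X : topologicalType) : Type :=
  continuousType (std_simplex k) X.

HB.instance Definition _ (k : nat) (X : topologicalType) :=
  gen_eqMixin (singular_simplex k X).
HB.instance Definition _ (k : nat) (X : topologicalType) :=
  gen_choiceMixin (singular_simplex k X).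

Section Chains.
Variable X : topologicalType.

Definition chain (k : nat) : Type := {freeg (singular_simplex k X) / int}.

HB.instance Definition _ k := GRing.Lmodule.on (chain k).

Definition face (k : nat) (i : 'I_k.+2)
    (s : singular_simplex k.+1 X) : singular_simplex k X :=
  [the continuousType (std_simplex k) X of
     (s : continuousType (std_simplex k.+1) X) \o coface i].

Definition chain_boundary (k : nat) (c : chain k.+1) : chain k :=
  fglift (fun s : singular_simplex k.+1 X =>
    \sum_(i < k.+2) (<< (-1) ^+ i *g face i s >> : chain k)) c.

Lemma chain_boundary_zmod_morphism k : zmod_morphism (@chain_boundary k).
Proof. exact: lift_is_additive. Qed.

HB.instance Definition _ k := GRing.isZmodMorphism.Build (chain k.+1) (chain k)
  (@chain_boundary k) (@chain_boundary_zmod_morphism k).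

Definition is_cycle : {pred chain 1} := fun c => chain_boundary c == 0.

Lemma is_cycle_zmod : zmod_closed is_cycle.
Proof.
split; first by rewrite unfold_in raddf0.
move=> a b /eqP a0 /eqP b0; apply/eqP.
by rewrite raddfB; move: a0 b0 => /= -> ->; rewrite subrr.
Qed.

HB.instance Definition _ := GRing.isZmodClosed.Build (chain 1) is_cycle
  is_cycle_zmod.

Record cycle1 := Cycle1 { cycle1_chain :> chain 1; _ : cycle1_chain \in is_cycle }.

HB.instance Definition _ := [isSub for cycle1_chain].
HB.instance Definition _ := [Choice of cycle1 by <:].
HB.instance Definition _ := [SubChoice_isSubZmodule of cycle1 by <:].

Definition is_boundary : {pred cycle1} :=
  fun z => `[< exists c : chain 2, chain_boundary c = z :> chain 1 >].

Lemma is_boundary_zmod : zmod_closed is_boundary.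
Proof.
split; first by apply/asboolP; exists 0; rewrite raddf0.
move=> a b /asboolP[c ca] /asboolP[d db]; apply/asboolP; exists (c - d).
by rewrite raddfB /= ca db.
Qed.

HB.instance Definition _ := GRing.isZmodClosed.Build cycle1 is_boundary
  is_boundary_zmod.

Definition H1 : zmodType := Quotient.quot is_boundary.

End Chains.
End SingularHomology.

Definition zmod_iso (U V : zmodType) :=
  exists f : {additive U -> V}, bijective f.

Section SmoothMaps.
Context {R : realType} {m k : nat}.

(* Only meaningful for U open: the partial derivatives are then those of f. *)
Fixpoint Ck_on (r : nat) (U : set 'rV[R]_m) (f : 'rV[R]_m -> 'rV[R]_k) : Prop :=
  if r is r'.+1 then
    (forall x, U x -> differentiable f x) /\
    (forall v, Ck_on r' U (fun x => 'D_v f x))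
  else forall x, U x -> {for x, continuous f}.

Definition smooth_on (U : set 'rV[R]_m) (f : 'rV[R]_m -> 'rV[R]_k) : Prop :=
  forall r, Ck_on r U f.

Lemma smooth_on_cst U (c : 'rV[R]_k) : smooth_on U (fun=> c).
Proof.
move=> r; elim: r c => [|r IH] c /=; first by move=> x _; exact: cst_continuous.
split=> [x _|v]; first exact: differentiable_cst.
have -> : (fun x => 'D_v (fun=> c) x) = (fun=> 0) :> ('rV[R]_m -> 'rV[R]_k).
  by apply/funext => x; exact: derive_cst.
exact: IH.
Qed.

End SmoothMaps.

Lemma smooth_on_id (R : realType) (m : nat) (U : set 'rV[R]_m) :
  smooth_on U (fun x : 'rV[R]_m => x).
Proof.
case=> [|r] /=; first by move=> x _; exact: cvg_id.
split=> [x _|v]; first by apply: ex_diff.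
have -> : (fun x => 'D_v (fun y : 'rV[R]_m => y) x) = fun=> v.
  by apply/funext => x; exact: derive_id.
exact: smooth_on_cst.
Qed.

Record chart (R : realType) (X : topologicalType) (m : nat) := Chart {
  chart_dom : set X;
  chart_cod : set 'rV[R]_m;
  chart_fun :> X -> 'rV[R]_m;
  chart_inv : 'rV[R]_m -> X;
  chart_dom_open : open chart_dom;
  chart_cod_open : open chart_cod;
  chart_funP : forall x, chart_dom x -> chart_cod (chart_fun x);
  chart_invP : forall u, chart_cod u -> chart_dom (chart_inv u);
  chart_funK : forall x, chart_dom x -> chart_inv (chart_fun x) = x;
  chart_invK : forall u, chart_cod u -> chart_fun (chart_inv u) = u;
  chart_fun_cts : forall x, chart_dom x -> {for x, continuous chart_fun};
  chart_inv_cts : forall u, chart_cod u -> {for u, continuous chart_inv} }.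

Definition chart_overlap (R : realType) (X : topologicalType) (m : nat)
    (c d : chart R X m) : set 'rV[R]_m :=
  [set u | chart_cod c u /\ chart_dom d (chart_inv c u)].

Record manifold (R : realType) (m : nat) := Manifold {
  manifold_sort :> topologicalType;
  atlas : set (chart R manifold_sort m);
  manifold_hausdorff : hausdorff_space manifold_sort;
  manifold_second_countable : @second_countable manifold_sort;
  atlas_cover : forall x, exists2 c, atlas c & chart_dom c x;
  atlas_smooth : forall c d, atlas c -> atlas d ->
    smooth_on (chart_overlap c d) (fun u => d (chart_inv c u)) }.

Section Euclidean.
Context (R : realType) (m : nat).

Lemma rV_second_countable : @second_countable 'rV[R]_m.
Proof.
pose b (qk : 'rV[rat]_m * nat) : set 'rV[R]_m :=
  ball (map_mx ratr qk.1 : 'rV[R]_m) (qk.2.+1%:R^-1).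
exists (range b).
  apply: (sub_countable (card_image_le b setT)).
  exact: (@countableP ('rV[rat]_m * nat)%type).
split=> [_ [qk _ <-]|x]; first exact: ball_open.
move=> U /nbhs_ballP[e /= e0 eU].
have [k ke] : exists k : nat, k.+1%:R^-1 < e / 2.
  have e20 : 0 < e / 2 by rewrite divr_gt0.
  exists (Num.truncn (e / 2)^-1); rewrite invf_plt ?posrE//.
  exact: truncnS_gt.
have k0 : 0 < k.+1%:R^-1 :> R by rewrite invr_gt0.
have qP i : exists q : rat, ball (ratr q : R) k.+1%:R^-1 (x 0 i).
  have [|q] := @rat_in_itvoo R (x 0 i - k.+1%:R^-1) (x 0 i + k.+1%:R^-1).
    by rewrite ltrD2l gt0_cp.
  rewrite in_itv /= => /andP[q1 q2]; exists q.
  by rewrite /ball /= ltr_distl q1.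
have [q {}qP] := choice qP.
exists (b (\row_i q i, k)); first split; first by exists (\row_i q i, k).
  by split=> // i j; rewrite !mxE ord1; exact: qP.
move=> y [_ by_]; apply: eU; split=> // i j.
have := by_ i j; have := qP j; rewrite !mxE (ord1 i) /ball /= !ltr_distl.
move=> /andP[q1 q2] /andP[q3 q4].
by apply/andP; move: q1 q2 q3 q4 ke; set a := _^-1 => *; split; lra.
Qed.

Definition euclidean_chart : chart R 'rV[R]_m m :=
  @Chart R 'rV[R]_m m setT setT id id openT openT
    (fun _ _ => I) (fun _ _ => I) (fun _ _ => erefl) (fun _ _ => erefl)
    (fun _ _ _ h => h) (fun _ _ _ h => h).

Lemma euclidean_cover (x : 'rV[R]_m) :
  exists2 c, [set euclidean_chart] c & chart_dom c x.
Proof. by exists euclidean_chart. Qed.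

Lemma euclidean_smooth (c d : chart R 'rV[R]_m m) :
  [set euclidean_chart] c -> [set euclidean_chart] d ->
  smooth_on (chart_overlap c d) (fun u => d (chart_inv c u)).
Proof. by move=> -> ->; exact: smooth_on_id. Qed.

Definition euclidean : manifold R m :=
  @Manifold R m 'rV[R]_m [set euclidean_chart] (@norm_hausdorff _ _)
    rV_second_countable euclidean_cover euclidean_smooth.

End Euclidean.

Section ManifoldMaps.
Context {R : realType}.

Section Maps.
Context {m k : nat} {M : manifold R m} {N : manifold R k}.

Definition local_rep (c : chart R M m) (d : chart R N k) (f : M -> N) :
    'rV[R]_m -> 'rV[R]_k := fun u => d (f (chart_inv c u)).

Definition local_rep_dom (c : chart R M m) (d : chart R N k) (f : M -> N) :
    set 'rV[R]_m :=
  [set u | chart_cod c u /\ chart_dom d (f (chart_inv c u))].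

Definition smooth_map_on (U : set M) (f : M -> N) : Prop :=
  (forall x, U x -> {for x, continuous f}) /\
  forall c d, atlas c -> atlas d ->
    smooth_on (local_rep_dom c d f `&` chart_inv c @^-1` U) (local_rep c d f).

Definition smooth_map (f : M -> N) : Prop := smooth_map_on setT f.

Definition immersion (f : M -> N) : Prop :=
  smooth_map f /\
  forall c d, atlas c -> atlas d -> forall u, local_rep_dom c d f u ->
    injective ('d (local_rep c d f) u).

End Maps.

Definition diffeomorphism (m : nat) (M : manifold R m) (g : M -> M) : Prop :=
  smooth_map g /\ exists2 h : M -> M, smooth_map h & cancel g h /\ cancel h g.

Definition smooth_covering (m : nat) (M' M : manifold R m) (p : M' -> M) : Prop :=
  [/\ smooth_map p, set_surj setT setT p &
    forall y : M, exists U : set M, [/\ open U, U y &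
      exists F : set (set M'),
        [/\ trivIset F id,
            p @^-1` U = \bigcup_(V in F) V &
            forall V, F V -> open V /\
              exists s : M -> M', [/\ smooth_map_on U s,
                forall x, U x -> V (s x) /\ p (s x) = x &
                forall x, V x -> s (p x) = x]]]].

Definition universal_covering (m : nat) (M' M : manifold R m) (p : M' -> M) :=
  smooth_covering p /\ simply_connected R M'.

Record riemannian_metric (m : nat) (M : manifold R m) := RiemannianMetric {
  metric_mx : chart R M m -> 'rV[R]_m -> 'M[R]_m;
  metric_smooth : forall c, atlas c -> forall i,
    smooth_on (chart_cod c) (fun u => row i (metric_mx c u));
  metric_sym : forall c, atlas c -> forall u, chart_cod c u ->
    (metric_mx c u)^T = metric_mx c u;
  metric_pos : forall c, atlas c -> forall u, chart_cod c u ->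
    forall v : 'rV[R]_m, v != 0 -> 0 < (v *m metric_mx c u *m v^T) 0 0;
  metric_compat : forall c d, atlas c -> atlas d ->
    forall u, chart_overlap c d u ->
    let J := 'J (fun u => d (chart_inv c u)) u in
    metric_mx c u = J *m metric_mx d (d (chart_inv c u)) *m J^T }.

(* A smooth embedding of the standard torus R^n / Z^n, given through its
   composition with the quotient map R^n -> R^n / Z^n. The torus being compact,
   an injective immersion of it is an embedding. *)
Definition torus_embedding (n m : nat) (M : manifold R m) (e : 'rV[R]_n -> M) :
    Prop :=
  immersion (e : euclidean R n -> M) /\
  forall x y, e x = e y <-> exists z : 'rV[int]_n, y = x + map_mx intr z.

Definition embedded_torus (n m : nat) (M : manifold R m) (T : set M) : Prop :=
  exists e : 'rV[R]_n -> M, torus_embedding e /\ range e = T.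

End ManifoldMaps.

Definition hyperbolic (n : nat) (A : 'M[int]_n) : Prop :=
  forall z : algC, eigenvalue (map_mx intr A) z -> `|z| != 1.

Definition stable_space (R : realType) (n : nat) (B : 'M[R]_n) : set 'cV[R]_n :=
  [set v | (fun k => B ^+ k *m v) @ \oo --> (0 : 'cV[R]_n)].

Definition unstable_space (R : realType) (n : nat) (B : 'M[R]_n) :
    set 'cV[R]_n :=
  stable_space (invmx B).

Definition one_dimensional (R : realType) (n : nat) (E : set 'cV[R]_n) : Prop :=
  exists2 v, v != 0 & E = range (fun a : R => a *: v).

Section Anosov.
Context {R : realType}.

(* The fundamental group of a torus is abelian, so that f_* is a well defined
   endomorphism of it although f may move the base point. *)
Definition acts_by (X : topologicalType) (f : continuousType X X) (n : nat)
    (A : 'M[int]_n) : Prop :=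
  exists (x : X) (c : path R x (f x)) (phi : pi1 R x -> 'cV[int]_n),
    [/\ bijective phi,
        {morph phi : a b / (a * b)%g >-> a + b} &
        forall l : path R x x,
          phi (pi1_class (path_cat (path_cat c (path_map f l)) (path_inv c))) =
          A *m phi (pi1_class l)].

Context (n m : nat) (M : manifold R m) (T : set M).

Definition anosov_with (A : 'M[int]_n) : Prop :=
  [/\ embedded_torus n T, hyperbolic A &
      exists g : M -> M, [/\ diffeomorphism g, g @` T = T &
        exists2 gT : continuousType T T,
          (forall x : T, val (gT x) = g (val x)) & acts_by gT A]].

Definition anosov_torus : Prop := exists A, anosov_with A.

Definition irreducible_anosov_torus : Prop :=
  exists2 A, anosov_with A &
    irreducible_poly (map_poly intr (char_poly A) : {poly rat}).

Definition codimension_one_anosov_torus : Prop :=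
  exists2 A, anosov_with A &
    one_dimensional (stable_space (map_mx intr A : 'M[R]_n)) \/
    one_dimensional (unstable_space (map_mx intr A : 'M[R]_n)).

End Anosov.

(* For a compact region N of the sphere with smooth boundary, the manifold
   boundary is the topological one. *)
Definition bd (X : topologicalType) (N : set X) : set X := N `\` interior N.

Lemma bd_sub (X : topologicalType) (N : set X) : bd N `<=` N.
Proof. by move=> x []. Qed.

(* The map pi_1(bd N) -> pi_1(N) induced by the inclusion. *)
Definition bd_pi1 (R : realType) (X : topologicalType) (N : set X) (b : bd N) :
    {multiplicative pi1 R b -> pi1 R (sub_incl (@bd_sub X N) b)} :=
  [the {multiplicative _ -> _} of @pi1_map R _ _ (sub_incl (@bd_sub X N)) b].

Definition incompressible_bd (R : realType) (X : topologicalType) (N : set X) :=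
  forall b : bd N, injective (@bd_pi1 R X N b).

Definition topological_embedding (X Y : topologicalType) (f : X -> Y) : Prop :=
  injective f /\
  forall U : set X, open U <-> exists2 V : set Y, open V & U = f @^-1` V.

(* The set S has exactly two complementary components, C1 and C2. *)
Definition splits_into (X : topologicalType) (S C1 C2 : set X) : Prop :=
  [/\ exists2 x, ~ S x & C1 = connected_component (~` S) x,
      exists2 x, ~ S x & C2 = connected_component (~` S) x,
      C1 `&` C2 = set0 & C1 `|` C2 = ~` S].

Section Lifts.
Context {R : realType} {n : nat}.

Definition sphere : topologicalType := one_point_compactification 'rV[R]_n.+1.

Context {M : manifold R n.+1} {T : set M}.

Definition is_lift (p : euclidean R n.+1 -> M) (l : T -> euclidean R n.+1) :
    Prop :=
  continuous l /\ forall x : T, p (l x) = val x.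

Definition to_sphere (l : T -> euclidean R n.+1) : T -> sphere :=
  fun x => Some (l x).

Definition embeds_in_sphere (l : T -> euclidean R n.+1) : Prop :=
  embedded_torus n (range l) /\ topological_embedding (to_sphere l).

End Lifts.

Arguments sphere R n : clear implicits.

(* Main.v *)
(** Alternative (a) always holds. Suppose that [T] is compressible. The kernel of
    [pi_1 T -> pi_1 M] is invariant under the Anosov matrix and, [pi_1 M] being
    torsion-free, saturated, hence by irreducibility it is the whole group. So
    [T] lifts to a closed hypersurface of the universal cover, which separates it
    into two sides, each preserved by a lift of the diffeomorphism. A class in
    [H^1(T)] is a circle-valued map. By Mayer-Vietoris each class is the sum of a
    class extending to one side and a class extending to the other; the classes
    extending to a given side form an invariant subgroup, and no nonzero class
    extends to both. By irreducibility all classes extend to one and the same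
    side. The [n] coordinates of the torus then extend together, to a retraction
    of this side onto the torus; with the identity on the other side this
    contradicts Brouwer's theorem.

    In codimension one, suppose that the characteristic polynomial factors. The
    factors have constant term 1 or -1, so that by hyperbolicity and Kronecker's
    theorem each has roots on both sides of the unit circle, and both the stable
    and the unstable space have dimension at least two. *)

From HB Require Import structures.
From mathcomp Require Import all_boot all_order all_fingroup all_algebra all_field generic_quotient.
From mathcomp Require Import all_classical all_reals all_analysis.
From mathcomp Require Import lra ring zify complex.
Require Import Defs.

Set Implicit Arguments.
Unset Strict Implicit.
Unset Printing Implicit Defensive.

Import Order.TTheory GRing.Theory Num.Theory.
Import numFieldNormedType.Exports.

Local Open Scope classical_set_scope.
Local Open Scope ring_scope.

(** Cohomology in degree one enters only through real functions that are continuous modulo the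
    integers. This makes three facts instances of a single continuation principle over star-shaped
    sets, [monodromy]: maps from a vector space lift through a covering, circle-valued maps on it
    lift to real ones, and a closed hypersurface has a global side function. The class of a
    circle-valued function on a side is read off from its windings along loops of the torus. When it
    vanishes, the function lifts on the torus to a real function, which Tietze's theorem extends to
    all of space; so a summand on the side without classes can be moved to the other side, one
    coordinate at a time.

    The unbounded side is the harder one, as a retraction of it onto the torus need not extend to
    infinity. It is first made constant far away, which uses that the exterior of a ball is simply
    connected, hence that n is at least 2. An inversion then exchanges infinity with a point of the
    bounded side. Brouwer's theorem itself comes from a cubical Sperner lemma modulo 2, since grids
    of points and the supremum norm fit row vectors. *)

Section ModuleIdentities.
Context {R : pzRingType} {V : lmodType R}.

Inductive mexp :=
  MVar of nat | MZero | MAdd of mexp & mexp | MOpp of mexp | MScale of R & mexp.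

Fixpoint meval (env : seq V) (e : mexp) : V :=
  match e with
  | MVar i => nth 0 env i
  | MZero => 0
  | MAdd a b => meval env a + meval env b
  | MOpp a => - meval env a
  | MScale r a => r *: meval env a
  end.

(** Indices are compared by [Nat.eqb] because it reduces on closed numerals, so that [lmodule] can
    compute the coefficients and leave pure ring identities. *)
Fixpoint mcoef (e : mexp) (j : nat) : R :=
  match e with
  | MVar i => if Nat.eqb i j then 1 else 0
  | MZero => 0
  | MAdd a b => mcoef a j + mcoef b j
  | MOpp a => - mcoef a j
  | MScale r a => r * mcoef a j
  end.

Lemma mevalE (env : seq V) e :
  meval env e = \sum_(i < size env) mcoef e i *: nth 0 env i.
Proof.
elim: e => [i||a IHa b IHb|a IHa|r a IHa] /=.
- have eqbE j : Nat.eqb i j = (i == j).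
    by apply/idP/eqP => [/PeanoNat.Nat.eqb_eq|->] //; apply/PeanoNat.Nat.eqb_eq.
  case: (ltnP i (size env)) => h.
    rewrite (bigD1 (Ordinal h)) //= eqbE eqxx scale1r big1 ?addr0// => j ji.
    rewrite eqbE ifF ?scale0r//; apply/negbTE; apply: contraNneq ji => ij.
    by apply/eqP/val_inj.
  rewrite nth_default// big1// => j _; rewrite eqbE ifF ?scale0r//.
  by apply/negbTE; rewrite gtn_eqF// (leq_trans (ltn_ord j)).
- by rewrite big1// => j _; rewrite scale0r.
- by rewrite IHa IHb -big_split; apply: eq_bigr => j _; rewrite scalerDl.
- by rewrite IHa -sumrN; apply: eq_bigr => j _; rewrite scaleNr.
- by rewrite IHa scaler_sumr; apply: eq_bigr => j _; rewrite scalerA.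
Qed.

Fixpoint mcoefs_eq (e e' : mexp) (n : nat) : Prop :=
  if n is m.+1 then mcoef e m = mcoef e' m /\ mcoefs_eq e e' m else True.

Lemma meval_eq (env : seq V) e e' :
  mcoefs_eq e e' (size env) -> meval env e = meval env e'.
Proof.
move=> h; rewrite !mevalE; apply: eq_bigr => i _; congr (_ *: _).
elim: (size env) i h => [|m IH] [i /= hi] // [hm h].
move: hi; rewrite ltnS leq_eqVlt => /orP[/eqP->//|hi].
exact: (IH (Ordinal hi)).
Qed.

End ModuleIdentities.

Ltac mfind env x :=
  lazymatch env with
  | x :: _ => constr:(O)
  | _ :: ?l => let i := mfind l x in constr:(S i)
  end.

Ltac mreify R env e :=
  lazymatch e with
  | ?a + ?b => let a' := mreify R env a in let b' := mreify R env b in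
               constr:(@MAdd R a' b')
  | - ?a => let a' := mreify R env a in constr:(@MOpp R a')
  | ?r *: ?a => let a' := mreify R env a in constr:(@MScale R r a')
  | 0 => constr:(@MZero R)
  | ?x => let i := mfind env x in constr:(@MVar R i)
  end.

(* [env] lists the atomic vectors; comparing coefficients leaves goals for [ring]. *)
Ltac lmodule R env :=
  lazymatch goal with
  | |- ?a = ?b =>
    let a' := mreify R env a in let b' := mreify R env b in
    refine (@meval_eq R _ env a' b' _);
    cbv [mcoefs_eq mcoef Nat.eqb size];
    repeat split; ring
  end.

(** * Continuation of local sections along segments *)

(** Connectedness of the unit interval as a propagation principle. The supremum of the parameters
    where [P] holds is approached by one of them, from which [P] passes to 1 or to a parameter
    beyond the supremum. *)
Lemma chain01 (R : realType) (P : R -> Prop) :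
  P 0 ->
  (forall t, 0 <= t <= 1 -> exists2 d, 0 < d &
     forall s s', 0 <= s <= 1 -> 0 <= s' <= 1 ->
       `|s - t| < d -> `|s' - t| < d -> P s -> P s') ->
  P 1.
Proof.
move=> P0 step; pose A : set R := [set t | 0 <= t <= 1 /\ P t].
have A0 : A 0 by split=> //; rewrite lexx ler01.
have hA : has_sup A.
  by split; [exists 0 | exists 1 => t [/andP[]]].
have t1 : sup A <= 1 by apply: ge_sup; [exists 0 | move=> t [/andP[]]].
have t0 : 0 <= sup A by apply: ub_le_sup => //; exact: hA.2.
have [d d0 dP] := step (sup A) (introT andP (conj t0 t1)).
have [s [/andP[s0 s1] Ps] sd] := sup_adherent d0 hA.
have ssup : s <= sup A by apply: ub_le_sup; [exact: hA.2 | split=> //; rewrite s0].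
have dist_s : `|s - sup A| < d by rewrite distrC ger0_norm ?subr_ge0//; lra.
case: (leP 1 (sup A + d / 2)) => h.
  apply: (dP s) => //; rewrite ?s0 ?ler01 ?lexx//.
  by rewrite ger0_norm ?subr_ge0//; lra.
have : A (sup A + d / 2).
  split; first by apply/andP; split; lra.
  apply: (dP s) => //; rewrite ?s0//; first by apply/andP; split; lra.
  by rewrite addrC addKr gtr0_norm; lra.
by move=> /(ub_le_sup hA.2); lra.
Qed.

Section Monodromy.
Context {R : realType} {V : normedModType R} {Y : Type}.
Implicit Types (x y z : V) (A B W : set V) (f g : V -> Y).

Definition convex_set A := forall x y (t : R), A x -> A y -> 0 <= t <= 1 ->
  A (x + t *: (y - x)).

Variable D : set V.

(** Equality of germs at [y], tested on [D] only. For lifts [D] is the whole space; for side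
    functions it is the complement of the hypersurface, where alone their values are meaningful. *)
Definition agree f g y := \forall z \near y, D z -> f z = g z.

Lemma agree_sym f g y : agree f g y -> agree g f y.
Proof. by apply: filterS => z h Dz; rewrite h. Qed.

Lemma agree_trans g f h y : agree f g y -> agree g h y -> agree f h y.
Proof. by apply: filterS2 => z fg gh Dz; rewrite fg// gh. Qed.

Lemma agree_near f g y : agree f g y -> \forall z \near y, agree f g z.
Proof. by move=> /nbhs_interior; apply: filterS => z. Qed.

Lemma agree_at f g y : agree f g y -> D y -> f y = g y.
Proof. by move=> /nbhs_singleton. Qed.

Variable Fam : set V -> (V -> Y) -> Prop.

(** The germs of the local sections in [Fam] form a covering space of [Om], and [G] plays the role
    of the sheets over [W]: each germ at a point of [W] comes from a member of [G], and two members
    with a common germ coincide over [W]. *)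
Definition locally_constant_family (Om : set V) := forall x, Om x -> exists W G,
  [/\ open W /\ W x, G `<=` Fam W,
      (forall y W' g', W y -> Fam W' g' -> W' y ->
         exists2 g, G g & agree g g' y) &
      (forall g g' y z, G g -> G g' -> W y -> agree g g' y ->
         W z -> D z -> g z = g' z)].

Definition section_on f A := forall y, A y -> exists W g,
  [/\ Fam W g, W y & agree f g y].

Lemma seg_continuous x y : continuous (fun t : R => x + t *: (y - x)).
Proof.
move=> t; apply: cvgD; first exact: cvg_cst.
by apply: cvgZr_tmp; exact: cvg_id.
Qed.

Lemma near_seg (x y : V) (t : R) (P : set V) : nbhs (x + t *: (y - x)) P ->
  exists2 d, 0 < d & forall s, `|s - t| < d -> P (x + s *: (y - x)).
Proof.
move=> /(@seg_continuous x y t) /nbhs_ballP[d /= d0 dP].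
by exists d => // s sd; apply: dP; rewrite /ball /= distrC.
Qed.

(** Agreement of germs is carried along the segment from [x] to [y]: near each parameter both
    sections are represented by members of one set of sheets, which cannot separate there. *)
Lemma section_unique (Om : set V) f g A x y :
  locally_constant_family Om -> A `<=` Om ->
  section_on f A -> section_on g A -> convex_set A -> A x -> A y ->
  agree f g x -> agree f g y.
Proof.
move=> lc AOm fA gA cA Ax Ay fgx.
rewrite (_ : y = x + 1 *: (y - x)); last by rewrite scale1r addrC subrK.
apply: (@chain01 R (fun t => agree f g (x + t *: (y - x)))).
  by rewrite scale0r addr0.
move=> t t01; set xt := x + t *: (y - x).
have Axt : A xt by exact: cA.
have [W [G [[oW Ot] GF ext uni]]] := lc _ (AOm _ Axt).
have [Wf [f' [Ff Oft ff]]] := fA _ Axt.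
have [Wg [g' [Fg Ogt gg]]] := gA _ Axt.
have [f1 Ff1 af1] := ext _ _ _ Ot Ff Oft.
have [g1 Fg1 ag1] := ext _ _ _ Ot Fg Ogt.
have af : agree f f1 xt by apply: agree_trans ff _; exact: agree_sym.
have ag : agree g g1 xt by apply: agree_trans gg _; exact: agree_sym.
have : nbhs xt [set z | [/\ W z, agree f f1 z & agree g g1 z]].
  have h1 := agree_near af; have h2 := agree_near ag.
  have h3 := open_nbhs_nbhs (conj oW Ot).
  by near=> z; split; near: z.
move=> /near_seg[d d0 dP]; exists d => // s s' _ _ /dP[Os afs ags] /dP[Os' afs' ags'] fgs.
have e1 : agree f1 g1 (x + s *: (y - x)).
  by apply: agree_trans ags; apply: agree_trans fgs; exact: agree_sym.
have e2 : agree f1 g1 (x + s' *: (y - x)).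
  by apply: filterS (open_nbhs_nbhs (conj oW Os')) => z Oz Dz; exact: (uni _ _ _ _ Ff1 Fg1 Os e1).
by apply: agree_trans afs' _; apply: agree_trans e2 _; exact: agree_sym.
Unshelve. all: by end_near. Qed.

(** An open convex neighbourhood of a segment. Sections are built on tubes because two tubes issued
    from the same point meet in a convex set containing that point, where [section_unique]
    applies. *)
Definition tube x y (e : R) : set V :=
  [set z | exists2 t, 0 <= t <= 1 & `|z - (x + t *: (y - x))| < e].

Lemma tube_convex x y e : convex_set (tube x y e).
Proof.
move=> z z' t [s s01 zs] [s' s'01 zs'] /andP[t0 t1]; exists (s + t * (s' - s)).
  by apply/andP; split; nra.
set w := (X in `|X|).
have -> : w = (1 - t) *: (z - (x + s *: (y - x))) + t *: (z' - (x + s' *: (y - x))).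
  by rewrite /w; lmodule R [:: x; y; z; z'].
apply: le_lt_trans (ler_normD _ _) _; rewrite !normrZ !ger0_norm ?subr_ge0//.
move: zs zs'; set a := `|_|; set b := `|_| => zs zs'.
case: (ltrP 0 t) => [tp|tn]; last first.
  have -> : t = 0 by lra.
  by rewrite subr0 mul1r mul0r addr0.
nra.
Qed.

Lemma tube_open x y e : open (tube x y e).
Proof.
rewrite openE => z [t t01 zt]; apply/nbhs_ballP; exists (e - `|z - (x + t *: (y - x))|).
  by rewrite /= subr_gt0.
move=> z'; rewrite -ball_normE /= => zz'; exists t => //.
rewrite -(subrKA z); apply: le_lt_trans (ler_normD _ _) _.
by rewrite -ltrBrDr (distrC z').
Qed.

Lemma tube_start x y e : 0 < e -> tube x y e x.
Proof. by move=> e0; exists 0; rewrite ?lexx ?ler01// scale0r addr0 subrr normr0. Qed.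

Lemma tube_end x y e : 0 < e -> tube x y e y.
Proof.
move=> e0; exists 1; rewrite ?lexx ?ler01// scale1r.
by rewrite (addrC x) subrK subrr normr0.
Qed.

Lemma tube_le x y e e' : e <= e' -> tube x y e `<=` tube x y e'.
Proof. by move=> ee z [t t01 h]; exists t => //; exact: lt_le_trans h ee. Qed.

Lemma section_sub f A B : A `<=` B -> section_on f B -> section_on f A.
Proof. by move=> AB fB y /AB /fB. Qed.

Section Existence.
Variables (Om : set V) (x0 : V) (W0 : set V) (g0 : V -> Y).
Hypothesis oOm : open Om.
Hypothesis star : forall x (t : R), Om x -> 0 <= t <= 1 -> Om (x0 + t *: (x - x0)).
Hypothesis Om0 : Om x0.
Hypothesis lc : locally_constant_family Om.
Hypothesis F0 : Fam W0 g0.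
Hypothesis W00 : W0 x0.

Let tube_section x := exists2 ef : R * (V -> Y), 0 < ef.1 &
  [/\ tube x0 x ef.1 `<=` Om, section_on ef.2 (tube x0 x ef.1) & agree ef.2 g0 x0].

Let tube_section_start : tube_section x0.
Proof.
have [W [G [[oW Wx] GF ext uni]]] := lc Om0.
have [g Fg gg] := ext _ _ _ Wx F0 W00.
have /nbhs_ballP[e /= e0 eP] : nbhs x0 (W `&` Om).
  by apply: open_nbhs_nbhs; split=> //; exact: openI.
have tb y : tube x0 x0 e y -> ball x0 e y.
  by move=> [t _]; rewrite subrr scaler0 addr0 -ball_normE /= distrC.
exists (e, g) => //=; split=> //.
  by move=> y /tb /eP[].
by move=> y /tb /eP[Wy _]; exists W, g; split=> //; [exact: GF|exact: nearW].
Qed.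

Let tube_section_step x (t : R) : Om x -> 0 <= t <= 1 -> exists2 d, 0 < d &
  forall s s', 0 <= s <= 1 -> 0 <= s' <= 1 -> `|s - t| < d -> `|s' - t| < d ->
  tube_section (x0 + s *: (x - x0)) -> tube_section (x0 + s' *: (x - x0)).
Proof.
move=> Omx t01; set xt := x0 + t *: (x - x0).
have [W [G [[oW Wx] GF ext uni]]] := lc (star Omx t01).
have /nbhs_ballP[r /= r0 rP] : nbhs xt (W `&` Om).
  by apply: open_nbhs_nbhs; split; [exact: openI|split=> //; exact: star].
have /near_seg[d d0 dP] : nbhs xt (ball xt (r / 2)).
  by apply: nbhsx_ballx; rewrite divr_gt0.
exists d => // s s' s01 s'01 /[dup] sd /dP xs s'd [[e f] /= e0 [tOm fS fg]].
(* A point of the new tube beyond parameter [s] is within [r / 2] of the segment, which there stays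
   within [r / 2] of [xt]; so the point lies in the ball of radius [r]. *)
set e' := Num.min e (r / 2).
have e'0 : 0 < e' by rewrite lt_min e0 divr_gt0.
have e'e : e' <= e by rewrite ge_min lexx.
have e'r : e' <= r / 2 by rewrite ge_min lexx orbT.
set A := tube x0 (x0 + s *: (x - x0)) e'.
have AOm : A `<=` Om by apply: subset_trans tOm; exact: tube_le.
have fA : section_on f A by apply: section_sub fS; exact: tube_le.
have As : A (x0 + s *: (x - x0)) by exact: tube_end.
have [W' [g' [Fg' W's fg']]] := fA _ As.
have Bs : ball xt r (x0 + s *: (x - x0)).
  by apply: le_ball xs; rewrite ler_pdivrMr// ler_pMr// ler1n.
have [g Fg gg'] := ext _ _ _ (rP _ Bs).1 Fg' W's.
have gB : section_on g (ball xt r).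
  by move=> y /rP[Wy _]; exists W, g; split=> //; [exact: GF|exact: nearW].
have cB : convex_set (ball xt r).
  move=> y z u; rewrite -ball_normE /= => y1 z1 /andP[u0 u1].
  have -> : xt - (y + u *: (z - y)) = (1 - u) *: (xt - y) + u *: (xt - z).
    by lmodule R [:: xt; y; z].
  apply: le_lt_trans (ler_normD _ _) _; rewrite !normrZ !ger0_norm ?subr_ge0//.
  move: y1 z1; set a := `|_|; set b := `|_| => y1 z1.
  case: (ltrP 0 u) => [up|un]; first by nra.
  have -> : u = 0 by lra.
  by rewrite subr0 mul1r mul0r addr0.
have fgAB y : A y -> ball xt r y -> agree g f y.
  move=> Ay By; apply: (@section_unique Om _ _ (A `&` ball xt r) (x0 + s *: (x - x0))) => //.
  - by move=> z [/AOm].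
  - by apply: section_sub gB => z [].
  - by apply: section_sub fA => z [].
  - move=> z z' u [? ?] [? ?] u01; split; [exact: tube_convex|exact: cB].
  - by apply: agree_trans gg' _; exact: agree_sym.
(* Glues the sheet [g] over the ball to the old section over the thinner tube; by [fgAB] the two
   agree where both are available. *)
pose F z := if `|xt - z| < r then g z else f z.
have FA y : A y -> agree F f y.
  move=> Ay; near=> z => Dz; rewrite /F; case: ifPn => // zr.
  apply: agree_at (fgAB z _ _) Dz; last by rewrite -ball_normE.
  near: z.
  by apply: open_nbhs_nbhs; split=> //; exact: tube_open.
have FB y : ball xt r y -> agree F g y.
  move=> By; near=> z => Dz; rewrite /F ifT//; near: z.
  have := open_nbhs_nbhs (conj (ball_open xt _) By).
  by rewrite -ball_normE.
have segB a : x0 + a *: (x - x0) - x0 = a *: (x - x0) by rewrite addrC addKr.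
have AB y : tube x0 (x0 + s' *: (x - x0)) e' y -> A y \/ ball xt r y.
  move=> [u /andP[u0 u1] yu].
  have yu' : `|y - (x0 + (u * s') *: (x - x0))| < e'.
    by move: yu; rewrite segB scalerA.
  case/andP: s01 s'01 => s0 s1 /andP[s'0 s'1].
  case: (lerP (u * s') s) => us.
    (* Reparametrises by the shorter segment ending at parameter [s]. When [s] is 0 that segment is
       a point, and the quotient is 0 by convention. *)
    left; exists (u * s' / s).
      have [->|sn0] := eqVneq s 0; first by rewrite invr0 mulr0 lexx ler01.
      have sp : 0 < s by rewrite lt_neqAle eq_sym sn0.
      rewrite ler_pdivrMr// mul1r us andbT.
      by rewrite divr_ge0// mulr_ge0.
    rewrite segB scalerA; move: us yu'.
    have [->|sn0] := eqVneq s 0; last by rewrite divfK.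
    rewrite mulr0 => us; have -> : u * s' = 0 by apply/eqP; rewrite eq_le us mulr_ge0.
    by [].
  right.
  have : `|u * s' - t| < d.
    have us' : u * s' <= s' by nra.
    by move: sd s'd; rewrite !ltr_norml => /andP[? ?] /andP[? ?]; apply/andP; split; lra.
  move=> /dP; rewrite -ball_normE /= => h.
  rewrite -(subrKA (x0 + (u * s') *: (x - x0))).
  apply: le_lt_trans (ler_normD _ _) _; rewrite (distrC _ y) (splitr r).
  by apply: ltrD => //; apply: lt_le_trans yu' _.
exists (e', F) => //=; split.
- by move=> y /AB[/AOm//|/rP[]].
- move=> y /AB[Ay|By].
    have [W1 [g1 [F1 W1y g1y]]] := fA _ Ay.
    by exists W1, g1; split=> //; exact: agree_trans (FA _ Ay) g1y.
  have [W1 [g1 [F1 W1y g1y]]] := gB _ By.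
  by exists W1, g1; split=> //; exact: agree_trans (FB _ By) g1y.
- by apply: agree_trans fg; apply: FA; exact: tube_start.
Unshelve. all: by end_near. Qed.

(** Star-shapedness stands in for simple connectedness: each point is reached by one preferred
    segment from [x0], so no two paths have to be compared up to homotopy. *)
Theorem monodromy : exists2 F, agree F g0 x0 & section_on F Om.
Proof.
have main x : Om x -> tube_section x.
  move=> Omx; rewrite (_ : x = x0 + 1 *: (x - x0)); last by rewrite scale1r addrC subrK.
  apply: (@chain01 R (fun t => tube_section (x0 + t *: (x - x0)))).
    by rewrite scale0r addr0.
  by move=> t t01; exact: tube_section_step.
have /choice[h hP] x : exists ef : R * (V -> Y), Om x -> 0 < ef.1 /\
    [/\ tube x0 x ef.1 `<=` Om, section_on ef.2 (tube x0 x ef.1) & agree ef.2 g0 x0].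
  have [Omx|nOmx] := pselect (Om x); last by exists (0, g0).
  by have [ef e0 efP] := main _ Omx; exists ef.
(* Each point takes its value from the section continued along its own segment. The choices cohere
   near [y], since the tubes of [y] and of a nearby [z] meet in a convex set that contains both [x0]
   and [z]. *)
pose F z := (h z).2 z.
have FP y : Om y -> agree F (h y).2 y.
  move=> Omy; have [e0 [tOm fS fg]] := hP _ Omy.
  have ny := open_nbhs_nbhs (conj (@tube_open x0 y (h y).1) (tube_end x0 y e0)).
  near=> z => Dz.
  have tz : tube x0 y (h y).1 z by near: z.
  have [e0' [tOm' fS' fg']] := hP _ (tOm _ tz).
  apply: (@agree_at (h z).2 (h y).2 z) => //.
  apply: (@section_unique Om _ _ (tube x0 y (h y).1 `&` tube x0 z (h z).1) x0) => //.
  - by move=> w [/tOm].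
  - by apply: section_sub fS' => w [].
  - by apply: section_sub fS => w [].
  - by move=> a b u [? ?] [? ?] u01; split; exact: tube_convex.
  - by split; exact: tube_start.
  - by split=> //; exact: tube_end.
  - by apply: agree_trans fg' _; exact: agree_sym.
exists F.
  by apply: agree_trans (FP _ Om0) _; case: (hP _ Om0) => _ [].
move=> y Omy; have [e0 [tOm fS fg]] := hP _ Omy.
have [W1 [g1 [F1 W1y g1y]]] := fS _ (tube_end x0 y e0).
by exists W1, g1; split=> //; apply: agree_trans g1y; exact: FP.
Unshelve. all: by end_near. Qed.

End Existence.

End Monodromy.

Lemma locally_constant_seg (R : realType) (V : normedModType R) (Y : Type)
    (A : set V) (h : V -> Y) (x y : V) :
  (forall z, A z -> \forall w \near z, h w = h z) ->
  (forall t : R, 0 <= t <= 1 -> A (x + t *: (y - x))) -> h x = h y.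
Proof.
move=> lc seg; rewrite (_ : y = x + 1 *: (y - x)); last by rewrite scale1r addrC subrK.
apply: (@chain01 R (fun t => h x = h (x + t *: (y - x)))).
  by rewrite scale0r addr0.
move=> t t01; have /near_seg[d d0 dP] := lc _ (seg t t01).
by exists d => // s s' _ _ /dP hs /dP hs' ->; rewrite hs.
Qed.

(** * The supremum norm and the connectedness of exteriors *)

Section RowVectorNorm.
Context {R : realType} {n : nat}.
Implicit Types x y : 'rV[R]_n.

Lemma rV_norm_lt x (e : R) : `|x| < e <-> 0 < e /\ forall i, `|x 0 i| < e.
Proof.
have -> : `|x| < e <-> ball (0 : 'rV[R]_n) e x.
  by rewrite mx_norm_ball /ball_ /= sub0r normrN.
split=> [[e0 h]|[e0 h]]; split=> // i.
  by have := h 0 i; rewrite mxE /ball /= sub0r normrN.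
by move=> j; rewrite mxE /ball /= sub0r normrN ord1.
Qed.

Lemma rV_coord_le x i : `|x 0 i| <= `|x|.
Proof. by rewrite leNgt; apply/negP => /rV_norm_lt[_ /(_ i)]; rewrite ltxx. Qed.

Lemma rV_norm_le x (e : R) : 0 <= e -> (forall i, `|x 0 i| <= e) -> `|x| <= e.
Proof.
move=> e0 h; apply/ler_addgt0Pr => d d0; apply/ltW/rV_norm_lt; split.
  by rewrite ltr_wpDl.
by move=> i; apply: le_lt_trans (h i) _; rewrite ltrDl.
Qed.

Lemma rV_norm_gt x (r : R) : 0 <= r -> r < `|x| <-> exists i, r < `|x 0 i|.
Proof.
move=> r0; split=> [rx|[ i]]; last by move=> /lt_le_trans; apply; exact: rV_coord_le.
apply/not_existsP => h; move: rx; apply/negP; rewrite -leNgt.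
by apply: rV_norm_le => // i; rewrite leNgt; apply/negP/h.
Qed.

End RowVectorNorm.

(** When the conditions on [x] and [y] concern different coordinates, one changes first the
    coordinate that [y] needs and then all the others, so that one condition persists along each
    segment. If they concern the same coordinate, one passes through a point with a condition on
    another one. *)
Lemma coordinate_union_constant (R : realType) (m : nat) (Y : Type)
    (P : 'I_m -> R -> Prop) (h : 'rV[R]_m -> Y) (x y : 'rV[R]_m) :
  (forall i, exists k c, k != i /\ P k c) ->
  (forall z : 'rV[R]_m, (exists i, P i (z 0 i)) -> \forall w \near z, h w = h z) ->
  (exists i, P i (x 0 i)) -> (exists i, P i (y 0 i)) -> h x = h y.
Proof.
move=> two lc.
have far (u v : 'rV[R]_m) i j : i != j -> P i (u 0 i) -> P j (v 0 j) -> h u = h v.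
  move=> ij ui vj.
  pose w := \row_k (if k == j then v 0 j else u 0 k) : 'rV[R]_m.
  transitivity (h w).
    apply: (@locally_constant_seg R 'rV[R]_m _ [set z | exists i, P i (z 0 i)]) => // t _ /=.
    by exists i; rewrite !mxE (negbTE ij) subrr mulr0 addr0.
  apply: (@locally_constant_seg R 'rV[R]_m _ [set z | exists i, P i (z 0 i)]) => // t _ /=.
  by exists j; rewrite !mxE eqxx subrr mulr0 addr0.
move=> [i xi] [j yj].
have [ij|ij] := eqVneq i j; last exact: (far _ _ i j).
have [k [c [ki kc]]] := two i.
pose w : 'rV[R]_m := const_mx c.
have wk : P k (w 0 k) by rewrite mxE.
transitivity (h w); first by apply: (far _ _ i k) => //; rewrite eq_sym.
by apply: (far _ _ k j) => //; rewrite -ij.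
Qed.

(** In the supremum norm the exterior of a ball is a union of conditions on single coordinates, and
    dimension at least 2 provides the second coordinate. *)
Lemma exterior_constant (R : realType) (n : nat) (Y : Type) (r : R)
    (h : 'rV[R]_n.+2 -> Y) (x y : 'rV[R]_n.+2) :
  0 <= r -> (forall z : 'rV[R]_n.+2, r < `|z| -> \forall w \near z, h w = h z) ->
  r < `|x| -> r < `|y| -> h x = h y.
Proof.
move=> r0 lc /(rV_norm_gt _ r0) xr /(rV_norm_gt _ r0) yr.
apply: (@coordinate_union_constant R _ _ (fun _ c => r < `|c|)) => // [i|z /(rV_norm_gt _ r0)].
  exists (fintype.lift i ord0), (r + 1); split; first by rewrite eq_sym neq_lift.
  by rewrite ger0_norm; lra.
exact: lc.
Qed.

Section Segments.
Context {R : realType}.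

Definition clamp (s : R) : R := Num.max 0 (Num.min 1 s).

Lemma clamp_continuous : continuous clamp.
Proof.
apply: continuous_maxfun; first by move=> z; exact: cvg_cst.
by apply: continuous_minfun => z; [exact: cvg_cst|exact: cvg_id].
Qed.

Lemma clamp_id s : 0 <= s <= 1 -> clamp s = s.
Proof. by move=> /andP[s0 s1]; rewrite /clamp min_r// max_r. Qed.

Lemma clamp_le0 s : s <= 0 -> clamp s = 0.
Proof. by move=> s0; rewrite /clamp min_r ?max_l//; lra. Qed.

Lemma clamp_ge1 s : 1 <= s -> clamp s = 1.
Proof. by move=> s1; rewrite /clamp min_l// max_r. Qed.

Lemma clamp01 s : 0 <= clamp s <= 1.
Proof. by rewrite /clamp le_max lexx /= ge_max ler01 ge_min lexx. Qed.

Context {X : topologicalType}.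

Lemma path_clamp (x y : X) (p : path R x y) t : p (clamp t) = p t.
Proof.
case: (lerP t 0) => [t0|t0]; first by rewrite clamp_le0// !path_le0.
case: (lerP t 1) => [t1|/ltW t1]; first by rewrite clamp_id// (ltW t0).
by rewrite clamp_ge1// !path_ge1.
Qed.

Lemma path0 (x y : X) (p : path R x y) : p 0 = x.
Proof. by rewrite path_le0. Qed.

Lemma path1 (x y : X) (p : path R x y) : p 1 = y.
Proof. by rewrite path_ge1. Qed.

Section SegPath.
Variables (g : R -> X) (cg : continuous g) (s t : R) (a b : X).
Hypotheses (ga : g s = a) (gb : g t = b).

Let seg_fun u := g ((t - s) * clamp u + s).

Let seg_cts : continuous seg_fun.
Proof.
apply: (continuous_compfun cg); apply: continuous_affine.
exact: clamp_continuous.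
Qed.

Let seg_le0 u : u <= 0 -> seg_fun u = a.
Proof. by move=> u0; rewrite /seg_fun clamp_le0// mulr0 add0r. Qed.

Let seg_ge1 u : 1 <= u -> seg_fun u = b.
Proof. by move=> u0; rewrite /seg_fun clamp_ge1// mulr1 subrK. Qed.

Definition seg_path : path R a b := Path seg_cts seg_le0 seg_ge1.

End SegPath.

End Segments.

(** * Coverings and the torus *)

Section Coverings.
Context {R : realType} {E M : topologicalType} (p : E -> M).

Definition topological_covering := continuous p /\
  forall y : M, exists U : set M, [/\ open U, U y &
    exists F : set (set E), [/\ trivIset F id, p @^-1` U = \bigcup_(V in F) V &
      forall V, F V -> open V /\ exists s : M -> E,
        [/\ forall x, U x -> {for x, continuous s},
            forall x, U x -> V (s x) /\ p (s x) = x &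
            forall x, V x -> s (p x) = x]]].

Hypothesis pc : topological_covering.

Lemma sheet_eq (F : set (set E)) (V V' : set E) x :
  trivIset F id -> F V -> F V' -> V x -> V' x -> V = V'.
Proof. by move=> tF FV FV' Vx V'x; apply: (tF V V') => //; exists x. Qed.

(** The local lifts are [f] followed by the inverses of [p] on the sheets. Since the sheets are
    disjoint, two such lifts with one common value come from the same sheet. *)
Lemma lift_map (V : normedModType R) (f : V -> M) (x0 : V) (y0 : E) :
  continuous f -> p y0 = f x0 ->
  exists F : V -> E, [/\ continuous F, forall x, p (F x) = f x & F x0 = y0].
Proof.
move=> cf py0.
pose Fam (W : set V) (g : V -> E) := open W /\
  (forall z, W z -> p (g z) = f z /\ {for z, continuous g}).
have opre (U : set M) : open U -> open (f @^-1` U) by move/continuousP: cf; apply.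
have lc : @locally_constant_family R V E setT Fam setT.
  move=> x _; have [U [oU Ux [F [tF pF FV]]]] := pc.2 (f x).
  exists (f @^-1` U), [set g | exists W s, [/\ F W,
       forall x, U x -> {for x, continuous s}, forall x, U x -> W (s x) /\ p (s x) = x,
       forall x, W x -> s (p x) = x & g = s \o f]]; split.
  - by split=> //; exact: opre.
  - move=> _ [W [s [FW cs s1 s2 ->]]]; split; first exact: opre.
    move=> z Uz; split; first by case: (s1 _ Uz).
    by apply: continuous_comp; [exact: cf|exact: cs].
  - move=> y W' g' Uy [oW' W'P] W'y; have [pg cg] := W'P _ W'y.
    have : (p @^-1` U) (g' y) by rewrite /preimage /= pg.
    rewrite pF => -[W FW Wg]; have [oW [s [cs s1 s2]]] := FV _ FW.
    exists (s \o f); first by exists W, s.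
    have nW : nbhs y (g' @^-1` W) by apply: cg; exact: open_nbhs_nbhs.
    near=> z => _ /=; have [] : p (g' z) = f z /\ {for z, continuous g'}.
      by apply: W'P; near: z; exact: open_nbhs_nbhs.
    move=> <- _; apply: s2; near: z; exact: nW.
  - move=> _ _ y z [W [s [FW cs s1 s2 ->]]] [W' [s' [FW' cs' s1' s2' ->]]] Uy.
    move=> /agree_at/(_ I) /= ss' Uz _.
    have WW' : W = W'.
      apply: (sheet_eq tF FW FW' (x := s (f y))); first by case: (s1 _ Uy).
      by rewrite ss'; case: (s1' _ Uy).
    have [W's' ps'] := s1' _ Uz.
    by rewrite -{1}ps' s2// WW'.
have [U [oU Ux [F [tF pF FV]]]] := pc.2 (f x0).
have : (p @^-1` U) y0 by rewrite /preimage /= py0.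
rewrite pF => -[W FW Wy0]; have [oW [s [cs s1 s2]]] := FV _ FW.
have F0 : Fam (f @^-1` U) (s \o f).
  split; first exact: opre.
  move=> z Uz; split; first by case: (s1 _ Uz).
  by apply: continuous_comp; [exact: cf|exact: cs].
have [G G0 GP] := @monodromy R V E setT Fam setT x0 _ _ openT (fun _ _ _ _ => I) I lc F0 Ux.
exists G; split.
- move=> x; have [W1 [g [[oW1 W1P] W1x gG]]] := GP x I.
  have [_ cg] := W1P _ W1x.
  have Gg : \forall z \near x, g z = G z by apply: filterS gG => z /(_ I).
  have Gx : G x = g x by rewrite (nbhs_singleton Gg).
  rewrite /continuous_at Gx; apply: cvg_trans cg; exact: near_eq_cvg.
- move=> x; have [W1 [g [[oW1 W1P] W1x gG]]] := GP x I.
  by rewrite (agree_at gG I); case: (W1P _ W1x).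
- by rewrite (agree_at G0 I) /= -py0 s2.
Unshelve. all: by end_near. Qed.

Lemma lift_unique (Z : topologicalType) (F G : Z -> E) (z0 z : Z) :
  continuous F -> continuous G -> (forall z, p (F z) = p (G z)) ->
  F z0 = G z0 -> path R z0 z -> F z = G z.
Proof.
move=> cF cG FG e0 q; rewrite -(path1 q).
apply: (@chain01 R (fun t => F (q t) = G (q t))); first by rewrite path0.
move=> t t01; have [U [oU Ux [Fm [tF pF FV]]]] := pc.2 (p (F (q t))).
have : (p @^-1` U) (F (q t)) by [].
rewrite pF => -[W FW WF]; have [oW [s [_ _ s2]]] := FV _ FW.
have : (p @^-1` U) (G (q t)) by rewrite /preimage /= -FG.
rewrite pF => -[W' FW' WG]; have [oW' _] := FV _ FW'.
have : nbhs t [set u | W (F (q u)) /\ W' (G (q u))].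
  apply: filterI.
    by apply: (continuous_compfun cF (path_cts (p := q))); exact: open_nbhs_nbhs.
  by apply: (continuous_compfun cG (path_cts (p := q))); exact: open_nbhs_nbhs.
move=> /nbhs_ballP[d /= d0 dP]; exists d => // a b _ _ ad bd e.
have [Wa W'a] : W (F (q a)) /\ W' (G (q a)) by apply: dP; rewrite /ball /= distrC.
have [Wb W'b] : W (F (q b)) /\ W' (G (q b)) by apply: dP; rewrite /ball /= distrC.
have WW' : W = W' by apply: (sheet_eq tF FW FW' Wa); rewrite e.
by rewrite -(s2 _ Wb) FG s2// WW'.
Qed.

Let idc : continuous (fun t : R => t). Proof. by move=> z; exact: cvg_id. Qed.

Definition segment_path (a b : R) : path R a b :=
  seg_path idc (erefl a) (erefl b).

(** The homotopy is lifted to the plane; the lift is constant on the lines over the two fixed end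
    points, and uniqueness identifies it with [Q] and [Q'] on the other two sides of the square. *)
Lemma homotopic_lift (x y : M) (q q' : path R x y) (Q Q' : R -> E) :
  homotopic q q' -> continuous Q -> continuous Q' ->
  (forall t, p (Q t) = q t) -> (forall t, p (Q' t) = q' t) ->
  Q 0 = Q' 0 -> Q 1 = Q' 1.
Proof.
move=> [H [cH H0 H1 Hx Hy]] cQ cQ' pQ pQ' QQ.
have [K [cK pK K0]] := @lift_map (R * R)%type H (0, 0) (Q 0) cH (eq_trans (pQ 0) (esym (H0 0))).
have c1 (u : R) : continuous (fun t : R => (u, t)).
  by apply: continuous_pairfun => z; [exact: cvg_cst|exact: cvg_id].
have c2 (u : R) : continuous (fun t : R => (t, u)).
  by apply: continuous_pairfun => z; [exact: cvg_id|exact: cvg_cst].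
have cst (a : E) : continuous (fun _ : R => a) by move=> z; exact: cvg_cst.
have e1 : K (0, 1) = Q 1.
  apply: (@lift_unique R (fun t => K (0, t)) Q 0 1) => //.
  - exact: (continuous_compfun cK (c1 0)).
  - by move=> t; rewrite pK H0 pQ.
  - exact: segment_path.
have e2 : K (1, 0) = Q 0.
  apply: (@lift_unique R (fun t => K (t, 0)) (fun=> Q 0) 0 1) => //.
  - exact: (continuous_compfun cK (c2 0)).
  - by move=> t; rewrite pK pQ Hx// path0.
  - exact: segment_path.
have e3 : K (1, 1) = Q' 1.
  apply: (@lift_unique R (fun t => K (1, t)) Q' 0 1) => //.
  - exact: (continuous_compfun cK (c1 1)).
  - by move=> t; rewrite pK H1 pQ'.
  - by rewrite e2.
  - exact: segment_path.
rewrite -e1 -e3.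
apply: (@lift_unique R (fun t => K (t, 1)) (fun=> K (1, 1)) 1 0) => //.
- exact: (continuous_compfun cK (c2 1)).
- by move=> t; rewrite !pK !Hy.
- exact: segment_path.
Qed.

End Coverings.

Section TorusQuotient.
Context {R : realType} {n : nat}.

Definition int_row (z : 'rV[int]_n) : 'rV[R]_n := map_mx intr z.

Definition unit_cube : set 'rV[R]_n := [set x | forall i, 0 <= x 0 i <= 1].

Lemma unit_cube_compact : compact unit_cube.
Proof.
have : compact [set v : 'rV[R]_n | forall i, v ord0 i \in `[0, 1]].
  apply: (@rV_compact _ _ (fun=> `[(0 : R), 1]%classic)).
  by move=> _; exact: segment_compact.
congr compact; apply/seteqP; split=> v h i; have := h i; rewrite /= in_itv//.
Qed.

Lemma unit_cube_rep (x : 'rV[R]_n) : exists z, unit_cube (x + int_row z).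
Proof.
exists (\row_i - Num.floor (x 0 i)) => i; rewrite !mxE rmorphN /= subr_ge0.
rewrite real_floor_le ?num_real//= lerBlDl.
by apply/ltW; rewrite -intrD1 real_floorD1_gt ?num_real.
Qed.

Variables (X : topologicalType) (e : 'rV[R]_n -> X).
Hypothesis hX : hausdorff_space X.
Hypothesis ce : continuous e.
Hypothesis eP : forall x z, e (x + int_row z) = e x.

(** The parametrisation maps the compact unit cube onto the torus and closed subsets of the cube to
    closed sets, so continuity can be tested after composition with it. *)
Lemma torus_quotient (Z : topologicalType) (T : set X) (h : T -> Z) (k : 'rV[R]_n -> Z) :
  range e = T -> continuous k -> (forall (x : T) y, val x = e y -> h x = k y) ->
  continuous h.
Proof.
move=> eT ck hk; apply/continuousP => B oB.
have cC : closed (e @` (unit_cube `&` k @^-1` (~` B))).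
  apply: compact_closed => //; apply: continuous_compact.
    by apply: continuous_subspaceT.
  apply: compact_closedI; first exact: unit_cube_compact.
  by apply: (closed_comp (fun z _ => ck z)); exact: open_closedC.
exists (~` (e @` (unit_cube `&` k @^-1` (~` B)))); first exact: closed_openC.
apply/seteqP; split=> x /=.
  move=> nx; apply: contrapT => nB; apply: nx.
  have rT u : T u -> range e u by rewrite eT.
  have [y _ yx] := rT _ (set_mem (valP x)); have [z zc] := unit_cube_rep y.
  exists (y + int_row z); last by rewrite eP.
  split=> //=; rewrite -(hk x)// eP//.
by move=> Bx [y [_ nB] yx]; apply: nB; rewrite /= -(hk x).
Qed.

End TorusQuotient.

(** * A cubical Sperner lemma and Brouwer's theorem *)

Section CubicalSperner.
Context {m : nat} {K : comNzRingType}.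
Hypothesis addKK : forall x : K, x + x = 0.
Implicit Types (p : 'I_m -> nat) (D : {set 'I_m}) (x : ('I_m -> nat) -> K).

Definition grid_set p j c : 'I_m -> nat := fun i => if i == j then c else p i.
Definition grid_succ p j := grid_set p j (p j).+1.

(* The cup product of the coboundaries of [xs] modulo 2, evaluated on the cube
   with origin [p] and edges in the directions [D], cut into the simplices of
   the monotone edge paths. *)
Fixpoint cup_product p D (xs : seq (('I_m -> nat) -> K)) : K :=
  if xs is x :: xs' then
    \sum_(j in D) (x (grid_succ p j) + x p) * cup_product (grid_succ p j) (D :\ j) xs'
  else 1.

Lemma grid_succC p j k : j != k ->
  grid_succ (grid_succ p j) k = grid_succ (grid_succ p k) j.
Proof.
move=> jk; apply/funext => i; rewrite /grid_succ /grid_set eq_sym (negbTE jk).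
by rewrite [j == k]eq_sym in jk *; case: (eqVneq i k) => // ->; rewrite (negbTE jk).
Qed.

Lemma sum_symmetric_char2 D (f : 'I_m -> 'I_m -> K) :
  (forall j k, j \in D -> k \in D -> j != k -> f j k = f k j) ->
  \sum_(j in D) \sum_(k in D :\ j) f j k = 0.
Proof.
move=> fC.
pose a := \sum_(j in D) \sum_(k in D | (k < j)%N) f j k.
suff -> : \sum_(j in D) \sum_(k in D :\ j) f j k = a + a by [].
have aE : a = \sum_(j in D) \sum_(k in D | (j < k)%N) f j k.
  rewrite /a (exchange_big_dep (mem D))//=; last by move=> ? ? _ /andP[].
  apply: eq_bigr => k kD; rewrite (eq_bigl (fun j : 'I_m => (j \in D) && (k < j)%N)).
    by apply: eq_bigr => j /andP[jD kj]; rewrite fC// -val_eqE /= gtn_eqF.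
  by move=> j; rewrite kD.
rewrite {2}aE -big_split; apply: eq_bigr => j jD /=.
rewrite (bigID (fun k : 'I_m => (k < j)%N)) /=; congr (_ + _); apply: eq_bigl => k.
  rewrite !inE -val_eqE /=; case: ltngtP => //; rewrite ?andbF//.
rewrite !inE -val_eqE /=; case: ltngtP => //; rewrite ?andbF ?andbT//.
Qed.

(** The sum runs over the faces of a cube: a cup product of coboundaries is a cocycle. *)
Lemma cup_product_closed xs p D : #|D| = (size xs).+1 ->
  \sum_(j in D) (cup_product (grid_succ p j) (D :\ j) xs + cup_product p (D :\ j) xs) = 0.
Proof.
elim: xs p D => [|y ys IH] p D cD /=.
  by rewrite big1// => j _.
have cDj j : j \in D -> #|D :\ j| = (size ys).+1.
  by move=> jD; have := finset.cardsD1 j D; rewrite jD cD => -[].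
have DC j k : D :\ j :\ k = D :\ k :\ j by rewrite !finset.setDDl finset.setUC.
set s := grid_succ.
pose T j k (a : K) := a * cup_product (s p k) (D :\ j :\ k) ys.
(* Of the five vanishing sums, [h1], [h4] and [h5] are symmetric in the two directions, so that
   their terms cancel in pairs, while [h2] and [h3] come from the induction hypothesis. Up to terms
   that occur twice they add up to the claim. *)
have h1 : \sum_(j in D) \sum_(k in D :\ j)
    y (s (s p j) k) * cup_product (s (s p j) k) (D :\ j :\ k) ys = 0.
  apply: sum_symmetric_char2 => j k _ _ jk.
  by rewrite /s (grid_succC _ jk) DC.
have h2 : \sum_(j in D) \sum_(k in D :\ j) y (s p j) *
    (cup_product (s (s p j) k) (D :\ j :\ k) ys + cup_product (s p j) (D :\ j :\ k) ys) = 0.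
  by apply: big1 => j jD; rewrite -mulr_sumr IH ?mulr0// cDj.
have h3 : \sum_(j in D) \sum_(k in D :\ j) y p *
    (cup_product (s p k) (D :\ j :\ k) ys + cup_product p (D :\ j :\ k) ys) = 0.
  by apply: big1 => j jD; rewrite -mulr_sumr IH ?mulr0// cDj.
have h4 : \sum_(j in D) \sum_(k in D :\ j) y p * cup_product p (D :\ j :\ k) ys = 0.
  by apply: sum_symmetric_char2 => j k _ _ jk; rewrite DC.
have h5 : \sum_(j in D) \sum_(k in D :\ j)
    (y (s p k) * cup_product (s p k) (D :\ j :\ k) ys +
     y (s p j) * cup_product (s p j) (D :\ j :\ k) ys) = 0.
  by apply: sum_symmetric_char2 => j k _ _ jk; rewrite addrC DC.
have sD (P : {set 'I_m}) (F G : 'I_m -> K) :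
    \sum_(k in P) F k + \sum_(k in P) G k = \sum_(k in P) (F k + G k).
  by rewrite big_split.
rewrite -[RHS]h1 -[RHS]addr0 -[X in _ = _ + X]h2.
rewrite -[X in _ = _ + X]addr0 -[X in _ = _ + (_ + X)]h3 -[X in _ = _ + (_ + X)]addr0.
rewrite -[X in _ = _ + (_ + (_ + X))]h4 -[X in _ = _ + (_ + (_ + X))]addr0.
rewrite -[X in _ = _ + (_ + (_ + (_ + X)))]h5 -!big_split; apply: eq_bigr => j jD /=.
rewrite !sD; apply: eq_bigr => k kD.
set A := cup_product (s (s p j) k) _ _; set B := cup_product (s p k) _ _.
set C := cup_product p _ _; set E := cup_product (s p j) _ _.
set u := y (s (s p j) k); set v := y (s p j); set w := y (s p k); set z := y p.
have -> : u * A + (v * (A + E) + (z * (B + C) + (z * C + (w * B + v * E)))) =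
   (u + v) * A + (w + z) * B + (v * E + v * E) + (z * C + z * C) by ring.
by rewrite !addKK !addr0.
Qed.

(** The two expressions differ by [x p] times a sum that vanishes by [cup_product_closed]. The new
    one is the coboundary of [x] times the remaining product, as needed for a discrete Stokes
    formula. *)
Lemma cup_product_cons p D x xs : #|D| = (size xs).+1 ->
  cup_product p D (x :: xs) =
  \sum_(j in D) (x (grid_succ p j) * cup_product (grid_succ p j) (D :\ j) xs +
                 x p * cup_product p (D :\ j) xs).
Proof.
move=> cD; set a := RHS; suff: cup_product p D (x :: xs) = a + x p * 0.
  by rewrite mulr0 addr0.
rewrite -(cup_product_closed p cD) mulr_sumr /a -big_split; apply: eq_bigr => j jD.
rewrite -[LHS]/((x (grid_succ p j) + x p) * cup_product (grid_succ p j) (D :\ j) xs).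
rewrite -[RHS]/(x (grid_succ p j) * cup_product (grid_succ p j) (D :\ j) xs +
   x p * cup_product p (D :\ j) xs +
   x p * (cup_product (grid_succ p j) (D :\ j) xs + cup_product p (D :\ j) xs)).
set A := cup_product _ _ _; set B := cup_product p _ _; set u := x _; set v := x p.
have -> : u * A + v * B + v * (A + B) = (u + v) * A + (v * B + v * B) by ring.
by rewrite addKK addr0.
Qed.

Lemma cup_product_face0 p D xs x j c : x \in xs -> j \notin D -> p j = c ->
  (forall q q', q j = c -> q' j = c -> x q = x q') -> cup_product p D xs = 0.
Proof.
move=> + + + xc; elim: xs p D => [|y ys IH] p D //=; rewrite inE => xys jD pj.
apply: big1 => k kD; have jk : j != k by apply: contraNneq jD => ->.
have sj : grid_succ p k j = c by rewrite /grid_succ /grid_set (negbTE jk).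
case/predU1P: xys => [<-|xys]; first by rewrite (xc _ p)// addKK mul0r.
by rewrite IH ?mulr0// !inE (negbTE jk).
Qed.

Variable N : nat.

Fixpoint grid_sum (ds : seq 'I_m) b (F : ('I_m -> nat) -> K) : K :=
  if ds is d :: ds' then \sum_(t < N) grid_sum ds' (grid_set b d t) F else F b.

Lemma grid_sum_ext ds b F G : (forall p, (forall i, i \notin ds -> p i = b i) -> F p = G p) ->
  grid_sum ds b F = grid_sum ds b G.
Proof.
elim: ds b => [|d ds IH] b FG /=; first exact: FG.
apply: eq_bigr => t _; apply: IH => p pb; apply: FG => i; rewrite inE negb_or => /andP[id ids].
by rewrite pb// /grid_set (negbTE id).
Qed.

Lemma grid_sumD ds b F G :
  grid_sum ds b (fun p => F p + G p) = grid_sum ds b F + grid_sum ds b G.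
Proof. by elim: ds b => //= d ds IH b; rewrite -big_split; apply: eq_bigr => t _; exact: IH. Qed.

Lemma grid_sum0 ds b : grid_sum ds b (fun=> 0) = 0.
Proof. by elim: ds b => //= d ds IH b; rewrite big1. Qed.

Lemma grid_sum_sum ds b (P : pred 'I_m) (F : 'I_m -> ('I_m -> nat) -> K) :
  grid_sum ds b (fun p => \sum_(j | P j) F j p) = \sum_(j | P j) grid_sum ds b (F j).
Proof.
elim: ds b => //= d ds IH b; rewrite exchange_big; apply: eq_bigr => t _; exact: IH.
Qed.

Lemma grid_setC p i j c c' : i != j ->
  grid_set (grid_set p i c) j c' = grid_set (grid_set p j c') i c.
Proof.
move=> ij; apply/funext => k; rewrite /grid_set; case: (eqVneq k i) => // ->.
by rewrite (negbTE ij).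
Qed.

Lemma grid_set_set p i c c' : grid_set (grid_set p i c) i c' = grid_set p i c'.
Proof. by apply/funext => k; rewrite /grid_set; case: eqP. Qed.

Lemma sum_telescope_char2 (f : nat -> K) : \sum_(t < N) (f t.+1 + f t) = f N + f 0%N.
Proof.
elim: N => [|k IH]; first by rewrite big_ord0 addKK.
rewrite big_ord_recr IH /=.
have -> : f k + f 0%N + (f k.+1 + f k) = f k.+1 + f 0%N + (f k + f k) by ring.
by rewrite addKK addr0.
Qed.

Lemma grid_sum_telescope ds b j F : uniq ds -> j \in ds ->
  grid_sum ds b (fun p => F (grid_succ p j) + F p) =
  grid_sum (rem j ds) b (fun p => F (grid_set p j N) + F (grid_set p j 0%N)).
Proof.
elim: ds b => //= d ds IH b /andP[dds uds]; rewrite inE.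
case: (eqVneq j d) => [-> _|jd /= jds].
  have nd c p : (forall i, i \notin ds -> p i = grid_set b d c i) -> p d = c.
    by move=> -> //; rewrite /grid_set eqxx.
  pose H c := grid_sum ds b (fun p => F (grid_set p d c)).
  have HE c G : grid_sum ds (grid_set b d c) G = grid_sum ds b (fun p => G (grid_set p d c)).
    elim: (ds) (dds) b {IH H uds nd} => //= a l IHl; rewrite inE negb_or => /andP[da dl] b.
    by apply: eq_bigr => t _; rewrite grid_setC// IHl.
  transitivity (\sum_(t < N) (H t.+1 + H t)).
    apply: eq_bigr => t _; rewrite HE -grid_sumD; apply: grid_sum_ext => p _.
    by rewrite /grid_succ grid_set_set /grid_set eqxx.
  by rewrite sum_telescope_char2 -grid_sumD.
by apply: eq_bigr => t _; exact: IH.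
Qed.

Variable x : 'I_m -> ('I_m -> nat) -> K.
Hypothesis x0 : forall j p, p j = 0%N -> x j p = 0.
Hypothesis xN : forall j p, p j = N -> x j p = 1.

(** Discrete Stokes formula: the sum telescopes to the boundary of the grid. On a face orthogonal to
    a direction [j] other than [d], the label [x j] is constant and its coboundary vanishes. On the
    two faces orthogonal to [d] the label [x d] is 0 and 1, which leaves the same sum in one
    dimension less. *)
Lemma grid_sum_cup ds b : uniq ds ->
  grid_sum ds b (fun p => cup_product p [set i in ds] (map x ds)) = 1.
Proof.
elim: ds b => [//|d ds IH] b uds; have /= /andP[dds uds'] := uds.
pose D := [set i in d :: ds].
have cD : #|D| = (size (map x ds)).+1 by rewrite cardsE (card_uniqP uds) size_map.
have Dd : D :\ d = [set i in ds].
  by apply/setP => i; rewrite !inE; case: eqVneq => //= ->; rewrite (negbTE dds).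
pose F j p := x d p * cup_product p (D :\ j) (map x ds).
transitivity (grid_sum (d :: ds) b (fun p => \sum_(j in D) (F j (grid_succ p j) + F j p))).
  by apply: (@grid_sum_ext (d :: ds)) => p _; exact: cup_product_cons.
rewrite grid_sum_sum (bigD1 d) ?inE ?eqxx//= [X in _ + X]big1 => [|j /andP[jD jd]].
  rewrite addr0 -/(grid_sum (d :: ds) b _) grid_sum_telescope ?inE ?eqxx//= eqxx.
  rewrite (@grid_sum_ext _ _ _ (fun p => cup_product (grid_set p d N) (D :\ d) (map x ds))).
    rewrite -[RHS](IH (grid_set b d N))// Dd.
    elim: (ds) (dds) (b) ([set i in ds]) (map x ds) => //= a l IHl.
    rewrite inE negb_or => /andP[da dl] b' E xs.
    by apply: eq_bigr => t _; rewrite grid_setC// IHl.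
  move=> p _; rewrite /F (@xN d) /grid_set ?eqxx// mul1r (@x0 d) ?eqxx//.
  by rewrite mul0r addr0.
have jds : j \in ds by move: jD; rewrite !inE (negbTE jd).
have face c p : c = 0%N \/ c = N -> F j (grid_set p j c) = 0.
  move=> cN; rewrite /F (@cup_product_face0 _ _ _ (x j) j c) ?mulr0//.
  - exact: map_f.
  - by rewrite !inE eqxx.
  - by rewrite /grid_set eqxx.
  - by move=> q q'; case: cN => -> qj q'j; [rewrite !x0|rewrite !xN].
rewrite -/(grid_sum (d :: ds) b _) grid_sum_telescope ?inE ?jds ?orbT//.
rewrite (@grid_sum_ext _ _ _ (fun=> 0)) ?grid_sum0// => p _.
by rewrite !face ?addr0; [|left|right].
Qed.

Lemma grid_sum_neq0 ds b F : grid_sum ds b F <> 0 -> exists2 p,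
  (forall i, i \in ds -> (p i < N)%N) /\ (forall i, i \notin ds -> p i = b i) & F p <> 0.
Proof.
elim: ds b => [|d ds IH] b /=; first by exists b.
move=> h; have [t ht] : exists t : 'I_N, grid_sum ds (grid_set b d t) F <> 0.
  by apply/existsNP => h0; apply: h; apply: big1.
have [p [p1 p2] Fp] := IH _ ht; exists p => //; split=> i.
  rewrite inE; case: (boolP (i \in ds)) => [/p1//|/p2 -> /=].
  by rewrite orbF /grid_set => ->.
by rewrite inE negb_or => /andP[id /p2 ->]; rewrite /grid_set (negbTE id).
Qed.

Lemma cup_product_neq0 p D xs y : cup_product p D xs <> 0 -> y \in xs ->
  exists q q', [/\ forall i, (p i <= q i <= p i + (i \in D))%N,
    forall i, (p i <= q' i <= p i + (i \in D))%N & y q <> y q'].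
Proof.
elim: xs p D => [//|z zs IH] p D /= h.
have [j jD hj] : exists2 j, j \in D &
    (z (grid_succ p j) + z p) * cup_product (grid_succ p j) (D :\ j) zs <> 0.
  by apply/not_exists2P => h0; apply: h; apply: big1 => j; case: (h0 j) => // /contrapT.
have sj i : grid_succ p j i = (p i + (i == j))%N.
  by rewrite /grid_succ /grid_set; case: eqP => [->|]; rewrite ?addn1 ?addn0.
rewrite inE => /predU1P[->|yzs].
  exists (grid_succ p j), p; split=> [i|i|e]; last by apply: hj; rewrite e addKK mul0r.
    by rewrite sj leq_addr leq_add2l /=; case: eqP => [->|]; rewrite ?jD.
  by rewrite leqnn leq_addr.
have /IH/(_ yzs)[q [q' [q1 q2 qq']]] : cup_product (grid_succ p j) (D :\ j) zs <> 0.
  by move=> h0; apply: hj; rewrite h0 mulr0.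
exists q, q'; split=> // i; [have := q1 i|have := q2 i]; rewrite sj !inE;
  case: (eqVneq i j) => [->|_]; rewrite ?jD /= ?addn0//; lia.
Qed.

(** The cup products add up to 1, so one of them is nonzero, and on its cell no label can be
    constant. *)
Lemma cubical_sperner : exists p, (forall i, (p i < N)%N) /\
  forall j, exists q q', [/\ forall i, (p i <= q i <= (p i).+1)%N,
    forall i, (p i <= q' i <= (p i).+1)%N & x j q <> x j q'].
Proof.
have := @grid_sum_cup (enum 'I_m) (fun=> 0%N) (enum_uniq _).
move=> h; have /grid_sum_neq0[p [p1 _] pn] : grid_sum (enum 'I_m) (fun=> 0%N)
    (fun p => cup_product p [set i in enum 'I_m] (map x (enum 'I_m))) <> 0.
  by rewrite h; apply/eqP; rewrite oner_neq0.
exists p; split=> [i|j]; first by apply: p1; rewrite mem_enum.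
have xj : x j \in map x (enum 'I_m) by apply/map_f; rewrite mem_enum.
have [q [q' [q1 q2 qq']]] := cup_product_neq0 pn xj; exists q, q'.
split=> // i; [have := q1 i|have := q2 i]; rewrite inE mem_enum addn1//.
Qed.

End CubicalSperner.

Lemma rV_box_compact (R : realType) (m : nat) (r : R) :
  compact [set x : 'rV[R]_m | `|x| <= r].
Proof.
apply: bounded_closed_compact.
  by exists r; split; [exact: num_real|move=> M rM x /= /le_trans; apply; exact: ltW].
exact: (preimage_closed (fun z _ => @norm_continuous _ _ z) (@closed_le R r)).
Qed.

(** This is the Lebesgue number argument: finitely many of the neighbourhoods cover [K], and the
    least of their scales serves for all. *)
Lemma compact_uniform_radius (R : realType) (V : normedModType R) (K : set V)
    (Q : R -> V -> Prop) : compact K ->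
  (forall x, K x -> exists2 e, 0 < e & forall x' d, `|x' - x| < e -> 0 < d < e -> Q d x') ->
  exists2 d : R, 0 < d & forall x, K x -> Q d x.
Proof.
move=> cK loc.
have : \forall d \near 0^'+, K `<=` Q d.
  apply: ((compact_near_coveringP K).1 cK) => x /loc[e e0 eP].
  exists (ball x e, [set d : R | 0 < d < e]) => /=.
    split; first exact: nbhsx_ballx.
    by near=> d; apply/andP; split; near: d; [exact: nbhs_right_gt|exact: nbhs_right_lt].
  by move=> [x' d] /= [xx' de]; apply: eP; rewrite // distrC; rewrite -ball_normE in xx'.
move=> h; near (0 : R)^'+ => d; exists d => // x Kx.
have : K `<=` Q d by near: d.
exact.
Unshelve. all: by end_near. Qed.

Lemma continuous_norm_lt (R : realType) (V W : normedModType R) (F : V -> W) x e :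
  {for x, continuous F} -> 0 < e ->
  exists2 d, 0 < d & forall y, `|y - x| < d -> `|F y - F x| < e.
Proof.
move=> cF e0; have /nbhs_ballP[d /= d0 dP] : \forall y \near x, `|F y - F x| < e.
  by have /cvgrPdist_lt/(_ e e0) := cF; apply: filterS => y; rewrite distrC.
by exists d => // y yx; apply: dP; rewrite -ball_normE /= distrC.
Qed.

Lemma norm_lt_continuous (R : realType) (V W : normedModType R) (F : V -> W) x :
  (forall e, 0 < e -> exists2 d, 0 < d & forall y, `|y - x| < d -> `|F y - F x| < e) ->
  {for x, continuous F}.
Proof.
move=> h; apply/(@cvgrPdist_lt _ _ _ (nbhs x)) => e /h[d d0 dP]; apply/nbhs_ballP; exists d => // y.
by rewrite -ball_normE /= distrC => /dP; rewrite distrC.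
Qed.

Theorem brouwer_zero (R : realType) (m : nat) (F : 'rV[R]_m -> 'rV[R]_m) (r : R) :
  continuous F -> (forall x, r <= `|x| -> F x = x) -> exists x, F x = 0.
Proof.
wlog r0 : r / 0 < r.
  move=> h cF rF; apply: (h (Num.max r 1)) => //; first by rewrite lt_max ltr01 orbT.
  by move=> x; rewrite ge_max => /andP[/rF].
move=> cF rF; apply: contrapT => /forallNP nF.
(* Without zeros, some coordinate of [F] keeps its sign near each point, and by compactness at a
   uniform distance [d]. The Sperner lemma on a grid of mesh below [d] yields a cell on which every
   coordinate changes sign. *)
pose Q (d : R) (x : 'rV[R]_m) := exists j b, forall y, `|y - x| < d -> (0 < F y 0 j) = b.
have [|d d0 dP] := @compact_uniform_radius R _ [set x : 'rV[R]_m | `|x| <= r] Q (@rV_box_compact R m r).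
  move=> x _; have [j Fj] : exists j, F x 0 j <> 0.
    by apply/existsNP => h; apply: (nF x); apply/rowP => j; rewrite mxE.
  have Fj0 : 0 < `|F x 0 j| by rewrite normr_gt0; apply/eqP.
  have [e e0 eP] := continuous_norm_lt (cF x) Fj0.
  exists (e / 2); first by rewrite divr_gt0.
  move=> x' d xx' /andP[d0 de]; exists j, (0 < F x 0 j) => y yx'.
  have /eP/(le_lt_trans (rV_coord_le _ j)) : `|y - x| < e.
    rewrite -(subrKA x') (splitr e); apply: le_lt_trans (ler_normD _ _) _.
    by rewrite ltrD// (lt_trans yx').
  rewrite !mxE ltr_norml; case: (ltrP 0 (F x 0 j)) => Fxj.
    by rewrite gtr0_norm//; lra.
  by rewrite ler0_norm// => /andP[? ?]; apply/negbTE; rewrite -leNgt; lra.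
pose N := (Num.truncn (2 * r / d)).+1.
have N0 : 0 < N%:R :> R by rewrite ltr0n.
pose h := 2 * r / N%:R.
have h0 : 0 < h by rewrite /h !(mulr_gt0, invr_gt0).
have hd : h < d.
  by rewrite /h ltr_pdivrMr// (mulrC d) -ltr_pdivrMr//; exact: truncnS_gt.
have hN : h * N%:R = 2 * r by rewrite /h divfK// gt_eqF.
pose pt (p : 'I_m -> nat) : 'rV[R]_m := \row_i (h * (p i)%:R - r).
(* The label is the sign of a coordinate of [F]. On the faces of the cube [F] is the identity, so
   that opposite faces carry the labels 0 and 1 that the Sperner lemma requires. *)
pose x j p : 'F_2 := if 0 < F (pt p) 0 j then 1 else 0.
have F2 (a : 'F_2) : a + a = 0 by rewrite -mulr2n -mulr_natr pchar_Zp ?mulr0.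
have [||p [pN pP]] := @cubical_sperner m 'F_2 F2 N x.
- move=> j p pj; have ptj : pt p 0 j = - r by rewrite mxE pj mulr0 sub0r.
  rewrite /x rF; first by rewrite ptj ifF//; apply/negbTE; rewrite -leNgt; lra.
  by apply: le_trans (rV_coord_le _ j); rewrite ptj normrN ler_norm.
- move=> j p pj; have ptj : pt p 0 j = r by rewrite mxE pj hN; lra.
  rewrite /x rF; first by rewrite ptj ifT.
  by apply: le_trans (rV_coord_le _ j); rewrite ptj ler_norm.
have [|j [b jb]] := dP (pt p).
  apply: rV_norm_le => [|i]; first exact: ltW.
  rewrite mxE ler_norml; have : (p i)%:R <= N%:R :> R by rewrite ler_nat ltnW.
  have := ler0n R (p i); set a := _%:R => a0 aN.
  have : h * a <= 2 * r by rewrite -hN ler_wpM2l// ltW.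
  have : 0 <= h * a by rewrite mulr_ge0// ltW.
  by move=> ? ?; apply/andP; split; lra.
have near_p q : (forall i, (p i <= q i <= (p i).+1)%N) -> (0 < F (pt q) 0 j) = b.
  move=> pq; apply: jb; apply: le_lt_trans hd; apply: rV_norm_le => [|i]; first exact: ltW.
  rewrite !mxE; have /andP[pq1 pq2] := pq i.
  have -> : h * (q i)%:R - r - (h * (p i)%:R - r) = h * (q i - p i)%:R.
    by rewrite natrB//; ring.
  rewrite normrM gtr0_norm// ger0_norm// ger_pMr// -[1]/(1%:R) ler_nat; lia.
have [q [q' [q1 q2]]] := pP j.
by rewrite /x !near_p.
Qed.

(** * Circle-valued maps *)

Section CircleValued.
Context {R : realType}.

Lemma int_small (k : R) : k \is a Num.int -> `|k| < 1 -> k = 0.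
Proof.
move=> /intrP[z ->]; rewrite -intr_norm -[X in _ < X]/(1%:~R) ltr_int => h.
by have -> : z = 0 by lia.
Qed.

Section Definitions.
Context {X : topologicalType}.
Implicit Types (A : set X) (f : X -> R).

(* A real function that is continuous modulo the integers, that is, a
   continuous function with values in the circle [R / Z]. *)
Definition mod1_at A f x := forall e, 0 < e ->
  \forall y \near x, A y -> exists2 k, k \is a Num.int & `|f y - f x - k| < e.

Definition mod1_on A f := forall x, A x -> mod1_at A f x.

Lemma cvg_mod1 A f x : f @ within A (nbhs x) --> f x -> mod1_at A f x.
Proof.
move=> cf e e0; have /cvgrPdist_lt/(_ e e0) := cf; rewrite near_withinE.
by apply: filterS => y + Ay => /(_ Ay) h; exists 0; rewrite ?rpred0// subr0 distrC.
Qed.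

Lemma continuous_mod1 A f x : {for x, continuous f} -> mod1_at A f x.
Proof. by move=> cf; apply: cvg_mod1; apply: cvg_within_filter. Qed.

Lemma mod1_sub A B f x : B `<=` A -> mod1_at A f x -> mod1_at B f x.
Proof. by move=> BA h e /h; apply: filterS => y + /BA; exact. Qed.

Lemma mod1D A f g x : mod1_at A f x -> mod1_at A g x -> mod1_at A (f \+ g) x.
Proof.
move=> hf hg e e0; have e2 : 0 < e / 2 by rewrite divr_gt0.
apply: filterS2 (hf _ e2) (hg _ e2) => y + + Ay => /(_ Ay)[k kZ kP] /(_ Ay)[l lZ lP].
exists (k + l); first exact: rpredD.
have -> : (f \+ g) y - (f \+ g) x - (k + l) = (f y - f x - k) + (g y - g x - l).
  by rewrite /=; ring.
by rewrite (splitr e); apply: le_lt_trans (ler_normD _ _) _; rewrite ltrD.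
Qed.

Lemma mod1N A f x : mod1_at A f x -> mod1_at A (fun z => - f z) x.
Proof.
move=> hf e /hf; apply: filterS => y + Ay => /(_ Ay)[k kZ kP].
exists (- k); first by rewrite rpredN.
rewrite -normrN; suff -> : - (- f y - - f x - - k) = f y - f x - k by [].
by ring.
Qed.

Lemma mod1_eq A f g x : A x -> (forall y, A y -> g y - f y \is a Num.int) ->
  mod1_at A f x -> mod1_at A g x.
Proof.
move=> Ax fg hf e /hf; apply: filterS => y + Ay => /(_ Ay)[k kZ kP].
exists (k + (g y - f y) - (g x - f x)); first by apply: rpredB; [apply: rpredD => //|]; exact: fg.
suff -> : g y - g x - (k + (g y - f y) - (g x - f x)) = f y - f x - k by [].
by ring.
Qed.

Lemma mod1_closed_cover A B f x : closed A -> closed B ->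
  (A x -> mod1_at A f x) -> (B x -> mod1_at B f x) -> mod1_at (A `|` B) f x.
Proof.
have half C : closed C -> (C x -> mod1_at C f x) -> forall e, 0 < e ->
    \forall y \near x, C y -> exists2 k, k \is a Num.int & `|f y - f x - k| < e.
  move=> clC hC e e0; have [Cx|nCx] := pselect (C x); first exact: hC.
  have : nbhs x (~` C) by apply: open_nbhs_nbhs; split=> //; exact: closed_openC.
  by apply: filterS => y nCy Cy; case: nCy.
move=> clA clB hA hB e e0.
by apply: filterS2 (half A clA hA e e0) (half B clB hB e e0) => y Ay By [/Ay|/By].
Qed.

End Definitions.

Lemma mod1_comp (X Y : topologicalType) (A : set X) (B : set Y) (f : X -> R) (h : Y -> X) y :
  {for y, continuous h} -> (forall z, B z -> A (h z)) ->
  mod1_at A f (h y) -> mod1_at B (f \o h) y.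
Proof.
move=> ch BA hf e /hf he; have : \forall z \near y, A (h z) ->
  exists2 k, k \is a Num.int & `|f (h z) - f (h y) - k| < e by exact: (ch _ he).
by apply: filterS => z hz /BA; exact: hz.
Qed.

Lemma int_near_eq (X : topologicalType) (f : X -> R) x :
  {for x, continuous f} -> (\forall y \near x, f y \is a Num.int) ->
  \forall y \near x, f y = f x.
Proof.
move=> cf fZ; have fx := nbhs_singleton fZ.
have /cvgrPdist_lt/(_ 1 ltr01) := cf; apply: filterS2 fZ => y fy.
by move=> /(int_small (rpredB fx fy))/eqP; rewrite subr_eq0 => /eqP.
Qed.

Section LocalLift.
Context {X : topologicalType}.

Let round (a : R) : R := (Num.floor (a + 2^-1))%:~R.

(** Subtracting from [f] the integer nearest to its variation from [f x] removes the jumps. *)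
Lemma mod1_local_lift (A : set X) (f : X -> R) x : A x -> mod1_at A f x ->
  exists (W : set X) (g : X -> R), [/\ open W, W x, (forall y, g y - f y \is a Num.int) &
    forall y, W y -> A y -> mod1_at A f y -> g @ within A (nbhs y) --> g y].
Proof.
(* With the bound 1/4, two values of [g] differ by less than 1/2, so the integer [k'] in the
   estimate of their difference is below 3/4 in absolute value, hence 0. *)
move=> Ax fx; have q0 : 0 < 4^-1 :> R by rewrite invr_gt0.
pose g y := f y - round (f y - f x).
have gZ y : g y - f y \is a Num.int.
  by rewrite /g addrAC subrr sub0r rpredN /round intr_int.
have /nbhs_interior : \forall y \near x, A y -> `|g y - f x| < 4^-1.
  have := fx _ q0; apply: filterS => y + Ay => /(_ Ay)[k kZ kP].
  suff -> : g y = f y - k by rewrite addrAC.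
  rewrite /g; congr (_ - _); apply/eqP; rewrite -subr_eq0; apply/eqP.
  apply: int_small; first by rewrite rpredB// /round intr_int.
  have := @real_floor_itv R (f y - f x + 2^-1) (num_real _).
  move: kP; rewrite /round; set r := _%:~R => kP /andP[r1].
  rewrite intrD1 -/r => r2.
  by move: kP; rewrite !ltr_norml => /andP[? ?]; apply/andP; split; lra.
set W := (X in nbhs x X) => Wx.
exists (interior [set y | A y -> `|g y - f x| < 4^-1]), g; split => //.
- exact: open_interior.
- exact: nbhs_singleton.
- move=> y Wy Ay fy; apply/cvgrPdist_lt => e e0; rewrite near_withinE.
  have e'0 : 0 < Num.min e 4^-1 by rewrite lt_min e0.
  have gy := nbhs_singleton Wy Ay : `|g y - f x| < 4^-1.
  apply: filterS2 (fy _ e'0) Wy => z + + Az => /(_ Az)[k kZ kP] /(_ Az) gz.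
  pose k' := k + (g z - f z) - (g y - f y).
  have kE : g z - g y - k' = f z - f y - k by rewrite /k'; ring.
  move: kP; rewrite -kE lt_min => /andP[k1 k2].
  suff k'0 : k' = 0 by rewrite distrC; move: k1; rewrite k'0 subr0.
  apply: int_small; first by apply: rpredB; [apply: rpredD|].
  by move: gz gy k2; rewrite !ltr_norml => /andP[? ?] /andP[? ?] /andP[? ?];
    apply/andP; split; lra.
Qed.

End LocalLift.

(** The local real lifts form a locally constant family, because two of them differ by a continuous
    function with integer values. *)
Theorem mod1_star_lift (V : normedModType R) (Om : set V) (x0 : V) (f : V -> R) :
  open Om -> Om x0 ->
  (forall x (t : R), Om x -> 0 <= t <= 1 -> Om (x0 + t *: (x - x0))) ->
  (forall x, Om x -> mod1_at setT f x) ->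
  exists F : V -> R, forall x, Om x -> {for x, continuous F} /\ F x - f x \is a Num.int.
Proof.
move=> oOm Om0 star fOm.
have local x : Om x -> exists (W : set V) (g : V -> R), [/\ open W, W x,
    (forall y, g y - f y \is a Num.int) &
    forall y, W y -> mod1_at setT f y -> {for y, continuous g}].
  move=> /fOm /(mod1_local_lift (x := x) I)[W [g [oW Wx gZ gc]]].
  exists W, g; split=> // y Wy fy B By.
  have : within setT (nbhs y) (g @^-1` B) by exact: (gc y Wy I fy).
  by rewrite /within /=; apply: filterS => z; apply.
pose Fam (W : set V) (g : V -> R) :=
  open W /\ forall z, W z -> {for z, continuous g} /\ g z - f z \is a Num.int.
have lc : @locally_constant_family R V R setT Fam Om.
  move=> x Omx; have [W [g [oW Wx gZ gc]]] := local x Omx.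
  have cg y : (W `&` Om) y -> {for y, continuous g} by move=> [Wy /fOm]; exact: gc.
  exists (W `&` Om), [set h | exists2 k, k \is a Num.int & h = fun z => g z + k]; split.
  - by split=> //; exact: openI.
  - move=> _ [k kZ ->]; split; first exact: openI.
    move=> z /cg cgz; split; first by apply: cvgD; [exact: cgz|exact: cvg_cst].
    by rewrite addrAC rpredD.
  - move=> y W' g' /cg cgy [oW' g'P] W'y; have [cg' g'Z] := g'P _ W'y.
    exists (fun z => g z + (g' y - g y)).
      exists (g' y - g y) => //.
      have -> : g' y - g y = (g' y - f y) - (g y - f y) by ring.
      exact: rpredB.
    have cd : {for y, continuous (fun z => g' z - g z)} by apply: cvgB.
    have : \forall z \near y, g' z - g z = g' y - g y.
      apply: int_near_eq cd _; near=> z.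
      have -> : g' z - g z = (g' z - f z) - (g z - f z) by ring.
      rewrite rpredB//; suff: W' z by move=> /g'P[].
      by near: z; exact: open_nbhs_nbhs.
    by apply: filterS => z <- _; rewrite addrC subrK.
  - move=> _ _ y z [k kZ ->] [k' k'Z ->] _ /agree_at/(_ I)/addrI -> //.
have [W [g [oW Wx gZ gc]]] := local x0 Om0.
have F0 : Fam (W `&` Om) g.
  by split=> [|z [Wz /fOm fz]]; [exact: openI|split=> //; exact: gc].
have [F _ FP] := monodromy oOm star Om0 lc F0 (conj Wx Om0).
exists F => x Omx; have [W' [h [[oW' hP] W'x Fh]]] := FP x Omx.
have [ch hZ] := hP _ W'x; split; last by rewrite (agree_at Fh I).
have hF : \forall z \near x, h z = F z by apply: filterS Fh => z /(_ I).
have ch' : h @ x --> F x by rewrite -(nbhs_singleton hF); exact: ch.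
exact: cvg_trans (near_eq_cvg hF) ch'.
Unshelve. all: by end_near. Qed.

Corollary mod1_lift (V : normedModType R) (f : V -> R) : mod1_on setT f ->
  exists2 F : V -> R, continuous F & forall x, F x - f x \is a Num.int.
Proof.
move=> fm; have [|F FP] := @mod1_star_lift V setT 0 f openT I (fun _ _ _ _ => I).
  by move=> x _; exact: fm.
by exists F => x; case: (FP x I).
Qed.

Lemma lift_eq (V : normedModType R) (F G : V -> R) x y :
  continuous F -> continuous G -> (forall z, F z - G z \is a Num.int) ->
  F x - G x = F y - G y.
Proof.
move=> cF cG FG; apply: (@locally_constant_seg R V _ setT (fun z => F z - G z)) => // z _.
apply: int_near_eq; last exact: nearW.
by apply: cvgB; [exact: cF|exact: cG].
Qed.

End CircleValued.

(** * Splitting a circle-valued map along two closed sets *)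

Lemma tietze_compact (R : realType) (V : normedModType R) (A : set V) (g : V -> R) :
  compact A -> (forall x, A x -> g @ within A (nbhs x) --> g x) ->
  exists2 h : V -> R, continuous h & forall x, A x -> h x = g x.
Proof.
move=> cA cg; have cg' : {within A, continuous g} by apply/subspace_continuousP.
have [M [_ Mb]] := compact_bounded (continuous_compact cg' cA).
have M1 : M < `|M| + 1 by rewrite (le_lt_trans (ler_norm M))// ltrDl.
have [|||||h [gh ch _]] := @continuous_bounded_extension V R _ A _ g (`|M| + 1).
- exact: pseudometric_normal.
- exact: compact_closed.
- by rewrite ltr_wpDl.
- exact: cg'.
- by move=> x Ax; apply: (Mb _ M1); exists x.
by exists h => // x Ax; rewrite -gh//; exact: mem_set.
Qed.

Section Boxes.
Context {R : realType} {m : nat}.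
Implicit Types (a b x : 'rV[R]_m).

Definition box a b : set 'rV[R]_m := [set x | forall i, a 0 i <= x 0 i <= b 0 i].

Definition box_proj a b x : 'rV[R]_m := \row_i Num.max (a 0 i) (Num.min (b 0 i) (x 0 i)).

Definition row_set a (i : 'I_m) (c : R) : 'rV[R]_m := \row_j if j == i then c else a 0 j.

Lemma box_proj_in a b x : (forall i, a 0 i <= b 0 i) -> box a b (box_proj a b x).
Proof. by move=> ab i; rewrite mxE le_max lexx /= ge_max ab ge_min lexx. Qed.

Lemma box_proj_id a b x : box a b x -> box_proj a b x = x.
Proof.
by move=> h; apply/rowP => i; have /andP[h1 h2] := h i; rewrite mxE min_r// max_r.
Qed.

Lemma box_proj_continuous a b : continuous (box_proj a b).
Proof.
apply: continuous_mx => i j; rewrite ord1.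
rewrite (_ : (fun z => _) = fun z : 'rV_m => Num.max (a 0 j) (Num.min (b 0 j) (z 0 j))).
  apply: continuous_maxfun; first exact: cst_continuous.
  by apply: continuous_minfun; [exact: cst_continuous|exact: coord_continuous].
by apply/funext => z; rewrite mxE.
Qed.

Lemma coord_le_closed (i : 'I_m) c : closed [set x : 'rV[R]_m | x 0 i <= c].
Proof. exact: (preimage_closed (fun z _ => @coord_continuous _ _ _ 0 i z) (@closed_le R c)). Qed.

Lemma coord_ge_closed (i : 'I_m) c : closed [set x : 'rV[R]_m | c <= x 0 i].
Proof. exact: (preimage_closed (fun z _ => @coord_continuous _ _ _ 0 i z) (@closed_ge R c)). Qed.

Lemma box_closed a b : closed (box a b).
Proof.
have -> : box a b = \bigcap_i ([set x | a 0 i <= x 0 i] `&` [set x | x 0 i <= b 0 i]).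
  apply/seteqP; split=> x h i; first by move=> _; have /andP[] := h i.
  by apply/andP; exact: h.
by apply: closed_bigI => i _; apply: closedI; [exact: coord_ge_closed|exact: coord_le_closed].
Qed.

Lemma boxS a b a' b' : (forall i, a' 0 i <= a 0 i) -> (forall i, b 0 i <= b' 0 i) ->
  box a b `<=` box a' b'.
Proof.
move=> aa bb x h i; have /andP[h1 h2] := h i.
by rewrite (le_trans (aa i))// (le_trans h2).
Qed.

End Boxes.

Section CircleSum.
Context {R : realType} {m : nat}.
Variables (N1 N2 : set 'rV[R]_m) (f : 'rV[R]_m -> R).
Hypotheses (clN1 : closed N1) (clN2 : closed N2).
Hypothesis cover : forall x, N1 x \/ N2 x.
Hypothesis fT : mod1_on (N1 `&` N2) f.
Implicit Types (B : set 'rV[R]_m).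

Definition circle_sum_on B := exists f1 f2 : 'rV[R]_m -> R,
  [/\ mod1_on (N1 `&` B) f1, mod1_on (N2 `&` B) f2 &
    forall x, N1 x -> N2 x -> B x -> f x - (f1 x + f2 x) \is a Num.int].

Lemma circle_sum_sub B B' : B' `<=` B -> circle_sum_on B -> circle_sum_on B'.
Proof.
move=> BB [f1 [f2 [h1 h2 h]]]; exists f1, f2; split.
- by move=> x [Nx /BB Bx]; apply: mod1_sub (h1 x (conj Nx Bx)) => y [Ny /BB].
- by move=> x [Nx /BB Bx]; apply: mod1_sub (h2 x (conj Nx Bx)) => y [Ny /BB].
- by move=> x x1 x2 /BB; exact: h.
Qed.

(** Near a common point of both sets, [f] lifts to a real function on a compact part of their
    intersection. Its Tietze extension is the first summand, and the second is 0. Near any other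
    point one of the sets is absent and nothing has to match. *)
Lemma circle_sum_local x : exists2 e : R, 0 < e & circle_sum_on [set y | `|y - x| < e].
Proof.
have cst B (y : 'rV[R]_m) : mod1_at B (fun=> 0 : R) y.
  by apply: continuous_mod1; exact: cst_continuous.
have away (N : set 'rV[R]_m) : closed N -> ~ N x ->
    exists2 e, 0 < e & forall y, `|y - x| < e -> ~ N y.
  move=> cN nN; have /nbhs_ballP[e /= e0 eP] : nbhs x (~` N).
    by apply: open_nbhs_nbhs; split=> //; exact: closed_openC.
  by exists e => // y yx; apply: eP; rewrite -ball_normE /= distrC.
have [x1|/(away _ clN1)[e e0 eP]] := pselect (N1 x); last first.
  by exists e => //; exists (fun=> 0), (fun=> 0); split=> // y y1 _ /eP.
have [x2|/(away _ clN2)[e e0 eP]] := pselect (N2 x); last first.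
  by exists e => //; exists (fun=> 0), (fun=> 0); split=> // y _ y2 /eP.
have xT : (N1 `&` N2) x by [].
have [W [g [oW Wx gZ cg]]] := mod1_local_lift xT (fT xT).
have /nbhs_ballP[e /= e0 eW] := open_nbhs_nbhs (conj oW Wx).
have e20 : 0 < e / 2 by rewrite divr_gt0.
pose C := N1 `&` N2 `&` [set y | `|y - x| <= e / 2].
have CW : C `<=` W.
  move=> y [_ yx]; apply: eW; rewrite -ball_normE /= distrC.
  by apply: le_lt_trans yx _; rewrite ltr_pdivrMr// ltr_pMr// ltr1n.
have clC : closed [set y : 'rV[R]_m | `|y - x| <= e / 2].
  have cn : continuous (fun y : 'rV[R]_m => `|y - x|).
    move=> z; have cz : (fun y => y - x) @ z --> z - x by exact: cvgB cvg_id (cvg_cst _).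
    exact: cvg_norm cz.
  exact: (preimage_closed (fun z _ => cn z) (@closed_le R (e / 2))).
have cC : compact C.
  apply: bounded_closed_compact; last by apply: closedI => //; exact: closedI.
  exists (`|x| + e / 2); split; first exact: num_real.
  move=> M /ltW Mx y [_ yx]; apply: le_trans Mx.
  by rewrite -(subrK x y) (le_trans (ler_normD _ _))// addrC lerD2l.
have [h ch hg] : exists2 h : 'rV[R]_m -> R, continuous h & forall y, C y -> h y = g y.
  apply: tietze_compact => // y Cy B gB.
  have : within (N1 `&` N2) (nbhs y) (g @^-1` B).
    by apply: (cg y (CW _ Cy) Cy.1 (fT Cy.1)).
  by rewrite /within /=; apply: filterS => z zB [zN _]; apply: zB.
exists (e / 2) => //; exists h, (fun=> 0); split=> //.
  by move=> y _; apply: continuous_mod1; exact: ch.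
move=> y y1 y2 yx; rewrite addr0 hg; last by split=> //; exact: ltW.
by rewrite -rpredN opprB.
Qed.

(** On the common face the two decompositions differ by a circle-valued function [u], given by the
    first summands on [N1] and by the second ones on [N2]. A real lift of [u], added to one summand
    and subtracted from the other beyond the face, makes them match. *)
Lemma circle_sum_glue (a b : 'rV[R]_m) i c : (forall j, a 0 j <= b 0 j) ->
  a 0 i <= c <= b 0 i ->
  circle_sum_on (box a (row_set b i c)) -> circle_sum_on (box (row_set a i c) b) ->
  circle_sum_on (box a b).
Proof.
move=> ab /andP[ac cb] [g1 [g2 [g1m g2m gf]]] [h1 [h2 [h1m h2m hf]]].
set Bm := box a (row_set b i c); set Bp := box (row_set a i c) b.
pose Fc := box (row_set a i c) (row_set b i c).
have aap j : a 0 j <= row_set a i c 0 j by rewrite mxE; case: eqP => // ->.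
have bbp j : row_set b i c 0 j <= b 0 j by rewrite mxE; case: eqP => // ->.
have Fm : Fc `<=` Bm by exact: boxS.
have Fp : Fc `<=` Bp by exact: boxS.
have mB : Bm `<=` box a b by exact: boxS.
have pB : Bp `<=` box a b by exact: boxS.
have BF x : Bm x -> Bp x -> Fc x.
  by move=> xm xp j; have /andP[_ ->] := xm j; have /andP[-> _] := xp j.
have Bmc x : Bm x -> x 0 i <= c by move=> /(_ i)/andP[_]; rewrite mxE eqxx.
have Bpc x : Bp x -> c <= x 0 i by move=> /(_ i)/andP[+ _]; rewrite mxE eqxx.
have BcP x : box a b x -> (if x 0 i <= c then Bm x else Bp x).
  move=> xB; case: leP => xc j; have /andP[j1 j2] := xB j; rewrite mxE;
    case: eqP => [->|_]; rewrite ?j1 ?j2 ?xc ?(ltW xc) ?andbT//.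
  - by have /andP[] := xB i.
  - by have /andP[] := xB i.
pose u x := if `[< N1 x >] then g1 x - h1 x else h2 x - g2 x.
have u2 x : N2 x -> Fc x -> u x - (h2 x - g2 x) \is a Num.int.
  move=> x2 xF; rewrite /u; case: asboolP => [x1|_]; last by rewrite subrr rpred0.
  have -> : g1 x - h1 x - (h2 x - g2 x) = (f x - (h1 x + h2 x)) - (f x - (g1 x + g2 x)).
    by ring.
  by apply: rpredB; [apply: hf => //; exact: Fp|apply: gf => //; exact: Fm].
have um : mod1_on Fc u.
  move=> x xF; have -> : Fc = (N1 `&` Fc) `|` (N2 `&` Fc).
    apply/seteqP; split=> y; last by move=> [] [].
    by move=> yF; have [y1|y2] := cover y; [left|right].
  have clF := @box_closed R m (row_set a i c) (row_set b i c).
  apply: mod1_closed_cover => [||x1|x2]; try exact: closedI.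
    apply: (@mod1_eq R _ _ (g1 \+ (fun z => - h1 z))) => //.
      move=> y [y1 _]; rewrite /u /=.
      by case: asboolP => // _; rewrite subrr rpred0.
    apply: mod1D.
      by apply: mod1_sub (g1m x (conj x1.1 (Fm _ xF))) => y [? /Fm].
    by apply: mod1N; apply: mod1_sub (h1m x (conj x1.1 (Fp _ xF))) => y [? /Fp].
  apply: (@mod1_eq R _ _ (h2 \+ (fun z => - g2 z))) => //.
    by move=> y [y2 yF]; exact: u2.
  apply: mod1D.
    by apply: mod1_sub (h2m x (conj x2.1 (Fp _ xF))) => y [? /Fp].
  by apply: mod1N; apply: mod1_sub (g2m x (conj x2.1 (Fm _ xF))) => y [? /Fm].
(* Composition with the projection onto the face extends [u] to the whole space, where [mod1_lift]
   applies. *)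
pose pr := box_proj (row_set a i c) (row_set b i c).
have prF x : Fc (pr x).
  by apply: box_proj_in => j; rewrite !mxE; case: eqP.
have [th cth thu] : exists2 th : 'rV[R]_m -> R, continuous th &
    forall x, th x - (u \o pr) x \is a Num.int.
  apply: mod1_lift => x _; apply: (@mod1_comp R _ _ Fc) => //.
  - exact: box_proj_continuous.
  - exact: um.
have thF x : Fc x -> th x - u x \is a Num.int.
  by move=> xF; have := thu x; rewrite /= /pr box_proj_id.
have glue (N : set 'rV[R]_m) (g h k : 'rV[R]_m -> R) : closed N ->
    mod1_on (N `&` Bm) g -> mod1_on (N `&` Bp) h -> continuous k ->
    (forall x, N x -> Fc x -> k x - (g x - h x) \is a Num.int) ->
    mod1_on (N `&` box a b) (fun x => if x 0 i <= c then g x else h x + k x).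
  move=> clN gm hm ck kF x [xN xB].
  have -> : N `&` box a b = (N `&` Bm) `|` (N `&` Bp).
    apply/seteqP; split=> y; last by move=> [] [yN]; [move=> /mB|move=> /pB].
    by move=> [yN /BcP]; case: ifP => _ ?; [left|right].
  apply: mod1_closed_cover => [||xm|xp]; try by apply: closedI => //; exact: box_closed.
    apply: (@mod1_eq R _ _ g) => //; last exact: gm.
    by move=> y [_ /Bmc ->]; rewrite subrr rpred0.
  apply: (@mod1_eq R _ _ (h \+ k)) => //.
    move=> y [yN yp]; case: ifP => [yc|_]; last by rewrite /= subrr rpred0.
    have yF : Fc y.
      by apply: (BF y _ yp); have := BcP y (pB _ yp); rewrite yc.
    have -> : g y - (h \+ k) y = - (k y - (g y - h y)) by rewrite /=; ring.
    by rewrite rpredN; exact: kF.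
  by apply: mod1D; [exact: hm|apply: continuous_mod1; exact: ck].
exists (fun x : 'rV[R]_m => if x 0 i <= c then g1 x else h1 x + th x).
exists (fun x : 'rV[R]_m => if x 0 i <= c then g2 x else h2 x + (- th x)); split.
- apply: glue => // x x1 xF; have := thF x xF; rewrite /u.
  by case: asboolP.
- apply: glue => //; first by move=> x; exact: (cvgN (cth x)).
  move=> x x2 xF; rewrite -rpredN.
  have -> : - (- th x - (g2 x - h2 x)) = (th x - u x) + (u x - (h2 x - g2 x)) by ring.
  by apply: rpredD; [exact: thF|exact: u2].
- move=> x x1 x2 /BcP; case: ifP => _ xB; first exact: gf.
  have -> : h1 x + th x + (h2 x - th x) = h1 x + h2 x by ring.
  exact: hf.
Qed.

(** [S] lists the directions in which the box may still be longer than [h]. A direction is dealt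
    with by cutting off slabs of width [h] one after the other and gluing. *)
Lemma circle_sum_box (r h : R) (S : seq 'I_m) (a b : 'rV[R]_m) : 0 < h ->
  (forall x, `|x| <= r -> circle_sum_on [set y | `|y - x| <= h]) ->
  (forall i, [/\ - r <= a 0 i, a 0 i <= b 0 i & b 0 i <= r]) ->
  (forall i, i \notin S -> b 0 i - a 0 i <= h) ->
  circle_sum_on (box a b).
Proof.
move=> h0 loc; elim: S a b => [|i S IH] a b ab small.
  (* In dimension 0 no coordinate forces [r] to be nonnegative; when [loc] cannot be used for this
     reason, the local statement is used directly. *)
  have [m0|[i0]] : (m = 0)%N \/ inhabited 'I_m.
    by case: (m) => [|k]; [left|right; constructor; exact: ord0].
    have -> : box a b = [set y | `|y - 0| <= h].
      apply/seteqP; split=> y _ => [|i]; last by have := ltn_ord i; rewrite {2}m0.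
      by apply: rV_norm_le => [|i]; [exact: ltW|have := ltn_ord i; rewrite {2}m0].
    have [r0|r0] := leP 0 r; first by apply: loc; rewrite normr0.
    have [e e0 eP] := circle_sum_local 0; apply: circle_sum_sub eP => y _ /=.
    by apply/rV_norm_lt; split=> // i; have := ltn_ord i; rewrite {2}m0.
  have r0 : 0 <= r by have [? ? ?] := ab i0; lra.
  apply: circle_sum_sub (loc a _) => [y yab|]; last first.
    by apply: rV_norm_le => // i; have [? ? ?] := ab i; rewrite ler_norml; apply/andP; split; lra.
  apply: rV_norm_le => [|i]; first exact: ltW.
  have /andP[y1 y2] := yab i; rewrite !mxE ger0_norm ?subr_ge0//.
  by apply: le_trans (small i _); rewrite ?in_nil// lerD2r.
have [k kP] : exists k, b 0 i - a 0 i <= h * k.+1%:R.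
  exists (Num.truncn ((b 0 i - a 0 i) / h)); rewrite mulrC -ler_pdivrMr//.
  exact/ltW/truncnS_gt.
elim: k a b ab small kP => [|k IHk] a b ab small kP.
  apply: IH => // j jS; have [->|ji] := eqVneq j i; first by rewrite -[h]mulr1.
  by apply: small; rewrite inE negb_or ji.
pose c := Num.min (a 0 i + h) (b 0 i).
have [a1 a2 a3] := ab i.
have cP : (c = a 0 i + h /\ a 0 i + h <= b 0 i) \/ (c = b 0 i /\ b 0 i < a 0 i + h).
  by rewrite /c; case: leP => ?; [left|right].
have acb : a 0 i <= c <= b 0 i by apply/andP; case: cP => -[-> ?]; split; lra.
have [ac cb] := andP acb.
apply: (@circle_sum_glue a b i c) => //.
- by move=> j; have [] := ab j.
- apply: IH => j; rewrite mxE; case: eqP => [->|/eqP ji]; last 1 first.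
  + by move=> jS; apply: small; rewrite inE negb_or ji.
  + by split=> //; lra.
  + exact: ab.
  + by move=> _; case: cP => -[-> ?]; lra.
- apply: IHk => [j|j jS|]; rewrite !mxE.
  + case: eqP => [->|_]; last exact: ab.
    by split=> //; lra.
  + by rewrite ifF; [exact: small|apply/negbTE; apply: contraNneq jS => ->; rewrite inE eqxx].
  + rewrite eqxx; move: kP; rewrite -[k.+2%:R]natr1 mulrDr mulr1; set z := h * _ => kP.
    have z0 : 0 <= z by rewrite mulr_ge0// ltW.
    by case: cP => -[-> ?]; lra.
Qed.

(* Mayer-Vietoris for circle-valued maps: [R^m] has no cohomology in degree two. *)
Theorem circle_sum (r : R) : 0 < r -> (forall x, r <= `|x| -> N1 x) ->
  (forall x, N2 x -> `|x| <= r) ->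
  exists f1 f2 : 'rV[R]_m -> R, [/\ mod1_on N1 f1, mod1_on N2 f2 &
    forall x, N1 x -> N2 x -> f x - (f1 x + f2 x) \is a Num.int].
Proof.
move=> r0 far N2r; pose K : set 'rV[R]_m := [set x | `|x| <= r].
have [h h0 hP] : exists2 h : R, 0 < h &
    forall x, K x -> circle_sum_on [set y | `|y - x| <= h].
  apply: (compact_uniform_radius (@rV_box_compact R m r)) => x _.
  have [e e0 eP] := circle_sum_local x; exists (e / 2); first by rewrite divr_gt0.
  move=> x' d xx' /andP[_ de]; apply: circle_sum_sub eP => y /= yx'.
  rewrite -(subrKA x') (splitr e); apply: le_lt_trans (ler_normD _ _) _.
  by rewrite ltrD// (le_lt_trans yx').
pose a : 'rV[R]_m := const_mx (- r); pose b : 'rV[R]_m := const_mx r.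
have abr i : [/\ - r <= a 0 i, a 0 i <= b 0 i & b 0 i <= r].
  by rewrite !mxE; split; lra.
have boxP x : box a b x <-> `|x| <= r.
  split=> [xab|xr i].
    apply: rV_norm_le => [|i]; first exact: ltW.
    by have := xab i; rewrite !mxE ler_norml.
  by rewrite !mxE -ler_norml (le_trans (rV_coord_le _ _)).
have [|f1 [f2 [f1m f2m fP]]] := @circle_sum_box r h (enum 'I_m) a b h0 hP abr.
  by move=> i; rewrite mem_enum.
have prab x : box a b (box_proj a b x) by apply: box_proj_in => i; have [] := abr i.
(* The first summand is known on the box only and is extended by the projection. A point of norm at
   least [r] projects to one of norm at least [r], which lies in [N1]. *)
have pr1 x : N1 x -> N1 (box_proj a b x).
  move=> x1; have [xr|xr] := ltP `|x| r.
    by rewrite box_proj_id//; apply/boxP; exact: ltW.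
  apply: far; rewrite leNgt; apply/negP => /rV_norm_lt[_ pr]; move: xr; apply/negP.
  rewrite -ltNge; apply/rV_norm_lt; split=> // i; have := pr i; rewrite !mxE.
  rewrite !ltr_norml.
  rewrite lt_max ltxx /= lt_min gt_max gt_min ltxx /= => /andP[/andP[_ x1'] /andP[_ x2]].
  by rewrite x1'.
exists (f1 \o box_proj a b), f2; split.
- move=> x x1; apply: (@mod1_comp R _ _ (N1 `&` box a b)).
  + exact: box_proj_continuous.
  + by move=> z /pr1.
  + by apply: f1m; split=> //; exact: pr1.
- have -> : N2 = N2 `&` box a b.
    by apply/seteqP; split=> x; [move=> x2; split=> //; apply/boxP; exact: N2r|case].
  exact: f2m.
- move=> x x1 x2; have xab : box a b x by apply/boxP; exact: N2r.
  by rewrite /= box_proj_id//; exact: fP.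
Qed.

End CircleSum.

Lemma cvg_closedU (X Y : topologicalType) (A B : set X) (g : X -> Y) :
  closed A -> closed B ->
  (forall x, A x -> g @ within A (nbhs x) --> g x) ->
  (forall x, B x -> g @ within B (nbhs x) --> g x) ->
  forall x, g @ within (A `|` B) (nbhs x) --> g x.
Proof.
move=> clA clB gA gB x U Ux.
have half C : closed C -> (forall x, C x -> g @ within C (nbhs x) --> g x) ->
    \forall y \near x, C y -> U (g y).
  move=> clC gC; have [Cx|nCx] := pselect (C x); first exact: (gC x Cx U Ux).
  have : nbhs x (~` C) by apply: open_nbhs_nbhs; split=> //; exact: closed_openC.
  by apply: filterS => y nCy Cy; case: nCy.
rewrite /within /=; apply: filterS2 (half A clA gA) (half B clB gB) => y Ay By.
by move=> [/Ay|/By].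
Qed.

Lemma cvg_closed_cover (X Y : topologicalType) (A B : set X) (g : X -> Y) :
  closed A -> closed B -> (forall x, A x \/ B x) ->
  (forall x, A x -> g @ within A (nbhs x) --> g x) ->
  (forall x, B x -> g @ within B (nbhs x) --> g x) -> continuous g.
Proof.
move=> clA clB AB gA gB x U Ux.
have h : nbhs x (fun y => (A `|` B) y -> U (g y)) by exact: (cvg_closedU clA clB gA gB Ux).
have : nbhs x (fun y => U (g y)) by apply: filterS h => y h; exact: h (AB y).
exact.
Qed.

Lemma cvg_within_eq (X Y : topologicalType) (A : set X) (h g : X -> Y) x : A x ->
  (forall y, A y -> h y = g y) -> g @ within A (nbhs x) --> g x ->
  h @ within A (nbhs x) --> h x.
Proof.
move=> Ax hg cg U; rewrite hg// => Ux.
have Uy : nbhs x (fun y => A y -> U (g y)) by exact: (cg U Ux).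
have : nbhs x (fun y => A y -> U (h y)) by apply: filterS Uy => y Uy Ay; rewrite hg//; exact: Uy.
exact.
Qed.

Lemma row_cvg (R : realType) (X : topologicalType) (n : nat) (f : 'I_n -> X -> R) x :
  (forall j, {for x, continuous (f j)}) ->
  (fun y => \row_j f j y) @ x --> (\row_j f j x : 'rV[R]_n).
Proof.
move=> cf; apply/cvgrPdist_lt => e e0.
have : \forall y \near x, forall j, `|f j x - f j y| < e.
  by apply: filter_forall => j; have /cvgrPdist_lt/(_ e e0) := cf j.
by apply: filterS => y fy; apply/rV_norm_lt; split=> // j; rewrite !mxE; exact: fy.
Qed.

(** * Real lifts over a punctured space *)

Section PuncturedLift.
Context {R : realType} {n : nat}.
Let m := n.+3.
Implicit Types x : 'rV[R]_m.

(** For [s] equal to 1 or -1, the complement of a closed half of the first coordinate axis. It is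
    star-shaped about [s] times the first basis vector, and the two slit spaces cover the punctured
    space. *)
Let slit (s : R) : set 'rV[R]_m := [set x | 0 < s * x 0 0 \/ exists2 i, i != 0 & x 0 i != 0].

Let slit_open s : open (slit s).
Proof.
have c i : continuous (fun x : 'rV[R]_m => x 0 i) by exact: coord_continuous.
rewrite openE => x [h|[i i0 xi]].
  have cs : continuous (fun x : 'rV[R]_m => s * x 0 0).
    by move=> z; exact: (cvgMl_tmp (c 0 z)).
  have : nbhs x [set y : 'rV[R]_m | 0 < s * y 0 0].
    exact: (cs x _ (open_nbhs_nbhs (conj (@open_gt R 0) h))).
  by apply: filterS => y; left.
have : nbhs x [set y : 'rV[R]_m | y 0 i != 0].
  exact: (c i x _ (open_nbhs_nbhs (conj (@open_neq R 0) xi))).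
by apply: filterS => y yi; right; exists i.
Qed.

Let slit_star s x (t : R) : s * s = 1 -> slit s x -> 0 <= t <= 1 ->
  slit s (s *: delta_mx 0 0 + t *: (x - s *: delta_mx 0 0)).
Proof.
move=> ss xs /andP[t0 t1].
have [->|tn0] := eqVneq t 0.
  by left; rewrite scale0r addr0 !mxE !eqxx mulr1 ss.
have [[i i0 xi]|nx] := pselect (exists2 i, i != 0 & x 0 i != 0).
  right; exists i => //; rewrite !mxE (negbTE i0) /= mulr0 oppr0 add0r addr0.
  by rewrite mulf_neq0.
case: xs => // xs; left; rewrite !mxE !eqxx mulr1.
have -> : s * (s + t * (x 0 0 - s)) = (1 - t) * (s * s) + t * (s * x 0 0) by ring.
have tp : 0 < t by rewrite lt_neqAle eq_sym tn0.
have := mulr_gt0 tp xs; rewrite ss; lra.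
Qed.

(** A van Kampen argument: the lifts over the two slit spaces differ by a locally constant integer
    on the complement of the axis, which is connected because at least two further coordinates
    remain. Shifting one lift by this integer glues them. *)
Lemma mod1_punctured_lift (f : 'rV[R]_m -> R) :
  (forall x, x != 0 -> mod1_at setT f x) ->
  exists F : 'rV[R]_m -> R, forall x, x != 0 -> {for x, continuous F} /\ F x - f x \is a Num.int.
Proof.
move=> fm.
have slit0 s x : slit s x -> x != 0.
  by move=> h; apply/eqP => x0; move: h; rewrite x0 => -[|[i _]]; rewrite mxE ?mulr0 ?ltxx ?eqxx.
have lift s : s * s = 1 -> exists F : 'rV[R]_m -> R, forall x, slit s x ->
    {for x, continuous F} /\ F x - f x \is a Num.int.
  move=> ss; apply: (@mod1_star_lift R _ (slit s) (s *: delta_mx 0 0)) => //.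
  - by left; rewrite !mxE !eqxx mulr1 ss.
  - by move=> x t; exact: slit_star.
  - by move=> x /slit0; exact: fm.
have [F FP] := lift 1 (mulr1 1).
have [G GP] := lift (-1) (eq_trans (mulrNN 1 1) (mulr1 1)).
pose d x := F x - G x.
pose P (i : 'I_m) (c : R) := i != 0 /\ c != 0.
have dP x : (exists i, P i (x 0 i)) -> slit 1 x /\ slit (-1) x.
  by move=> [i [i0 xi]]; split; right; exists i.
have dc x : (exists i, P i (x 0 i)) -> \forall w \near x, d w = d x.
  move=> xP; have [x1 x2] := dP x xP; apply: int_near_eq.
    exact: (cvgB (FP x x1).1 (GP x x2).1).
  near=> z.
  have z1 : slit 1 z by near: z; apply: open_nbhs_nbhs; split.
  have z2 : slit (-1) z by near: z; apply: open_nbhs_nbhs; split.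
  have -> : d z = (F z - f z) - (G z - f z) by rewrite /d; ring.
  exact: (rpredB (FP z z1).2 (GP z z2).2).
pose x0 : 'rV[R]_m := const_mx 1.
have x0P : exists i, P i (x0 0 i) by exists 1; rewrite /P mxE !oner_neq0.
have dx0 x : (exists i, P i (x 0 i)) -> d x = d x0.
  move=> xP; apply: (@coordinate_union_constant R m _ P d) => // i.
  have [->|i1] := eqVneq i 1; last by exists 1, 1; rewrite eq_sym i1 /P !oner_neq0.
  by exists 2%:R, 1; rewrite /P oner_neq0.
have both x : slit 1 x -> slit (-1) x -> d x = d x0.
  move=> x1 x2; apply: dx0; case: x1 => [x1|[i i0 xi]]; last by exists i.
  by case: x2 => [|[i i0 xi]]; [move: x1; rewrite mulN1r mul1r; lra|exists i].
have dZ : d x0 \is a Num.int.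
  have [x1 x2] := dP x0 x0P.
  have -> : d x0 = (F x0 - f x0) - (G x0 - f x0) by rewrite /d; ring.
  exact: (rpredB (FP x0 x1).2 (GP x0 x2).2).
pose H x := if `[< slit 1 x >] then F x else G x + d x0.
have H2 x : slit (-1) x -> H x = G x + d x0.
  by move=> x2; rewrite /H; case: asboolP => // x1; rewrite -(both x x1 x2) /d; ring.
have H1 x : slit 1 x -> H x = F x by rewrite /H => /asboolP ->.
have cont (W : set 'rV[R]_m) (g : 'rV[R]_m -> R) x : open W -> W x ->
    (forall y, W y -> H y = g y) -> {for x, continuous g} -> {for x, continuous H}.
  move=> oW Wx Hg cg; have cg' : g @ x --> H x by rewrite Hg.
  have nW : nbhs x W by exact: open_nbhs_nbhs.
  have gH : \forall y \near x, g y = H y by apply: filterS nW => y /Hg ->.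
  exact: cvg_trans (near_eq_cvg gH) cg'.
exists H => x xn0; have [x1|x1] := pselect (slit 1 x).
  by have [cF FZ] := FP x x1; rewrite H1//; split=> //; exact: (cont (slit 1) F).
have x2 : slit (-1) x.
  have [xP|nx] := pselect (exists2 i, i != 0 & x 0 i != 0); first by right.
  left; rewrite mulN1r oppr_gt0 lt_neqAle; apply/andP; split; last first.
    by rewrite leNgt; apply/negP => h; apply: x1; left; rewrite mul1r.
  apply: contra_neq xn0 => x00; apply/rowP => i; rewrite mxE.
  have [->//|i0] := eqVneq i 0; apply/eqP; rewrite -[_ == _]negbK; apply/negP => xi.
  by apply: nx; exists i.
have [cG GZ] := GP x x2; rewrite H2//; split.
  apply: (cont (slit (-1)) (fun y => G y + d x0)) => //.
  exact: (cvgD cG (cvg_cst _)).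
by rewrite addrAC; exact: rpredD.
Unshelve. all: by end_near. Qed.

End PuncturedLift.

(** * Retractions onto an embedded torus *)

Section Inversion.
Context {R : realType} {m : nat}.
Implicit Types x : 'rV[R]_m.

(** Inversion in the unit sphere of the supremum norm. The value 0 at 0 makes it an involution
    everywhere; continuity is claimed only elsewhere. *)
Definition inversion x : 'rV[R]_m := `|x| ^- 2 *: x.

Lemma inversion_eq0 x : (inversion x == 0) = (x == 0).
Proof.
rewrite scaler_eq0 invr_eq0 expf_eq0 /= normr_eq0.
by case: eqP.
Qed.

Lemma norm_inversion x : x != 0 -> `|inversion x| = `|x|^-1.
Proof.
move=> x0; have n0 : `|x| != 0 by rewrite normr_eq0.
rewrite normrZ ger0_norm ?invr_ge0 ?exprn_ge0//.
by field.
Qed.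

Lemma inversionK x : inversion (inversion x) = x.
Proof.
have [->|x0] := eqVneq x 0; first by rewrite /inversion !scaler0.
have n0 : `|x| != 0 by rewrite normr_eq0.
rewrite {1}/inversion norm_inversion// /inversion scalerA.
by rewrite (_ : _ * _ = 1) ?scale1r//; field.
Qed.

Lemma inversion_continuous x : x != 0 -> {for x, continuous inversion}.
Proof.
move=> x0; have cn : (fun y : 'rV[R]_m => `|y| ^+ 2) @ x --> `|x| ^+ 2.
  have c1 := @norm_continuous R 'rV[R]_m x.
  exact: (cvgM c1 c1).
have cv : (fun y : 'rV[R]_m => `|y| ^- 2) @ x --> `|x| ^- 2.
  by apply: cvgV cn; rewrite expf_eq0 /= normr_eq0.
exact: (cvgZ cv cvg_id).
Qed.

(* Conjugating by the inversion in [q] turns this into Brouwer's theorem. *)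
Lemma no_exterior_contraction (h : 'rV[R]_m -> 'rV[R]_m) (q c : 'rV[R]_m) (e r : R) :
  continuous h -> 0 < e -> 0 < r -> (forall x, `|x - q| < e -> h x = x) ->
  (forall x, r < `|x| -> h x = c) -> (forall x, h x = q -> x = q) -> c != q -> False.
Proof.
move=> ch e0 r0 hq hc hinj cq.
pose H x := h (x + q) - q.
have cH : continuous H.
  move=> x; have cq' : (fun y : 'rV[R]_m => y + q) @ x --> x + q by exact: cvgD cvg_id (cvg_cst _).
  have chq : (fun y => h (y + q)) @ x --> h (x + q) by exact: (continuous_cvg _ (ch (x + q)) cq').
  exact: (cvgB chq (cvg_cst _)).
have H0 x : H x = 0 -> x = 0.
  move=> /eqP; rewrite subr_eq0 => /eqP/hinj/eqP.
  by rewrite -subr_eq0 addrK => /eqP.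
have He x : `|x| < e -> H x = x.
  by move=> xe; rewrite /H hq ?addrK//; rewrite addrK.
pose r' := r + `|q| + 1.
have r'0 : 0 < r' by rewrite /r' -addrA addr_gt0// ltr_wpDl.
have Hr x : r' <= `|x| -> H x = c - q.
  move=> xr; rewrite /H hc//.
  have := ler_normB (x + q) q; rewrite addrK => /(le_trans xr); rewrite /r'; lra.
(* [H] is constant near infinity and the identity near 0. Its conjugate is thus constant near 0,
   which dictates the value there, and the identity near infinity. A zero of it would come from a
   point other than 0 that [H] sends to 0. *)
pose k x := if x == 0 then inversion (c - q) else inversion (H (inversion x)).
have kfar x : e^-1 + 1 <= `|x| -> k x = x.
  move=> xe; have x0 : x != 0.
    apply: contraTneq xe => ->; rewrite normr0 -ltNge ltr_wpDl//.
    by rewrite invr_ge0 ltW.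
  rewrite /k (negbTE x0) He ?inversionK// norm_inversion// invf_plt ?posrE//.
    by rewrite (lt_le_trans _ xe)// ltrDl.
  by rewrite normr_gt0.
have k0 x : k x != 0.
  rewrite /k; case: (x =P 0) => [_|/eqP x0]; first by rewrite inversion_eq0 subr_eq0.
  rewrite inversion_eq0; apply/eqP => /H0 ix.
  by move: x0; rewrite -inversion_eq0 ix eqxx.
have ck : continuous k.
  move=> x; have [->|x0] := eqVneq x 0.
    have kc y : `|y| < r'^-1 -> k y = inversion (c - q).
      move=> yr; rewrite /k; case: (y =P 0) => // /eqP y0; rewrite Hr// norm_inversion//.
      by rewrite ltW// -ltf_pV2 ?posrE ?invr_gt0 ?normr_gt0// invrK.
    have kn : \forall y \near (0 : 'rV[R]_m), inversion (c - q) = k y.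
      apply/nbhs_ballP; exists r'^-1; first by rewrite /= invr_gt0.
      by move=> y; rewrite -ball_normE /= sub0r normrN => /kc ->.
    have c0 : (fun _ : 'rV[R]_m => inversion (c - q)) @ (0 : 'rV[R]_m) --> k 0.
      by rewrite -(nbhs_singleton kn); exact: cst_continuous.
    exact: cvg_trans (near_eq_cvg kn) c0.
  have kn : \forall y \near x, inversion (H (inversion y)) = k y.
    have : nbhs x [set y : 'rV[R]_m | y != 0].
      apply/nbhs_ballP; exists `|x|; first by rewrite /= normr_gt0.
      move=> y; rewrite -ball_normE /= => xy; apply: contraTneq xy => ->.
      by rewrite subr0 ltxx.
    by apply: filterS => y y0; rewrite /k (negbTE y0).
  have cx : (fun y => inversion (H (inversion y))) @ x --> k x.
    rewrite -(nbhs_singleton kn).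
    have c1 : (fun y => H (inversion y)) @ x --> H (inversion x).
      exact: (continuous_cvg _ (cH _) (inversion_continuous x0)).
    apply: (continuous_cvg _ (inversion_continuous _) c1).
    by apply/eqP => /H0 ix; move: x0; rewrite -inversion_eq0 ix eqxx.
  exact: cvg_trans (near_eq_cvg kn) cx.
have [x /eqP] := brouwer_zero ck kfar.
exact/negP.
Qed.

End Inversion.

Section Retraction.
Context {R : realType} {n m : nat}.
Variable (E : 'rV[R]_n -> 'rV[R]_m).
Hypothesis cE : continuous E.
Hypothesis perE : forall x z, E (x + int_row z) = E x.

(** The integer jumps of the functions [F] are absorbed by the periodicity of [E]. *)
Lemma periodic_cvg (X : topologicalType) (A : set X) (F : 'I_n -> X -> R) y :
  (forall k, mod1_at A (F k) y) ->
  (fun z => E (\row_k F k z)) @ within A (nbhs y) --> E (\row_k F k y).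
Proof.
move=> Fm U EU; have /nbhs_ballP[d /= d0 dP] := cE EU.
have : \forall z \near y, forall k, A z -> exists2 c, c \is a Num.int & `|F k z - F k y - c| < d.
  by apply: filter_forall => k; exact: Fm.
rewrite /within /=; apply: filterS => z Fz Az.
have /choice[c cP] k : exists c : int, `|F k z - F k y - c%:~R| < d.
  by have [c /intrP[c' ->] cd] := Fz k Az; exists c'.
rewrite /= -(perE _ (\row_k - c k)); apply: dP; rewrite -ball_normE /= distrC.
apply/rV_norm_lt; split=> // k; rewrite !mxE rmorphN /=.
by rewrite (_ : _ + - _ - _ = F k z - F k y - (c k)%:~R); [exact: cP|ring].
Qed.

Variables (N1 N2 : set 'rV[R]_m) (r : R) (q : 'rV[R]_m).
Hypotheses (clN1 : closed N1) (clN2 : closed N2).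
Hypothesis cover : forall x, N1 x \/ N2 x.
Hypothesis meet : forall x, N1 x -> N2 x -> range E x.
Hypothesis sub : forall x, N1 (E x) /\ N2 (E x).
Hypothesis r0 : 0 < r.
Hypothesis far : forall x, N2 x -> `|x| < r.
Hypothesis N1q : ~ N1 q.

Let far1 x : r <= `|x| -> N1 x.
Proof. by move=> xr; case: (cover x) => // /far; rewrite ltNge xr. Qed.

Lemma no_bounded_retraction (F : 'I_n -> 'rV[R]_m -> R) :
  (forall k, mod1_on N2 (F k)) ->
  (forall k x, F k (E x) - x 0 k \is a Num.int) -> False.
Proof.
move=> Fm FE.
pose h x := if `[< N1 x >] then x else E (\row_k F k x).
have h1 x : N1 x -> h x = x by rewrite /h => /asboolP ->.
have h2 x : N2 x -> h x = E (\row_k F k x).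
  move=> x2; rewrite /h; case: asboolP => // x1; have [u _ ux] := meet x1 x2.
  have /choice[c cP] k : exists c : int, F k (E u) - u 0 k = c%:~R by exact/intrP.
  rewrite -ux -[LHS](perE u (\row_k c k)); congr E; apply/rowP => k; rewrite !mxE -cP.
  by rewrite addrC subrK.
have h1N x : N1 (h x).
  case: (cover x) => [x1|x2]; first by rewrite h1.
  by rewrite h2//; case: (sub (\row_k F k x)).
have ch : continuous h.
  apply: (cvg_closed_cover clN1 clN2 cover) => x xN.
    apply: (cvg_within_eq (g := id) xN h1); apply: cvg_within_filter; exact: cvg_id.
  by apply: (cvg_within_eq xN h2); apply: periodic_cvg => // k; exact: Fm.
(* After translation by [q] the map is still the identity far away, and a zero would put [q] into
   the image of [h], which lies in [N1]. *)
pose H x := h (x + q) - q.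
have cH : continuous H.
  move=> x; have cq' : (fun y : 'rV[R]_m => y + q) @ x --> x + q by exact: cvgD cvg_id (cvg_cst _).
  have chq : (fun y => h (y + q)) @ x --> h (x + q) by exact: (continuous_cvg _ (ch (x + q)) cq').
  exact: (cvgB chq (cvg_cst _)).
have [|x /eqP] := @brouwer_zero R m H (r + `|q|) cH.
  move=> x xr; rewrite /H h1 ?addrK//; apply: far1.
  have := ler_normB (x + q) q; rewrite addrK => /(le_trans xr); lra.
by rewrite subr_eq0 => /eqP hq; apply: N1q; rewrite -hq.
Qed.

End Retraction.

Section UnboundedRetraction.
Context {R : realType} {n k : nat}.
Let m := k.+3.
Variable (E : 'rV[R]_n -> 'rV[R]_m).
Hypothesis cE : continuous E.
Hypothesis perE : forall x z, E (x + int_row z) = E x.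
Variables (N1 N2 : set 'rV[R]_m) (r : R) (q : 'rV[R]_m).
Hypotheses (clN1 : closed N1) (clN2 : closed N2).
Hypothesis cover : forall x, N1 x \/ N2 x.
Hypothesis meet : forall x, N1 x -> N2 x -> range E x.
Hypothesis sub : forall x, N1 (E x) /\ N2 (E x).
Hypothesis r0 : 0 < r.
Hypothesis far : forall x, N2 x -> `|x| < r.
Hypothesis N1q : ~ N1 q.

Let far1 x : r <= `|x| -> N1 x.
Proof. by move=> xr; case: (cover x) => // /far; rewrite ltNge xr. Qed.

(* The lifts of [F] to the real numbers over the simply connected exterior of
   a ball allow one to make the retraction constant near infinity. *)
Lemma no_unbounded_retraction (F : 'I_n -> 'rV[R]_m -> R) :
  (forall j, mod1_on N1 (F j)) ->
  (forall j x, F j (E x) - x 0 j \is a Num.int) -> False.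
Proof.
move=> Fm FE.
(* Beyond radius [r] only the values of [F] on the sphere are kept: composed with the radial
   projection they are circle-valued on the punctured space, and lift to the real functions [th]. *)
pose rad (x : 'rV[R]_m) := (r / `|x|) *: x.
have nrad x : x != 0 -> `|rad x| = r.
  move=> x0; rewrite normrZ ger0_norm; last by rewrite divr_ge0// ltW.
  by rewrite divfK ?normr_eq0.
have crad x : x != 0 -> {for x, continuous rad}.
  move=> x0; have cv : (fun y : 'rV[R]_m => r / `|y|) @ x --> r / `|x|.
    have c1 : (fun y : 'rV[R]_m => `|y|^-1) @ x --> `|x|^-1.
      have n0 : `|x| != 0 by rewrite normr_eq0.
      exact: (cvgV n0 (@norm_continuous R 'rV[R]_m x)).
    exact: (cvgMl_tmp c1).
  exact: (cvgZ cv cvg_id).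
have /choice[th thP] j : exists th : 'rV[R]_m -> R, forall x, x != 0 ->
    {for x, continuous th} /\ th x - F j (rad x) \is a Num.int.
  apply: (@mod1_punctured_lift R k (F j \o rad)) => x x0.
  have : mod1_at N1 (F j) (rad x) by apply: Fm; apply: far1; rewrite nrad.
  move=> Fx; have : mod1_at [set y : 'rV[R]_m | y != 0] (F j \o rad) x.
    apply: mod1_comp Fx; first exact: crad.
    by move=> y y0; apply: far1; rewrite nrad.
  have nx : nbhs x [set y : 'rV[R]_m | y != 0].
    apply/nbhs_ballP; exists `|x|; first by rewrite /= normr_gt0.
    move=> y; rewrite -ball_normE /= => xy; apply: contraTneq xy => ->.
    by rewrite subr0 ltxx.
  by move=> h e e0; apply: filterS2 (h e e0) nx => y + y0 _; exact.
(* This factor is 1 on the sphere of radius [r] and 0 from twice that radius on. Scaling the lifts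
   by it leads from the retraction to the constant [E 0]; functions known only modulo the integers
   could not be scaled. *)
pose s (x : 'rV[R]_m) := Num.max 0 (2 - r^-1 * `|x|).
have cs : continuous s.
  apply: continuous_maxfun; first exact: cst_continuous.
  move=> x; have c1 := @norm_continuous R 'rV[R]_m x.
  exact: (cvgB (cvg_cst _) (cvgMl_tmp c1)).
have s1 x : `|x| = r -> s x = 1.
  by move=> xr; rewrite /s xr mulVf ?gt_eqF// max_r; lra.
have s0 x : 2 * r <= `|x| -> s x = 0.
  move=> xr; rewrite /s max_l//; have : r^-1 * (2 * r) <= r^-1 * `|x|.
    by rewrite ler_wpM2l// invr_ge0 ltW.
  by rewrite mulrCA mulVf ?gt_eqF// mulr1; lra.
pose K1 : set 'rV[R]_m := N1 `&` [set x | `|x| <= r].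
pose K3 : set 'rV[R]_m := [set x | r <= `|x|].
have cln : closed [set x : 'rV[R]_m | `|x| <= r].
  exact: (preimage_closed (fun z _ => @norm_continuous _ _ z) (@closed_le R r)).
have clK3 : closed K3.
  exact: (preimage_closed (fun z _ => @norm_continuous _ _ z) (@closed_ge R r)).
have K3n x : K3 x -> x != 0.
  by move=> xr; apply/eqP => x0; move: xr; rewrite x0 /K3 /= normr0 leNgt r0.
pose h x := if `[< K3 x >] then E (s x *: \row_j th j x) else
            if `[< N2 x >] then x else E (\row_j F j x).
have h3 x : K3 x -> h x = E (s x *: \row_j th j x) by rewrite /h => /asboolP ->.
have hN x : N1 x \/ K3 x -> N1 (h x) /\ N2 (h x).
  rewrite /h; case: asboolP => [_ _|n3 [x1|//]]; first exact: sub.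
  by case: asboolP => // _; exact: sub.
have h2 x : N2 x -> h x = x.
  move=> x2; rewrite /h; case: asboolP => [x3|_]; last by case: asboolP.
  by have := far x2; rewrite ltNge x3.
have shift (u v : 'I_n -> R) : (forall j, u j - v j \is a Num.int) ->
    E (\row_j u j) = E (\row_j v j).
  move=> uv; have /choice[c cP] j : exists c : int, u j - v j = c%:~R by exact/intrP.
  rewrite -(perE (\row_j v j) (\row_j c j)); congr E; apply/rowP => j; rewrite !mxE -cP.
  by rewrite addrC subrK.
have h1 x : K1 x -> h x = E (\row_j F j x).
  move=> [x1 xr]; rewrite /h; case: asboolP => [x3|_].
    have xE : `|x| = r by apply/eqP; rewrite eq_le xr x3.
    rewrite s1// scale1r; apply: shift => j.
    have [_] := thP j x (K3n _ x3); rewrite /rad xE divff ?gt_eqF// scale1r//.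
  case: asboolP => // x2; have [u _ ux] := meet x1 x2.
  rewrite -ux (shift (fun j => F j (E u)) (fun j => u 0 j)) => [|j]; last exact: FE.
  by congr E; apply/rowP => j; rewrite mxE.
have cov x : (K1 `|` K3) x \/ N2 x.
  case: (cover x) => [x1|]; last by right.
  by left; have [xr|/ltW xr] := leP `|x| r; [left|right].
have cK1 x : K1 x -> h @ within K1 (nbhs x) --> h x.
  move=> xK; apply: (cvg_within_eq xK h1); apply: periodic_cvg => // j.
  by apply: mod1_sub (Fm j x xK.1) => y [].
have cK3 x : K3 x -> h @ within K3 (nbhs x) --> h x.
  move=> xK; apply: (cvg_within_eq xK h3); apply: cvg_within_filter.
  have x0 := K3n _ xK.
  have cth := row_cvg (fun j => (thP j x x0).1).
  have c1 : (fun y => s y *: \row_j th j y) @ x --> s x *: \row_j th j x.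
    exact: (cvgZ (cs x) cth).
  have c2 := continuous_cvg _ (@cE (s x *: \row_j th j x)) c1.
  exact: c2.
have ch : continuous h.
  have clK1 : closed K1 by exact: closedI.
  apply: (cvg_closed_cover (closedU clK1 clK3) clN2 cov) => x xN.
    exact: (cvg_closedU clK1 clK3 cK1 cK3).
  by apply: (cvg_within_eq (g := id) xN h2); apply: cvg_within_filter; exact: cvg_id.
have /nbhs_ballP[e /= e0 eN] : nbhs q (~` N1).
  by apply: open_nbhs_nbhs; split=> //; exact: closed_openC.
have id_q x : ~ N1 x -> h x = x by move=> n1; apply: h2; case: (cover x).
apply: (@no_exterior_contraction R m h q (E 0) e (2 * r)) => //.
- exact: mulr_gt0.
- by move=> x xq; apply: id_q; apply: eN; rewrite -ball_normE /= distrC.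
- move=> x xr; have x3 : K3 x.
    by rewrite /K3 /=; apply: le_trans _ (ltW xr); rewrite mulr_natl mulr2n lerDl ltW.
  by rewrite h3// s0 ?ltW// scale0r.
- move=> x hx; have [x1|x2] := cov x; last by rewrite -hx h2.
  have : N1 (h x) by apply: (hN x _).1; case: x1 => [[]|]; [left|right].
  by rewrite hx.
- by apply/eqP => Eq; apply: N1q; rewrite -Eq; case: (sub 0).
Qed.

End UnboundedRetraction.

(** * Separation *)

Section Separation.
Context {R : realType} {m : nat}.
Implicit Types (T W U P Q : set 'rV[R]_m) (s : 'rV[R]_m -> bool).

(** A small [W] minus [T] falls into two open sides. Their connectedness is expressed through
    locally constant boolean functions, the form in which it is used; the last clause puts [T] into
    the closure of both. *)
Definition two_sided_at T y := forall U, nbhs y U -> exists W P Q,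
  [/\ open W /\ W y, W `<=` U, (open P /\ open Q) /\
        (P `&` Q = set0 /\ forall z, W z -> ~ T z -> P z \/ Q z),
      (forall s, (forall z, W z -> ~ T z -> \forall w \near z, s w = s z) ->
         (forall z z', P z -> P z' -> s z = s z') /\
         (forall z z', Q z -> Q z' -> s z = s z')) &
      forall z V, W z -> T z -> nbhs z V ->
        (exists w, [/\ V w, W w, ~ T w & P w]) /\ (exists w, [/\ V w, W w, ~ T w & Q w])].

Definition side_function T W s :=
  (forall z, W z -> ~ T z -> \forall w \near z, s w = s z) /\
  (forall z V, W z -> T z -> nbhs z V ->
     exists w w', [/\ V w /\ V w', ~ T w, ~ T w' & s w <> s w']).

Variable T : set 'rV[R]_m.
Hypothesis clT : closed T.
Hypothesis two_sided : forall y, T y -> two_sided_at T y.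

Let neg (b : bool) s : 'rV[R]_m -> bool := fun z => b (+) s z.

Lemma side_functionN W s : side_function T W s -> side_function T W (neg true s).
Proof.
move=> [h1 h2]; split=> [z Wz nTz|z V Wz Tz Vz].
  by apply: filterS (h1 z Wz nTz) => w; rewrite /neg => ->.
have [w [w' [? ? ? ww']]] := h2 z V Wz Tz Vz; exists w, w'; split=> //.
by rewrite /neg => /addbI.
Qed.

(** Near a point of [T] a side function is determined by its value on [P], because the jump forces
    the opposite value on [Q]. Hence two of them agree up to negation. *)
Lemma side_function_agree W s W' s' y : open W -> open W' -> W y -> W' y ->
  side_function T W s -> side_function T W' s' ->
  exists b, agree (~` T) s' (neg b s) y.
Proof.
move=> oW oW' Wy W'y [s1 s2] [s'1 s'2].
have [Ty|nTy] := pselect (T y); last first.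
  exists (s' y (+) s y).
  apply: filterS2 (s1 y Wy nTy) (s'1 y W'y nTy) => z e1 e2 _.
  by rewrite /neg e1 e2 addbK.
have nWW : nbhs y (W `&` W') by apply: open_nbhs_nbhs; split=> //; exact: openI.
have [V [P [Q [[oV Vy] VWW [_ [PQ cover]] conn _]]]] := two_sided Ty nWW.
have const (s0 : 'rV[R]_m -> bool) (W0 : set 'rV[R]_m) : V `<=` W0 -> side_function T W0 s0 ->
    exists b, (forall z, P z -> V z -> ~ T z -> s0 z = b) /\
              (forall z, Q z -> V z -> ~ T z -> s0 z = ~~ b).
  move=> VW0 [h1 h2].
  have [cP cQ] := conn s0 (fun z Vz => h1 z (VW0 _ Vz)).
  have [w [w' [[Vw Vw'] nTw nTw' ww']]] := h2 y V (VW0 _ Vy) Ty (open_nbhs_nbhs (conj oV Vy)).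
  case: (cover w Vw nTw) (cover w' Vw' nTw') => [Pw|Qw] [Pw'|Qw'].
  - by case: ww'; exact: cP.
  - exists (s0 w); split=> z zP _ _; first exact: cP.
    by rewrite (cQ z w')//; case: (s0 w) (s0 w') ww' => -[].
  - exists (s0 w'); split=> z zP _ _; first exact: cP.
    by rewrite (cQ z w)//; case: (s0 w) (s0 w') ww' => -[].
  - by case: ww'; exact: cQ.
have [b [bP bQ]] := const s W (fun z Vz => (VWW z Vz).1) (conj s1 s2).
have [b' [b'P b'Q]] := const s' W' (fun z Vz => (VWW z Vz).2) (conj s'1 s'2).
exists (b (+) b'); apply: filterS (open_nbhs_nbhs (conj oV Vy)) => z Vz nTz.
rewrite /neg; case: (cover z Vz nTz) => zP; first by rewrite b'P// bP// addbAC addbb.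
by rewrite b'Q// bQ//; case: b {bP bQ}; case: b' {b'P b'Q}.
Qed.

Lemma side_function_local y : exists W s, [/\ open W, W y & side_function T W s].
Proof.
have [Ty|nTy] := pselect (T y); last first.
  exists (~` T), xpredT; split=> //; first exact: closed_openC.
  split=> [z _ _|z V nTz Tz _]; first by apply: filterE.
  by case: nTz.
have [W [P [Q [[oW Wy] _ [[oP oQ] [PQ cover]] conn near]]]] := two_sided Ty (@filterT _ (nbhs y) _).
have PnQ z : P z -> Q z -> False by move=> Pz Qz; have := conj Pz Qz : (P `&` Q) z; rewrite PQ.
exists W, (fun z => `[< P z >]); split=> //; split=> [z Wz nTz|z V Wz Tz Vz].
  case: (cover z Wz nTz) => zP.
    apply: filterS (open_nbhs_nbhs (conj oP zP)) => w wP.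
    by rewrite !asboolT.
  apply: filterS (open_nbhs_nbhs (conj oQ zP)) => w wQ.
  by rewrite !asboolF// => h; [exact: (PnQ z)|exact: (PnQ w)].
have [[w [Vw Ww nTw Pw]] [w' [Vw' Ww' nTw' Qw']]] := near z V Wz Tz Vz.
exists w, w'; split=> //; rewrite asboolT// asboolF// => Pw'.
exact: (PnQ w').
Qed.

(** A local side function and its negation are the two sheets of a double covering of the whole
    space, which has a section by [monodromy]. *)
Theorem separation : exists s, side_function T setT s.
Proof.
pose Fam W s := open W /\ side_function T W s.
(* [T] has empty interior, so that germs compared off [T] still tell a side function from its
   negation. *)
have nowhere s W y U : open W -> W y -> side_function T W s -> nbhs y U ->
    exists z, U z /\ ~ T z.
  move=> oW Wy [_ h] Uy; have [Ty|nTy] := pselect (T y).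
    by have [w [w' [[Uw _] nTw _ _]]] := h y U Wy Ty Uy; exists w.
  by exists y; split=> //; exact: nbhs_singleton.
have lc : @locally_constant_family R _ bool (~` T) Fam setT.
  move=> x _; have [W [s [oW Wx sW]]] := side_function_local x.
  exists W, [set t | exists b, t = neg b s]; split=> //.
  - move=> _ [[] ->]; split=> //; exact: side_functionN.
  - move=> y W' s' Wy [oW' sW'] W'y.
    have [b bP] := side_function_agree oW oW' Wy W'y sW sW'.
    by exists (neg b s); [exists b|exact: agree_sym].
  - move=> _ _ y z [b ->] [b' ->] Wy bb' Wz _.
    have [w [bw nTw]] := nowhere s W y _ oW Wy sW bb'.
    have e : neg b s w = neg b' s w := bw nTw.
    by rewrite /neg (addIb e).
have [W [s [oW Wx sW]]] := side_function_local 0.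
have F0 : Fam W s by [].
have [F _ FP] := @monodromy R _ bool (~` T) Fam setT 0 W s openT (fun _ _ _ _ => I) I lc F0 Wx.
exists F; split=> [z _ nTz|z V _ Tz Vz].
  have [W' [s' [[oW' [s'1 _]] W'z Fs']]] := FP z I.
  have s'z := s'1 z W'z nTz.
  have nT : nbhs z (~` T) by apply: open_nbhs_nbhs; split=> //; exact: closed_openC.
  have Fz := agree_at Fs' nTz.
  apply: filterS3 s'z (agree_near Fs') nT => w e1 e2 nTw.
  by rewrite Fz -e1; exact: agree_at e2 nTw.
have [W' [s' [[oW' [_ s'2]] W'z Fs']]] := FP z I.
have [w [w' [[[Vw Fw] [Vw' Fw']] nTw nTw' ww']]] := s'2 z _ W'z Tz (filterI Vz Fs').
by exists w, w'; split=> //; rewrite Fw// Fw'.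
Qed.

End Separation.

(** * Flatness of smooth hypersurfaces *)

Lemma norm_seg_lt (R : realType) (V : normedModType R) (x y : V) (t d : R) :
  0 <= t <= 1 -> `|x| < d -> `|y| < d -> `|x + t *: (y - x)| < d.
Proof.
move=> /andP[t0 t1] xd yd.
have -> : x + t *: (y - x) = (1 - t) *: x + t *: y by lmodule R [:: x; y].
apply: le_lt_trans (ler_normD _ _) _; rewrite !normrZ !ger0_norm ?subr_ge0//.
move: xd yd; set a := `|_|; set b := `|_| => xd yd.
have [->|tn] := eqVneq t 0; first by rewrite subr0 mul1r mul0r addr0.
have tp : 0 < t by rewrite lt_neqAle eq_sym tn.
nra.
Qed.

Section FlatCharts.
Context {R : realType} {k : nat}.
Let m := k.+1.
Implicit Types (T W U P Q : set 'rV[R]_m) (s : 'rV[R]_m -> bool).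

Definition local_homeo (X Y : topologicalType) (phi : X -> Y) (psi : Y -> X)
    (B : set X) (W : set Y) :=
  [/\ open B, open W,
      forall u, B u -> [/\ W (phi u), psi (phi u) = u & {for u, continuous phi}] &
      forall z, W z -> [/\ B (psi z), phi (psi z) = z & {for z, continuous psi}]].

Definition flat_at T y := exists (phi psi : 'rV[R]_m -> 'rV[R]_m) (d : R) W,
  [/\ 0 < d, W y /\ psi y = 0, local_homeo phi psi [set u | `|u| < d] W &
      forall z, W z -> (T z <-> psi z 0 0 = 0)].

(** In the chart the sides are the half balls given by the sign of the first coordinate; they are
    convex, hence connected. *)
Lemma flat_two_sided T y : flat_at T y -> two_sided_at T y.
Proof.
move=> [phi [psi [d [W [d0 [Wy y0] [_ oW phiP psiP] TP]]]]] U Uy.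
have coord (i : 'I_m) : continuous (fun u : 'rV[R]_m => u 0 i) by exact: coord_continuous.
have opre (O : set 'rV[R]_m) : open O -> open [set z | W z /\ O (psi z)].
  move=> oO; rewrite openE => z [Wz Oz]; have [_ _ cpsi] := psiP z Wz.
  have h1 := open_nbhs_nbhs (conj oW Wz).
  have h2 : nbhs z (psi @^-1` O) by apply: cpsi; exact: open_nbhs_nbhs.
  exact: filterS2 h1 h2 => w.
have oball e : open [set u : 'rV[R]_m | `|u| < e].
  rewrite (_ : [set u | _] = ball (0 : 'rV[R]_m) e); first exact: ball_open.
  by apply/seteqP; split=> u; rewrite -ball_normE /= sub0r normrN.
have [d' [d'0 d'd] d'U] : exists2 d', 0 < d' /\ d' <= d & forall u, `|u| < d' -> U (phi u).
  have zd : `|0 : 'rV[R]_m| < d by rewrite normr0.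
  have [_ _ cphi] := phiP 0 zd.
  have phi0 : phi 0 = y by rewrite -y0; case: (psiP y Wy).
  have /nbhs_ballP[e /= e0 eP] : nbhs (0 : 'rV[R]_m) (phi @^-1` U) by apply: cphi; rewrite phi0.
  exists (Num.min e d); first by rewrite lt_min e0 d0 ge_min lexx orbT.
  by move=> u; rewrite lt_min => /andP[ue _]; apply: eP; rewrite -ball_normE /= sub0r normrN.
have ltd (u : 'rV[R]_m) : `|u| < d' -> `|u| < d by move=> h; exact: lt_le_trans h d'd.
pose W' := [set z | W z /\ `|psi z| < d'].
pose A (e : R) : set 'rV[R]_m := [set u : 'rV[R]_m | `|u| < d' /\ 0 < e * u 0 0].
pose S (e : R) : set 'rV[R]_m := [set z | W z /\ A e (psi z)].
have oA e : open (A e).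
  apply: openI; first exact: oball.
  have ce : continuous (fun u : 'rV[R]_m => e * u 0 0).
    by move=> z; exact: (cvgMl_tmp (coord 0 z)).
  by move/continuousP: ce => /(_ _ (@open_gt R 0)).
have SW e z : S e z -> W' z by move=> [Wz [zd _]].
have conn e s : (forall z, W' z -> ~ T z -> \forall w \near z, s w = s z) ->
    forall z z', S e z -> S e z' -> s z = s z'.
  move=> lc z z' [Wz Az] [Wz' Az'].
  have [_ zE _] := psiP z Wz; have [_ zE' _] := psiP z' Wz'.
  rewrite -zE -zE'.
  apply: (@locally_constant_seg R 'rV[R]_m _ (A e) (s \o phi)) => [u [ud u0]|t t01].
    have [Wu uE cphi] := phiP u (ltd u ud).
    have : \forall w \near phi u, s w = s (phi u).
      apply: lc; first by split=> //; rewrite uE.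
      by move=> /(TP _ Wu); rewrite uE => u00; move: u0; rewrite u00 mulr0 ltxx.
    exact: cphi.
  case: Az Az' => [z1 z2] [z'1 z'2]; split; first exact: norm_seg_lt.
  rewrite !mxE; case/andP: t01 => t0 t1.
  have -> : e * (psi z 0 0 + t * (psi z' 0 0 - psi z 0 0)) =
    (1 - t) * (e * psi z 0 0) + t * (e * psi z' 0 0) by ring.
  move: z2 z'2; set a := e * _; set b := e * _ => a0 b0.
  have [->|tn] := eqVneq t 0; first by lra.
  have tp : 0 < t by rewrite lt_neqAle eq_sym tn.
  have := mulr_gt0 tp b0; have : 0 <= (1 - t) * a by rewrite mulr_ge0 ?subr_ge0// ltW.
  lra.
have near e z V : e * e = 1 -> W' z -> T z -> nbhs z V ->
    exists w, [/\ V w, W' w, ~ T w & S e w].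
  move=> ee [Wz zd] Tz Vz; have [_ zE _] := psiP z Wz.
  have z0 : psi z 0 0 = 0 by apply/(TP _ Wz).
  have [_ _ cphi] := phiP (psi z) (ltd _ zd).
  have : nbhs (psi z) (phi @^-1` V `&` [set u | `|u| < d']).
    apply: filterI; first by apply: cphi; rewrite zE.
    by apply: open_nbhs_nbhs; split=> //; exact: oball.
  move=> /nbhs_ballP[r /= r0 rP].
  pose v := psi z + (e * (r / 2)) *: delta_mx 0 0.
  have e1 : `|e| = 1.
    by apply/eqP; rewrite -(@eqrXn2 _ 2) ?normr_ge0// expr1n -normrX expr2 ee normr1.
  have vr : ball (psi z) r v.
    rewrite -ball_normE /= /v opprD addrA subrr sub0r normrN normrZ normrM e1 mul1r.
    rewrite ger0_norm ?divr_ge0 ?ltW//.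
    have d1 : `|delta_mx 0 0 : 'rV[R]_m| <= 1.
      by apply: rV_norm_le => // i; rewrite !mxE; case: andP => _; rewrite ?normr1 ?normr0.
    have r2 : 0 < r / 2 by rewrite divr_gt0.
    by have := ler_pM (ltW r2) (normr_ge0 _) (lexx (r / 2)) d1; lra.
  have [Vv vd] := rP _ vr.
  have [Wv vE _] := phiP v (ltd _ vd).
  have v0 : e * v 0 0 = r / 2.
    by rewrite !mxE !eqxx z0 add0r mulr1 mulrA ee mul1r.
  exists (phi v); split=> //; first by split=> //; rewrite vE.
    by move=> /(TP _ Wv); rewrite vE => vz; move: v0; rewrite vz mulr0; lra.
  by split=> //; rewrite vE; split=> //; rewrite v0 divr_gt0.
exists W', (S 1), (S (-1)); split.
- split; first exact: (opre _ (oball d')).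
  by split=> //; rewrite y0 normr0.
- by move=> z [Wz zd]; have [_ <- _] := psiP z Wz; exact: d'U.
- split; first by split; exact: (opre _ (oA _)).
  split.
    apply/seteqP; split=> // z [[_ [_ z1]] [_ [_ z2]]].
    by move: z1 z2; rewrite mul1r mulN1r; lra.
  move=> z [Wz zd] nTz; case: (ltrgtP 0 (psi z 0 0)) => z0.
  + by left; split=> //; split=> //; rewrite mul1r.
  + by right; split=> //; split=> //; rewrite mulN1r oppr_gt0.
  + by case: nTz; apply/(TP _ Wz).
- by move=> s lc; split; exact: conn.
- move=> z V Wz Tz Vz; split; first exact: near (mulr1 1) _ _ Vz.
  exact: near (eq_trans (mulrNN 1 1) (mulr1 1)) _ _ Vz.
Qed.

End FlatCharts.

(** * Local inverses and the straightening of an immersed hypersurface *)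

Section LocalInverse.
Context {R : realType} {m : nat}.
Variables (Psi : 'rV[R]_m -> 'rV[R]_m) (d : R).
Hypothesis lip : forall u v : 'rV[R]_m, `|u| < d -> `|v| < d ->
  `|Psi u - Psi v - (u - v)| <= 2^-1 * `|u - v|.

Lemma expansion u v : `|u| < d -> `|v| < d -> `|u - v| <= 2 * `|Psi u - Psi v|.
Proof.
move=> ud vd; have := ler_normB (Psi u - Psi v) (Psi u - Psi v - (u - v)).
rewrite subKr => h; have := lip ud vd; lra.
Qed.

Lemma perturbation_continuous u : `|u| < d -> {for u, continuous Psi}.
Proof.
move=> ud; apply: norm_lt_continuous => e e0.
exists (Num.min (e / 2) (d - `|u|)); first by rewrite lt_min subr_gt0 ud divr_gt0.
move=> v; rewrite distrC lt_min => /andP[uve uvd]; rewrite distrC.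
have vd : `|v| < d.
  by have := ler_normB u (u - v); rewrite subKr; lra.
have := ler_normD (Psi u - Psi v - (u - v)) (u - v); rewrite subrK => h.
have := lip ud vd; lra.
Qed.

(** Instead of iterating a contraction, the distance from [Psi u] to [y] is minimised over a closed
    ball. Moving a minimiser by its error [y - Psi u] would at least halve the distance, so the
    error is 0. *)
Lemma perturbation_open u0 : `|u0| < d -> exists2 e, 0 < e &
  forall y, `|y - Psi u0| < e -> exists2 u, `|u| < d & Psi u = y.
Proof.
move=> u0d; pose r := (d - `|u0|) / 2.
have r0 : 0 < r by rewrite divr_gt0// subr_gt0.
have inC (u : 'rV[R]_m) : `|u - u0| <= r -> `|u| < d.
  by move=> ur; have := ler_normD (u - u0) u0; rewrite subrK; move: ur; rewrite /r; lra.
(* By [expansion] the minimiser then stays within [r / 2] of [u0], and adding an error below [r / 8]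
   does not leave the ball. *)
exists (r / 8); first by rewrite divr_gt0.
move=> y yu0; pose C := [set u : 'rV[R]_m | `|u - u0| <= r].
have cC : compact C.
  apply: bounded_closed_compact.
    exists d; split; first exact: num_real.
    by move=> M dM u /inC ud; exact: ltW (lt_trans ud dM).
  have cn : continuous (fun u : 'rV[R]_m => `|u - u0|).
    move=> z; have cz : (fun u => u - u0) @ z --> z - u0 by exact: cvgB cvg_id (cvg_cst _).
    exact: cvg_norm cz.
  exact: (preimage_closed (fun z _ => cn z) (@closed_le R r)).
have C0 : C u0 by rewrite /C /= subrr normr0 ltW.
have cg : {within C, continuous (fun u => `|Psi u - y|)}.
  apply/subspace_continuousP => u /inC ud; apply: cvg_within_filter.
  have c1 : (fun v => Psi v - y) @ u --> Psi u - y.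
    exact: cvgB (perturbation_continuous ud) (cvg_cst _).
  exact: cvg_norm c1.
have [u /set_mem uC umin] := @EVT_min_rV R m _ C (ex_intro _ u0 C0) cC cg.
have := umin u0 (mem_set C0); rewrite distrC in yu0 => /le_lt_trans/(_ yu0) uy.
have ud := inC _ uC.
have uu0 : `|u - u0| <= r / 2.
  have h1 := expansion ud u0d.
  have := ler_distD y (Psi u) (Psi u0); move: yu0 uy h1; rewrite (distrC y); lra.
have wC : C (u + (y - Psi u)).
  rewrite /C /= addrAC; have := ler_normD (u - u0) (y - Psi u).
  by move: uy; rewrite (distrC (Psi u)); lra.
have := umin _ (mem_set wC); have := lip (inC _ wC) ud.
have -> : u + (y - Psi u) - u = y - Psi u by rewrite addrC addKr.
have -> : Psi (u + (y - Psi u)) - Psi u - (y - Psi u) = Psi (u + (y - Psi u)) - y.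
  by lmodule R [:: Psi (u + (y - Psi u)); Psi u; y].
rewrite (distrC y) => h1 h2; exists u => //; apply/eqP; rewrite -subr_eq0 -normr_le0; lra.
Qed.

Lemma local_inverse : exists psi, local_homeo Psi psi [set u | `|u| < d]
  [set y | exists2 u, `|u| < d & Psi u = y].
Proof.
have /choice[psi psiP] y : exists u, (exists2 u, `|u| < d & Psi u = y) -> `|u| < d /\ Psi u = y.
  by have [[u ud uy]|n] := pselect (exists2 u, `|u| < d & Psi u = y); [exists u|exists 0].
have psiK u : `|u| < d -> psi (Psi u) = u.
  move=> ud; have [|vd vE] := psiP (Psi u); first by exists u.
  by apply/eqP; rewrite -subr_eq0 -normr_le0; have := expansion vd ud; rewrite vE subrr normr0 mulr0.
exists psi; split.
- rewrite (_ : [set u | _] = ball (0 : 'rV[R]_m) d); first exact: ball_open.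
  by apply/seteqP; split=> u; rewrite -ball_normE /= sub0r normrN.
- rewrite openE => _ [u ud <-]; have [e e0 eP] := perturbation_open ud.
  by apply/nbhs_ballP; exists e => // y; rewrite -ball_normE /= distrC => /eP.
- move=> u ud; split; [by exists u|exact: psiK|exact: perturbation_continuous].
- move=> z zW; have [ud uE] := psiP z zW; split=> //.
  apply: norm_lt_continuous => e e0; have [e' e'0 eP] := perturbation_open ud.
  exists (Num.min e' (e / 2)); first by rewrite lt_min e'0 divr_gt0.
  move=> y; rewrite lt_min => /andP[ye' ye].
  have yW : exists2 u, `|u| < d & Psi u = y by apply: eP; rewrite uE.
  have [vd vE] := psiP y yW.
  by apply: le_lt_trans (expansion vd ud) _; rewrite uE vE; lra.
Qed.

End LocalInverse.

Section StrictDerivative.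
Context {R : realType} {n m : nat}.
Variables (f : 'rV[R]_n -> 'rV[R]_m) (D : set 'rV[R]_n) (x0 : 'rV[R]_n).
Hypothesis oD : open D.
Hypothesis Dx0 : D x0.
Hypothesis f1 : Ck_on 1 D f.

Let df x : D x -> differentiable f x. Proof. by case: f1 => + _; exact. Qed.

Lemma line_derivative (p w : 'rV[R]_n) (t : R) i : D (p + t *: w) ->
  is_derive t (1 : R) (fun s : R => f (p + s *: w) 0 i) ((w *m jacobian f (p + t *: w)) 0 i).
Proof.
move=> Dp; have dp := df Dp.
pose F (s : R) := f (p + s *: w).
have E : (fun h : R => h^-1 *: ((F \o shift t) (h *: (1 : R)) - F t)) =
    (fun h => h^-1 *: ((f \o shift (p + t *: w)) (h *: w) - f (p + t *: w))).
  apply/funext => h; rewrite /F /=; congr (_ *: (f _ - _)).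
  by rewrite scalerDl [h *: 1]mulr1; lmodule R [:: p; w].
have dF : derivable F t 1.
  have h : derivable f (p + t *: w) w by exact: diff_derivable.
  by rewrite /derivable E; exact: h.
have dFE : 'D_1 F t = w *m jacobian f (p + t *: w).
  by rewrite -deriveEjacobian// /derive E.
apply: DeriveDef; first by have /derivable_mxP := dF; exact.
by rewrite -dFE derive_mx// mxE.
Qed.

Lemma jacobian_near e : 0 < e -> exists2 d, 0 < d & forall x, `|x - x0| < d ->
  D x /\ forall (w : 'rV[R]_n) i, `|(w *m (jacobian f x - jacobian f x0)) 0 i| <= e * `|w|.
Proof.
move=> e0; have n0 : 0 < n.+1%:R :> R by rewrite ltr0n.
have hD : nbhs x0 D by exact: open_nbhs_nbhs.
(* The errors of [n] rows are added up; dividing by [n.+1] also makes sense in dimension 0. *)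
pose close (j : 'I_n) x := `|'D_(delta_mx 0 j) f x - 'D_(delta_mx 0 j) f x0| < e / n.+1%:R.
have hJ : \forall x \near x0, forall j, close j x.
  refine (@filter_forall _ _ (fun j => [set x | close j x]) _ (nbhs_filter x0) _) => j.
  case: f1 => _ /(_ (delta_mx 0 j) x0 Dx0) cD.
  have en : 0 < e / n.+1%:R by rewrite divr_gt0.
  have [d d0 dP] := continuous_norm_lt cD en.
  by apply/nbhs_ballP; exists d => // y; rewrite -ball_normE /= distrC => /dP.
pose J : set 'rV[R]_n := [set x | forall j, close j x].
have hDJ : nbhs x0 (D `&` J) by exact: filterI hD hJ.
move: hDJ => /nbhs_ballP[d /= d0 dP]; exists d => // x xd.
have [Dx Dj] : (D `&` J) x.
  by apply: dP; rewrite -ball_normE /= distrC.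
rewrite /J /= /close in Dj.
split=> // w i; rewrite mxE.
apply: le_trans (ler_norm_sum _ _ _) _.
apply: (@le_trans _ _ (\sum_(j < n) `|w| * (e / n.+1%:R))).
  apply: ler_sum => j _; rewrite normrM; apply: ler_pM => //; first exact: rV_coord_le.
  have := Dj j; rewrite !deriveEjacobian; [|exact: df|exact: df].
  rewrite -mulmxBr -rowE => /ltW; apply: le_trans.
  by have := rV_coord_le (row j (jacobian f x - jacobian f x0)) i; rewrite mxE.
rewrite sumr_const card_ord -mulrnAr -mulr_natr mulrC ler_wpM2r//.
rewrite -mulrA ler_piMr ?(ltW e0)// mulrC ler_pdivrMr// mul1r ler_nat//.
Qed.

(** The mean value theorem, applied to each coordinate along the segment, turns continuity of the
    Jacobian into an estimate uniform over pairs of points, as [local_inverse] demands. *)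
Lemma strict_derivative e : 0 < e -> exists2 d, 0 < d & forall v v' : 'rV[R]_n,
  `|v| < d -> `|v'| < d ->
  `|f (x0 + v) - f (x0 + v') - (v - v') *m jacobian f x0| <= e * `|v - v'|.
Proof.
move=> e0; have [d d0 dP] := jacobian_near e0; exists d => // v v' vd v'd.
apply: rV_norm_le => [|i]; first by rewrite mulr_ge0// ltW.
pose w : 'rV[R]_n := v - v'; pose p : 'rV[R]_n := x0 + v'.
pose g (t : R) := f (p + t *: w) 0 i - t * (w *m jacobian f x0) 0 i.
pose dg (t : R) := (w *m jacobian f (p + t *: w)) 0 i - (w *m jacobian f x0) 0 i.
have near_p (t : R) : 0 <= t <= 1 -> `|p + t *: w - x0| < d.
  move=> t01; have -> : p + t *: w - x0 = v' + t *: (v - v').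
    by rewrite /p /w; lmodule R [:: x0; v; v'].
  exact: norm_seg_lt.
have dgP (t : R) : 0 <= t <= 1 -> is_derive t (1 : R) g (dg t).
  move=> t01; have [Dp _] := dP _ (near_p t t01).
  have h1 := line_derivative i Dp.
  have h2 : is_derive t (1 : R) (fun s : R => s * (w *m jacobian f x0) 0 i) ((w *m jacobian f x0) 0 i).
    by apply: is_derive_eq; rewrite /= scaler0 add0r [_ *: _]mulr1.
  pose F1 (s : R) := f (p + s *: w) 0 i; pose F2 (s : R) := s * (w *m jacobian f x0) 0 i.
  have gE : g = F1 - F2 by apply/funext.
  have [d1 v1] := h1; have [d2 v2] := h2.
  have dB : derivable (F1 - F2) t 1 by exact: derivableB d1 d2.
  have vB : 'D_1 (F1 - F2) t = dg t by rewrite (deriveB d1 d2) v1 v2.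
  by rewrite gE; exact: DeriveDef dB vB.
have [||c] := @MVT_segment R g dg 0 1 ler01.
- by move=> t /[!in_itv]/= /andP[t0 t1]; apply: dgP; rewrite !ltW.
- apply/subspace_continuousP => t /=; rewrite in_itv /= => t01; apply: cvg_within_filter.
  apply: differentiable_continuous; apply/derivable1_diffP.
  by have [] := dgP t t01.
move=> /[!in_itv]/= c01; rewrite subr0 mulr1 => gE.
have [_ /(_ w i)] := dP _ (near_p c c01).
have sub (A B : 'rV[R]_m) : (A - B) 0 i = A 0 i - B 0 i by rewrite !mxE.
have -> : (f (x0 + v) - f (x0 + v') - (v - v') *m jacobian f x0) 0 i = dg c.
  rewrite -gE /g scale1r mul1r scale0r mul0r addr0 subr0 !sub.
  have -> : p + w = x0 + v by rewrite /p /w; lmodule R [:: x0; v; v'].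
  rewrite -/w -/p; set a := f _ 0 i; set b := f p 0 i; set z := (w *m _) 0 i.
  by ring.
by rewrite mulmxBr sub; exact.
Qed.

End StrictDerivative.

Lemma open_preimage_on (X Y : topologicalType) (W : set X) (psi : X -> Y) (O : set Y) : open W ->
  (forall z, W z -> {for z, continuous psi}) -> open O -> open (W `&` psi @^-1` O).
Proof.
move=> oW cpsi oO; rewrite openE => z [Wz Oz].
have h1 := open_nbhs_nbhs (conj oW Wz).
have h2 : nbhs z (psi @^-1` O) by apply: (cpsi z Wz); exact: open_nbhs_nbhs.
exact: filterI h1 h2.
Qed.

Lemma local_homeo_restrict (X Y : topologicalType) (phi : X -> Y) psi B W B' : local_homeo phi psi B W ->
  open B' -> B' `<=` B -> local_homeo phi psi B' (W `&` psi @^-1` B').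
Proof.
move=> [oB oW phiP psiP] oB' BB; split=> //.
- by apply: open_preimage_on => // z /psiP[].
- move=> u B'u; have [Wu uE cu] := phiP u (BB u B'u).
  by split=> //; split=> //; rewrite /preimage /= uE.
- by move=> z [Wz B'z]; have [_ zE cz] := psiP z Wz.
Qed.

Lemma local_homeo_comp (X Y Z : topologicalType) (phi : X -> Y) psi B W (phi' : Y -> Z) psi' B' W' :
  local_homeo phi psi B W -> local_homeo phi' psi' B' W' ->
  local_homeo (phi' \o phi) (psi \o psi') (B `&` phi @^-1` B') (W' `&` psi' @^-1` W).
Proof.
move=> [oB oW phiP psiP] [oB' oW' phi'P psi'P]; split.
- by apply: open_preimage_on => // u /phiP[].
- by apply: open_preimage_on => // z /psi'P[].
- move=> u [Bu B'u]; have [Wu uE cu] := phiP u Bu; have [W'u uE' cu'] := phi'P _ B'u.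
  split=> //=; first by split=> //; rewrite /preimage /= uE'.
    by rewrite uE'.
  exact: continuous_comp.
- move=> z [W'z Wz]; have [B'z zE' cz'] := psi'P z W'z; have [Bz zE cz] := psiP _ Wz.
  split=> //=; first by split=> //; rewrite /preimage /= zE.
    by rewrite zE.
  exact: continuous_comp.
Qed.

Section ImmersionChart.
Context {R : realType} {n : nat}.
Variables (f : 'rV[R]_n -> 'rV[R]_n.+1) (D : set 'rV[R]_n) (x0 : 'rV[R]_n).
Hypothesis oD : open D.
Hypothesis Dx0 : D x0.
Hypothesis f1 : Ck_on 1 D f.
Hypothesis inj_df : injective ('d f x0).

Lemma mulmx_bound (a b : nat) (A : 'M[R]_(a, b)) :
  exists2 c, 0 < c & forall x : 'rV[R]_a, `|x *m A| <= c * `|x|.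
Proof.
exists (1 + \sum_i \sum_j `|A i j|).
  by rewrite ltr_wpDr// sumr_ge0// => i _; rewrite sumr_ge0.
move=> x; apply: rV_norm_le => [|j].
  by rewrite mulr_ge0// addr_ge0// sumr_ge0// => i _; rewrite sumr_ge0.
rewrite mxE; apply: le_trans (ler_norm_sum _ _ _) _.
rewrite mulrDl mul1r ler_wpDl// mulr_suml; apply: ler_sum => i _.
rewrite normrM mulrC; apply: ler_pM => //; last exact: rV_coord_le.
by rewrite (bigD1 j)//= lerDl sumr_ge0.
Qed.

(** The rows of the Jacobian are independent but one too few to span, so some standard basis vector
    completes them to a basis. *)
Lemma normal_vector : exists w : 'rV[R]_n.+1, (col_mx w (jacobian f x0) : 'M[R]_n.+1) \in unitmx.
Proof.
set J := jacobian f x0.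
have Jinj (v : 'rV[R]_n) : v *m J = 0 -> v = 0.
  rewrite /J /jacobian mul_rV_lin1 => h; apply: inj_df.
  by rewrite h raddf0.
have freeJ : row_free J by apply: inj_row_free.
have : ~~ (1%:M <= J)%MS.
  apply/negP => /mxrankS; rewrite mxrank1.
  by have := rank_leq_row J; lia.
move=> /row_subPn[i wJ]; exists (row i 1%:M); rewrite -row_free_unit.
apply: (@inj_row_free _ _ _ (col_mx (row i 1%:M) J : 'M[R]_(1 + n, n.+1))) => v.
rewrite -[v]hsubmxK mul_row_col => h.
have l0 : lsubmx v = 0 :> 'rV_1.
  apply/rowP => j; rewrite [RHS]mxE (ord1 j); apply/eqP/negPn/negP => a0.
  move/negP: wJ; apply; move: h; rewrite [lsubmx v]mx11_scalar mul_scalar_mx.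
  set a := lsubmx v 0 0 in a0 *; move=> /eqP; rewrite addr_eq0 => /eqP h.
  rewrite -(scalerK a0 (row i 1%:M)) h scalerN -scaleNr scalemxAl.
  exact: submxMl.
move: h; rewrite l0 mul0mx add0r => /Jinj ->.
by rewrite row_mx0.
Qed.

(** The immersion is thickened in the direction [w]. Multiplied by the inverse of its derivative [K]
    at the origin, it becomes a map whose increments are close to those of the identity. *)
Theorem immersion_chart (r : R) : 0 < r ->
  exists (phi psi : 'rV[R]_n.+1 -> 'rV[R]_n.+1) (d : R) W,
  [/\ 0 < d <= r, local_homeo phi psi [set u | `|u| < d] W &
    forall u : 'rV[R]_(1 + n), u 0 0 = 0 -> phi u = f (x0 + rsubmx u)].
Proof.
move=> r0; have [w] := normal_vector; set J := jacobian f x0; set K : 'M[R]_n.+1 := col_mx w J => uK.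
have [c c0 cP] := mulmx_bound (invmx K).
(* Multiplication by [invmx K] costs a factor [c]; this choice leaves the constant 1/2 of
   [local_inverse]. *)
have e0 : 0 < (2 * c)^-1 by rewrite invr_gt0 mulr_gt0.
have [d d0 dP] := strict_derivative oD Dx0 f1 e0.
pose phi (u : 'rV[R]_(1 + n)) : 'rV[R]_n.+1 := f (x0 + rsubmx u) + lsubmx u *m w.
pose Psi (u : 'rV[R]_n.+1) : 'rV[R]_n.+1 := phi u *m invmx K.
have rsub (u : 'rV[R]_(1 + n)) : `|rsubmx u| <= `|u|.
  by apply: rV_norm_le => // i; rewrite mxE rV_coord_le.
pose d' := Num.min d r.
have d'0 : 0 < d' by rewrite lt_min d0.
have lip (u v : 'rV[R]_n.+1) : `|u| < d' -> `|v| < d' ->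
    `|Psi u - Psi v - (u - v)| <= 2^-1 * `|u - v|.
  rewrite !lt_min => /andP[ud _] /andP[vd _].
  have -> : Psi u - Psi v - (u - v) = (f (x0 + rsubmx (u : 'rV_(1 + n))) -
      f (x0 + rsubmx (v : 'rV_(1 + n))) -
      (rsubmx (u : 'rV_(1 + n)) - rsubmx (v : 'rV_(1 + n))) *m J) *m invmx K.
    rewrite /Psi -mulmxBl -[X in _ - X](mulmxK uK) -mulmxBl; congr (_ *m _).
    rewrite /phi [(u - v) *m K](_ : _ = (lsubmx (u : 'rV_(1 + n)) - lsubmx (v : 'rV_(1 + n))) *m w +
       (rsubmx (u : 'rV_(1 + n)) - rsubmx (v : 'rV_(1 + n))) *m J); last first.
      by rewrite -linearB -[X in _ + X *m _]linearB -mul_row_col hsubmxK.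
    rewrite mulmxBl.
    set a := f _; set b := f _; set p := lsubmx _ *m w; set q := lsubmx _ *m w.
    set z := _ *m J.
    by lmodule R [:: a; b; p; q; z].
  apply: le_trans (cP _) _.
  have := dP (rsubmx (u : 'rV_(1 + n))) (rsubmx (v : 'rV_(1 + n)))
     (le_lt_trans (rsub u) ud) (le_lt_trans (rsub v) vd).
  rewrite -linearB => h.
  have h2 : (2 * c)^-1 * `|rsubmx (u - v : 'rV_(1 + n))| <= (2 * c)^-1 * `|u - v|.
    by apply: ler_wpM2l; [exact: ltW|exact: rsub].
  apply: le_trans (ler_wpM2l (ltW c0) (le_trans h h2)) _.
  by rewrite mulrA invfM mulrCA mulfV ?gt_eqF// mulr1.
have [psi psiP] := local_inverse lip.
have lin (A : 'M[R]_n.+1) : continuous (fun u : 'rV[R]_n.+1 => u *m A).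
  move=> u; have [c' c'0 c'P] := mulmx_bound A.
  apply: norm_lt_continuous => e e0'; exists (e / c'); first by rewrite divr_gt0.
  move=> y; rewrite ltr_pdivlMr// mulrC => yu; rewrite -mulmxBl.
  exact: le_lt_trans (c'P _) yu.
have homK : local_homeo (fun u : 'rV[R]_n.+1 => u *m K) (fun u => u *m invmx K) setT setT.
  split.
  - exact: openT.
  - exact: openT.
  - by move=> u _; split; [exact: I|rewrite mulmxK|exact: lin].
  - by move=> u _; split; [exact: I|rewrite mulmxKV|exact: lin].
have := local_homeo_comp psiP homK; set W := (X in local_homeo _ _ _ X).
rewrite setIT => hom.
exists (fun u => Psi u *m K), (psi \o (fun u => u *m invmx K)), d', W; split=> //.
- by rewrite d'0 ge_min lexx orbT.
- move=> u u0; rewrite /Psi mulmxKV// /phi.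
  rewrite (_ : lsubmx u = 0) ?mul0mx ?addr0//; apply/rowP => j; rewrite !mxE (ord1 j).
  by rewrite -[RHS]u0; congr (u 0 _); exact/val_inj.
Qed.

End ImmersionChart.

Lemma int_rowD (R : realType) (n : nat) (z z' : 'rV[int]_n) :
  int_row (z + z') = int_row z + int_row z' :> 'rV[R]_n.
Proof. by apply/rowP => i; rewrite !mxE intrD. Qed.

(** The points of the unit cube at distance at least [r] from all translates of [x0] have a compact
    image that misses [e x0], and [O] is its complement. This is what makes an injective immersion
    of the torus an embedding. *)
Lemma torus_near (R : realType) (n : nat) (X : topologicalType) (e : 'rV[R]_n -> X)
    (x0 : 'rV[R]_n) (r : R) :
  hausdorff_space X -> continuous e ->
  (forall x y, e x = e y <-> exists z, y = x + int_row z) -> 0 < r ->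
  exists O, [/\ open O, O (e x0) &
    forall x, O (e x) -> exists z, `|x + int_row z - x0| < r].
Proof.
move=> hX ce eP r0.
have per x z : e (x + int_row z) = e x by apply/esym/eP; exists z.
pose K : set 'rV[R]_n := unit_cube `&` \bigcap_z [set x | r <= `|x + int_row z - x0|].
have cK : compact K.
  apply: compact_closedI; first exact: unit_cube_compact.
  apply: closed_bigI => z _.
  have cn : continuous (fun x : 'rV[R]_n => `|x + int_row z - x0|).
    move=> y; have cy : (fun x => x + int_row z - x0) @ y --> y + int_row z - x0.
      exact: cvgB (cvgD cvg_id (cvg_cst _)) (cvg_cst _).
    exact: cvg_norm cy.
  exact: (preimage_closed (fun z _ => cn z) (@closed_ge R r)).
have clK : closed (e @` K).
  by apply: compact_closed => //; apply: continuous_compact => //; exact: continuous_subspaceT.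
exists (~` (e @` K)); split; first exact: closed_openC.
  move=> [x [_ xK] /eP[z x0E]]; have := xK z I.
  by rewrite /= -x0E subrr normr0 leNgt r0.
move=> x nK; have [z0 xc] := unit_cube_rep x.
apply: contrapT => h; apply: nK; exists (x + int_row z0); last exact: per.
split=> // z _ /=; rewrite leNgt; apply/negP => xr; apply: h; exists (z0 + z).
by rewrite int_rowD addrA.
Qed.

Section LiftedTorus.
Context {R : realType} {n : nat} {M : manifold R n.+1}.
Variables (p : euclidean R n.+1 -> M) (e : 'rV[R]_n -> M) (E : 'rV[R]_n -> 'rV[R]_n.+1).
Hypothesis cov : smooth_covering p.
Hypothesis emb : torus_embedding e.
Hypothesis cE : continuous E.
Hypothesis pE : forall x, p (E x) = e x.
Hypothesis EP : forall x y, E x = E y <-> exists z, y = x + int_row z.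

Lemma smooth_covering_topological : topological_covering p.
Proof.
case: cov => -[cp _] _ loc; split=> [x|y]; first by apply: cp.
have [U [oU Uy [F [tF pF FV]]]] := loc y; exists U; split=> //; exists F; split=> // V /FV[oV].
move=> [s [[cs _] s1 s2]]; split=> //; exists s; split=> //.
Qed.

Lemma torus_embedding_continuous : continuous e.
Proof. by case: emb => -[[ce _] _] _ x; apply: ce. Qed.

(** A sheet of the covering and a chart of [M] reduce the claim to the immersion [c \o e]. Its chart
    straightens only the piece of the torus parametrised near [x0]; [torus_near] keeps the other
    pieces away. *)
Theorem lifted_torus_flat x0 : flat_at (range E) (E x0).
Proof.
have [cp loc] := smooth_covering_topological.
have ce := torus_embedding_continuous.
have [c ac cx0] := atlas_cover (e x0).
have [U [oU Uy [F [tF pF FV]]]] := loc (e x0).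
have : (p @^-1` U) (E x0) by rewrite /preimage /= pE.
rewrite pF => -[V FVV VE]; have [oV [s [cs s1 s2]]] := FV V FVV.
have VU z : V z -> U (p z).
  by move=> Vz; have : (p @^-1` U) z by rewrite pF; exists V.
have homs : local_homeo s p U V.
  split=> //.
  - by move=> u Uu; have [? ?] := s1 u Uu; split=> //; exact: cs.
  - by move=> z Vz; split; [exact: VU|exact: s2|exact: cp].
have homc : local_homeo (chart_inv c) c (chart_cod c) (chart_dom c).
  split; [exact: chart_cod_open|exact: chart_dom_open| |].
  - move=> u cu; split; [exact: chart_invP|exact: chart_invK|exact: chart_inv_cts].
  - move=> z cz; split; [exact: chart_funP|exact: chart_funK|exact: chart_fun_cts].
pose f (x : 'rV[R]_n) := c (e x).
pose D : set 'rV[R]_n := e @^-1` chart_dom c.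
have oD : open D by move/continuousP: ce; apply; exact: chart_dom_open.
have [f1 injf] : Ck_on 1 D f /\ injective ('d f x0).
  case: emb => -[[_ sm] inj] _.
  pose eu : chart R (euclidean R n) n := euclidean_chart R n.
  split; last exact: (inj eu c erefl ac x0 (conj I cx0)).
  suff -> : D = local_rep_dom eu c (e : euclidean R n -> M) `&` chart_inv eu @^-1` setT.
    exact: (sm eu c erefl ac 1%N).
  by apply/seteqP; split=> x; [move=> Dx; split|move=> [[_ Dx] _]].
have [r r0 rP] : exists2 r, 0 < r & forall v, `|v| < r -> D (x0 + v) /\ V (E (x0 + v)).
  have /nbhs_ballP[r /= r0 rP] : nbhs x0 (D `&` E @^-1` V).
    apply: open_nbhs_nbhs; split; last by split.
    by apply: openI => //; move/continuousP: cE; apply.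
  by exists r => // v vr; apply: rP; rewrite -ball_normE /= opprD addrA subrr sub0r normrN.
have [phi [psi [d [W [/andP[d0 dr] hom phiE]]]]] := immersion_chart oD cx0 f1 injf r0.
have hom1 := local_homeo_comp hom homc.
have hom2 := local_homeo_comp hom1 homs.
set Th := s \o (chart_inv c \o phi) in hom2.
set th := (psi \o c) \o p in hom2.
set B1 := (X in local_homeo _ _ X _) in hom2; set W1 := (X in local_homeo _ _ _ X) in hom2.
have rsub0 : rsubmx (0 : 'rV[R]_(1 + n)) = 0 by apply/rowP => j; rewrite !mxE.
have phi0 : phi 0 = f x0.
  by rewrite phiE; [rewrite rsub0 addr0|rewrite mxE].
have lat (v : 'rV[R]_n) : `|v| < r -> s (chart_inv c (f (x0 + v))) = E (x0 + v).
  by move=> /rP[Dv Vv]; rewrite /f chart_funK// -pE s2.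
have Th0 : Th 0 = E x0.
  by rewrite /Th /= phi0 -[x0]addr0 lat ?normr0.
have zd : `|0 : 'rV[R]_n.+1| < d by rewrite normr0.
have B10 : B1 0.
  split; first split=> //=.
    by rewrite /preimage /= phi0; exact: chart_funP.
  by rewrite /preimage /= phi0 chart_funK.
have [Ob [oO OE OP]] := torus_near x0 (@norm_hausdorff _ _) cE EP d0.
have [oB1 oW1 ThP thP] := hom2.
have : nbhs (0 : 'rV[R]_n.+1) (B1 `&` Th @^-1` Ob).
  apply: filterI; first exact: open_nbhs_nbhs.
  have [_ _ cTh] := ThP 0 B10; apply: cTh; rewrite Th0.
  exact: open_nbhs_nbhs.
move=> /nbhs_ballP[d' /= d'0 d'P].
have ballE (u : 'rV[R]_n.+1) : `|u| < d' -> B1 u /\ Ob (Th u).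
  by move=> ud; apply: d'P; rewrite -ball_normE /= sub0r normrN.
have oball : open [set u : 'rV[R]_n.+1 | `|u| < d'].
  rewrite (_ : [set u | _] = ball (0 : 'rV[R]_n.+1) d'); first exact: ball_open.
  by apply/seteqP; split=> u; rewrite -ball_normE /= sub0r normrN.
have hom3 := local_homeo_restrict hom2 oball (fun u ud => (ballE u ud).1).
exists Th, th, d', (W1 `&` th @^-1` [set u | `|u| < d']); split=> //.
- have thE : th (E x0) = 0 by rewrite -Th0; case: (ThP 0 B10).
  split=> //; split; first by rewrite -Th0; case: (ThP 0 B10).
  by rewrite /preimage /= thE normr0.
- move=> z [W1z zd']; have [B1z zE _] := thP z W1z; split=> [[x _ xz]|z0].
    have [k xk] : exists k, `|x + int_row k - x0| < d.
      by apply: OP; rewrite xz -zE; case: (ballE _ zd').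
    pose v := x + int_row k - x0.
    have zv : z = E (x0 + v).
      by rewrite -xz; apply/EP; exists k; rewrite /v addrC subrK.
    pose u : 'rV[R]_(1 + n) := row_mx 0 v.
    have u0 : u 0 0 = 0.
      have i0 : (0 : 'I_(1 + n)) = lshift n 0 by exact/val_inj.
      by rewrite [X in u _ X]i0 row_mxEl mxE.
    have ud : `|u| < d.
      apply/rV_norm_lt; split=> // i; rewrite mxE; case: split_ordP => j _.
        by rewrite mxE normr0.
      exact: le_lt_trans (rV_coord_le _ _) xk.
    have [_ _ homP _] := hom; have [_ uE _] := homP u ud.
    rewrite (_ : th z = u)//.
    have fE : c (e (x0 + v)) = phi u by rewrite phiE// row_mxKr.
    by rewrite /th /= zv pE fE uE.
  exists (x0 + rsubmx (th z : 'rV[R]_(1 + n))) => //; rewrite -lat; last first.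
    apply: le_lt_trans (_ : `|th z| < r).
      by apply: rV_norm_le => // i; rewrite mxE rV_coord_le.
    by apply: lt_le_trans dr; case: B1z => -[].
  by rewrite -phiE// -[RHS]zE.
Qed.

End LiftedTorus.

(** * Winding numbers *)

Section Winding.
Context {R : realType} {X : topologicalType}.
Implicit Types (f : X -> R) (a b c : X).

Definition winds f a b (p : path R a b) (w : R) := exists th : R -> R,
  [/\ continuous th, forall t, th t - f (p t) \is a Num.int & th 1 - th 0 = w].

(** The default 0 is taken only if [f] has no lift along [p], which cannot happen when [f] is
    continuous modulo the integers. *)
Definition winding f a b (p : path R a b) : R := xget 0 (winds f p).

Lemma windingP f a b (p : path R a b) w : winds f p w -> winding f p = w.
Proof.
move=> pw; rewrite /winding; case: xgetP => [w' -> [th' [c' h' <-]]|]; last by move/(_ w).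
case: pw => th [ct h <-].
have e : th' 1 - th 1 = th' 0 - th 0.
  apply: (@lift_eq R R) => // z.
  have -> : th' z - th z = (th' z - f (p z)) - (th z - f (p z)) by ring.
  exact: rpredB.
lra.
Qed.

Lemma winds_ex f a b (p : path R a b) : mod1_on setT f -> exists2 th : R -> R, continuous th &
  forall t, th t - f (p t) \is a Num.int.
Proof.
move=> fm; apply: mod1_lift => t _; apply: (@mod1_comp R _ _ setT) => //; first exact: path_cts.
exact: fm.
Qed.

Lemma winding_homotopic f a b (p q : path R a b) : mod1_on setT f -> homotopic p q ->
  winding f p = winding f q.
Proof.
move=> fm [H [cH H0 H1 Ha Hb]].
have [K cK KP] : exists2 K : R * R -> R, continuous K & forall z, K z - f (H z) \is a Num.int.
  by apply: mod1_lift => t _; apply: (@mod1_comp R _ _ setT) => //; [exact: cH|exact: fm].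
have c1 (u : R) : continuous (fun t : R => (u, t)).
  by apply: continuous_pairfun => z; [exact: cvg_cst|exact: cvg_id].
have c2 (u : R) : continuous (fun t : R => (t, u)).
  by apply: continuous_pairfun => z; [exact: cvg_id|exact: cvg_cst].
rewrite (@windingP _ _ _ p (K (0, 1) - K (0, 0))); last first.
  exists (fun t => K (0, t)); split=> //; first exact: (continuous_compfun cK (c1 0)).
  by move=> t; rewrite -H0.
rewrite (@windingP _ _ _ q (K (1, 1) - K (1, 0))); last first.
  exists (fun t => K (1, t)); split=> //; first exact: (continuous_compfun cK (c1 1)).
  by move=> t; rewrite -H1.
have side u z : (forall t, H (t, u) = z) -> K (0, u) = K (1, u).
  move=> Hz; apply: (addIr (- f z)).
  apply: (@lift_eq R R (fun t => K (t, u)) (fun=> f z)).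
  - exact: (continuous_compfun cK (c2 u)).
  - exact: cst_continuous.
  - by move=> t; rewrite -(Hz t).
by rewrite (side 0 a) ?(side 1 b)// => t; [exact: Hb|exact: Ha].
Qed.

Lemma winding_cat f a b c (p : path R a b) (q : path R b c) : mod1_on setT f ->
  winding f (path_cat p q) = winding f p + winding f q.
Proof.
move=> fm; have [th cth thP] := winds_ex (path_cat p q) fm.
have aff (u v : R) : continuous (fun t : R => u * t + v).
  by apply: continuous_affine => z; exact: cvg_id.
rewrite (@windingP _ _ _ _ (th 1 - th 0)); last by exists th.
rewrite (@windingP _ _ _ p (th 2^-1 - th 0)); last first.
  exists (fun t => th (2^-1 * clamp t + 0)); split.
  - apply: (continuous_compfun cth (continuous_compfun (aff _ _) clamp_continuous)).
  - move=> t; have := thP (2^-1 * clamp t + 0); rewrite /= /path_cat_fun.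
    have /andP[t0 t1] := clamp01 t.
    by rewrite ifT ?addr0 ?mulVKf ?pnatr_eq0// ?path_clamp//; lra.
  - by rewrite (clamp_id (_ : 0 <= 1 <= 1)) ?ler01 ?lexx// clamp_le0// mulr0 mulr1 !addr0.
rewrite (@windingP _ _ _ q (th 1 - th 2^-1)); first by ring.
exists (fun t => th (2^-1 * clamp t + 2^-1)); split.
- apply: (continuous_compfun cth (continuous_compfun (aff _ _) clamp_continuous)).
- move=> t; have := thP (2^-1 * clamp t + 2^-1); rewrite /= /path_cat_fun.
  have /andP[t0 t1] := clamp01 t.
  have -> : 2 * (2^-1 * clamp t + 2^-1) = clamp t + 1 by field.
  rewrite addrK path_clamp; case: ifP => // t2.
  have -> : clamp t = 0 by lra.
  rewrite add0r path1; suff -> : q t = b by [].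
  by rewrite -path_clamp (_ : clamp t = 0) ?path0//; lra.
- rewrite (clamp_id (_ : 0 <= 1 <= 1)) ?ler01 ?lexx// clamp_le0// mulr0 mulr1 add0r.
  by congr (th _ - _); lra.
Qed.

Lemma winding_inv f a b (p : path R a b) : mod1_on setT f ->
  winding f (path_inv p) = - winding f p.
Proof.
move=> fm; have [th cth thP] := winds_ex p fm.
rewrite (@windingP _ _ _ p (th 1 - th 0)); last by exists th.
apply: windingP; exists (fun t => th (-1 * t + 1)); split.
- by apply: (continuous_compfun cth); apply: continuous_affine => z; exact: cvg_id.
- by move=> t; rewrite /= (_ : 1 - t = -1 * t + 1)//; ring.
- by rewrite mulr1 mulr0 add0r addNr opprB.
Qed.

Lemma windingB f g a b (p : path R a b) : mod1_on setT f -> mod1_on setT g ->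
  winding (fun z => f z - g z) p = winding f p - winding g p.
Proof.
move=> fm gm; have [th cth thP] := winds_ex p fm; have [th' cth' thP'] := winds_ex p gm.
rewrite (@windingP f _ _ p (th 1 - th 0)); last by exists th.
rewrite (@windingP g _ _ p (th' 1 - th' 0)); last by exists th'.
apply: windingP; exists (fun t => th t - th' t); split.
- by move=> z; exact: (cvgB (cth z) (cth' z)).
- move=> t; have -> : th t - th' t - (f (p t) - g (p t)) =
      (th t - f (p t)) - (th' t - g (p t)) by ring.
  exact: rpredB.
- by ring.
Qed.

Lemma winding_loop f a (p : path R a a) : mod1_on setT f -> winding f p \is a Num.int.
Proof.
move=> fm; have [th cth thP] := winds_ex p fm.
rewrite (@windingP f _ _ p (th 1 - th 0)); last by exists th.
have -> : th 1 - th 0 = (th 1 - f (p 1)) - (th 0 - f (p 0)) by rewrite path1 path0; ring.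
exact: rpredB.
Qed.

End Winding.

Lemma winding_map (R : realType) (X Y : topologicalType) (g : continuousType X Y)
    (f : Y -> R) (a b : X) (p : path R a b) : mod1_on setT f ->
  winding f (path_map g p) = winding (f \o g) p.
Proof.
move=> fm; have [th cth thP] := winds_ex (path_map g p) fm.
by rewrite !(@windingP _ _ _ _ _ _ (th 1 - th 0))//; exists th.
Qed.

Lemma int_additive_row (n : nat) (chi : 'cV[int]_n -> int) :
  {morph chi : a b / a + b} -> exists v : 'rV[int]_n, forall u, chi u = (v *m u) 0 0.
Proof.
move=> chiD.
have chi0 : chi 0 = 0 by apply: (addIr (chi 0)); rewrite -chiD !add0r.
have chiN a : chi (- a) = - chi a.
  by apply: (addIr (chi a)); rewrite -chiD !addNr.
have chiMn a k : chi (a *+ k) = chi a *+ k.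
  by elim: k => [|k IH]; rewrite ?mulr0n// !mulrS chiD IH.
have chiZ (z : int) a : chi (z *: a) = z * chi a.
  have -> : z *: a = a *~ z by rewrite -scaler_int intz.
  case: z => k.
    by rewrite -[a *~ _]/(a *+ k) chiMn -mulr_natl natz.
  by rewrite -[a *~ _]/(- (a *+ k.+1)) chiN chiMn NegzE mulNr -mulr_natl natz.
exists (\row_j chi (delta_mx j 0)) => u.
have -> : u = \sum_j u j 0 *: delta_mx j 0.
  rewrite {1}[u]matrix_sum_delta; apply: eq_bigr => j _.
  by rewrite big_ord1.
rewrite (big_morph chi chiD chi0) mulmx_sumr summxE; apply: eq_bigr => j _.
rewrite chiZ -scalemxAr mxE; congr (_ * _).
rewrite mxE (bigD1 j)//= big1 => [|i ij]; rewrite !mxE ?eqxx ?mulr1 ?addr0//.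
by rewrite (negbTE ij) mulr0.
Qed.

Section PeriodicMaps.
Context {R : realType} {n m : nat}.
Variable (E : 'rV[R]_n -> 'rV[R]_m).
Hypothesis cE : continuous E.
Hypothesis EP : forall x y, E x = E y <-> exists z, y = x + int_row z.

Lemma torus_map_periodic x z : E (x + int_row z) = E x.
Proof. by apply/esym/EP; exists z. Qed.

Lemma torus_image_compact : compact (range E).
Proof.
have -> : range E = E @` unit_cube.
  apply/seteqP; split=> [_ [x _ <-]|_ [x _ <-]]; last by exists x.
  by have [z zc] := unit_cube_rep x; exists (x + int_row z); rewrite ?torus_map_periodic.
apply: continuous_compact; last exact: unit_cube_compact.
exact: continuous_subspaceT.
Qed.

(** A chosen inverse of the parametrisation, determined up to integer vectors on the torus. Its
    entries are the circle-valued coordinates of the torus. *)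
Let pre (z : 'rV[R]_m) : 'rV[R]_n := xget 0 [set y | E y = z].

Let preE y : exists z, pre (E y) = y + int_row z.
Proof.
rewrite /pre; case: xgetP => [x -> /esym/EP //|/(_ y)]; by case.
Qed.

Lemma torus_coordinate_mod1 j : mod1_on (range E) (fun z => pre z 0 j).
Proof.
move=> _ [y0 _ <-] h h0.
have [Ob [oO OE OP]] := torus_near y0 (@norm_hausdorff _ _) cE EP h0.
apply: filterS (open_nbhs_nbhs (conj oO OE)) => z Oz [y _ yz]; subst z.
have [k yk] := OP y Oz; have [a aE] := preE y; have [b bE] := preE y0.
exists (((a - k) 0 j)%:~R - (b 0 j)%:~R); first by rewrite -rmorphB /= intr_int.
have := rV_coord_le (y + int_row k - y0) j; move/le_lt_trans/(_ yk).
rewrite aE bE !mxE; suff -> : y 0 j + (a 0 j)%:~R - (y0 0 j + (b 0 j)%:~R) -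
   ((a 0 j - k 0 j)%:~R - (b 0 j)%:~R) = y 0 j + (k 0 j)%:~R - y0 0 j by [].
by rewrite rmorphB /=; ring.
Qed.

Lemma torus_coordinateE j y : pre (E y) 0 j - y 0 j \is a Num.int.
Proof. by have [z ->] := preE y; rewrite !mxE addrAC subrr add0r intr_int. Qed.

Lemma torus_function_extension (K : 'rV[R]_n -> R) : continuous K ->
  (forall y z, K (y + int_row z) = K y) ->
  exists2 Th : 'rV[R]_m -> R, continuous Th & forall y, Th (E y) = K y.
Proof.
move=> cK perK.
have [||Th cTh ThP] := @tietze_compact R _ (range E) (K \o pre).
- exact: torus_image_compact.
- move=> _ [y0 _ <-] U; have [b bE] := preE y0; rewrite /= bE perK => KU.
  have /nbhs_ballP[h /= h0 hP] : nbhs y0 (K @^-1` U) by exact: cK.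
  have [Ob [oO OE OP]] := torus_near y0 (@norm_hausdorff _ _) cE EP h0.
  have nO : nbhs (E y0) Ob by exact: open_nbhs_nbhs.
  have : nbhs (E y0) (fun z => range E z -> U (K (pre z))).
    apply: filterS nO => z Oz [y _ yz]; subst z.
    have [k yk] := OP y Oz; have [a aE] := preE y.
    by rewrite aE perK -(perK y k); apply: hP; rewrite -ball_normE /= distrC.
  exact.
exists Th => // y; rewrite ThP; last by exists y.
by have [a aE] := preE y; rewrite /= aE.
Qed.

End PeriodicMaps.

Section Sides.
Context {R : realType} {n k : nat}.
Let m := k.+2.
Variable (E : 'rV[R]_n -> 'rV[R]_m).
Hypothesis cE : continuous E.
Hypothesis EP : forall x y, E x = E y <-> exists z, y = x + int_row z.
Hypothesis side : exists s, side_function (range E) setT s.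
Hypothesis two_sided : forall y, range E y -> two_sided_at (range E) y.
Variables (G H : 'rV[R]_m -> 'rV[R]_m).
Hypotheses (cG : continuous G) (cH : continuous H) (GK : cancel G H) (HK : cancel H G).
Hypothesis GT : forall z, range E (G z) <-> range E z.

Let T := range E.

Let clT : closed T.
Proof. by apply: compact_closed; [exact: norm_hausdorff|exact: torus_image_compact]. Qed.

Let Tbounded : exists2 r : R, 0 < r & forall z, T z -> `|z| <= r.
Proof.
have [M [_ Mb]] := compact_bounded (torus_image_compact cE EP).
exists (`|M| + 1); first by rewrite ltr_wpDl.
by apply: Mb; rewrite (le_lt_trans (ler_norm M))// ltrDl.
Qed.

(* [s \o G] and [s] have the same jumps, and both are constant near infinity. *)
Lemma side_invariant (s : 'rV[R]_m -> bool) : side_function T setT s ->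
  forall z, ~ T z -> s (G z) = s z.
Proof.
move=> sT; have [s1 s2] := sT.
have sG : side_function T setT (s \o G).
  split=> [z _ nTz|z V _ Tz Vz].
    have : \forall w \near G z, s w = s (G z) by apply: s1 => // /GT.
    exact: cG.
  have VH : nbhs (G z) (H @^-1` V) by apply: cH; rewrite GK.
  have [w [w' [[Vw Vw'] nw nw' ww']]] := s2 (G z) _ I (iffRL (GT z) Tz) VH.
  exists (H w), (H w'); split=> //=; last by rewrite !HK.
    by move=> /GT; rewrite HK.
  by move=> /GT; rewrite HK.
have /choice[h hP] y : exists b, agree (~` T) (s \o G) (fun z => b (+) s z) y.
  exact: (side_function_agree two_sided openT openT I I sT sG).
have hlc y : \forall z \near y, h z = h y.
  apply: filterS (agree_near (hP y)) => z hz.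
  have both : nbhs z [set w | ~ T w -> h z (+) s w = h y (+) s w].
    by apply: filterS2 (hP z) hz => w e1 e2 nTw; rewrite -e1// -e2.
  have [w [e nTw]] : exists w, (~ T w -> h z (+) s w = h y (+) s w) /\ ~ T w.
    have [Tz|nTz] := pselect (T z); last by exists z; split=> //; exact: nbhs_singleton both.
    by have [w [w' [[e _] nTw _ _]]] := s2 z _ I Tz both; exists w.
  by move: (e nTw); case: (h z); case: (h y); case: (s w).
have hc y : h y = h 0.
  by apply: (@locally_constant_seg R 'rV[R]_m _ setT h).
have [r r0 Tr] := Tbounded.
have far z w : r < `|z| -> r < `|w| -> s z = s w.
  apply: exterior_constant; first exact: ltW.
  by move=> u ru; apply: s1 => // /Tr; rewrite leNgt ru.
(* A point whose norm exceeds the bound of [H] on the ball is sent by [G] outside the ball, so [s]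
   has its exterior value both there and at the image. *)
have [M [_ Mb]] : bounded_set (H @` [set z | `|z| <= r]).
  apply: compact_bounded; apply: continuous_compact; last exact: rV_box_compact.
  exact: continuous_subspaceT.
pose z0 : 'rV[R]_m := const_mx (`|M| + 1 + r).
have z0n : `|z0| = `|M| + 1 + r.
  have p0 : 0 <= `|M| + 1 + r by rewrite !addr_ge0// ltW.
  apply/eqP; rewrite eq_le; apply/andP; split.
    by apply: rV_norm_le => // i; rewrite mxE ger0_norm.
  by have := rV_coord_le z0 0; rewrite mxE ger0_norm.
have rz : r < `|z0| by rewrite z0n ltrDr ltr_wpDl.
have rGz : r < `|G z0|.
  rewrite ltNge; apply/negP => Gr.
  have M1 : M < `|M| + 1 by rewrite (le_lt_trans (ler_norm M))// ltrDl.
  have := Mb _ M1 z0; rewrite /= z0n => h0.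
  have : `|M| + 1 + r <= `|M| + 1 by apply: h0; exists (G z0).
  by rewrite gerDl leNgt r0.
have nT0 : ~ T z0 by move=> /Tr; rewrite leNgt rz.
have h0 : h 0 = false.
  have := agree_at (hP z0) nT0; rewrite hc /= (far (G z0) z0)//.
  by case: (h 0) (s z0) => -[].
by move=> z nTz; have := agree_at (hP z) nTz; rewrite hc h0 addFb.
Qed.

Theorem torus_sides : exists (N1 N2 : set 'rV[R]_m) (r : R) (q : 'rV[R]_m),
  [/\ closed N1 /\ closed N2, (forall x, N1 x \/ N2 x) /\
        ((forall x, N1 x -> N2 x -> range E x) /\ forall x, N1 (E x) /\ N2 (E x)),
      0 < r /\ (forall x, N2 x -> `|x| < r), ~ N1 q &
      forall x, (N1 x -> N1 (G x)) /\ (N2 x -> N2 (G x))].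
Proof.
have [s sT] := side; have [s1 s2] := sT; have sG := side_invariant sT.
have [r r0 Tr] := Tbounded.
have far z w : r < `|z| -> r < `|w| -> s z = s w.
  apply: exterior_constant; first exact: ltW.
  by move=> u ru; apply: s1 => // /Tr; rewrite leNgt ru.
pose z0 : 'rV[R]_m := const_mx (r + 1).
have rz : r < `|z0|.
  by have := rV_coord_le z0 0; rewrite mxE ger0_norm; lra.
(* Adding the torus makes each side closed. The side of the far point [z0] becomes [N1] and contains
   the exterior of a ball, so that [N2] is bounded. *)
pose N b : set 'rV[R]_m := T `|` [set z | s z = b].
have clN b : closed (N b).
  rewrite -[N b]setCK; apply: open_closedC; rewrite openE => z nz.
  have nTz : ~ T z by move=> Tz; apply: nz; left.
  have nT : nbhs z (~` T) by apply: open_nbhs_nbhs; split=> //; exact: closed_openC.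
  apply: filterS2 nT (s1 z I nTz) => w nTw sw [//|/=].
  by rewrite sw => sb; apply: nz; right.
have GN b x : N b x -> N b (G x).
  move=> [Tx|sx]; first by left; apply/GT.
  have [Tx|nTx] := pselect (T x); first by left; apply/GT.
  by right; rewrite /= sG.
have [w [w' [_ nTw nTw' ww']]] := s2 (E 0) setT I (imageT _ _) filterT.
have [q [nTq sq]] : exists q, ~ T q /\ s q <> s z0.
  have [e|] := eqVneq (s w) (s z0); last by move=> /eqP ?; exists w.
  by exists w'; split=> // e'; apply: ww'; rewrite e e'.
exists (N (s z0)), (N (~~ s z0)), (r + 1), q; split.
- by split; exact: clN.
- split=> [x|].
    by have [e|e] := eqVneq (s x) (s z0); [left|right]; right => //=; move: e; case: (s x) (s z0) => -[].
  split=> [x [//|/= sx] [//|/= sx']|x]; last by split; left; exists x.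
  by move: sx'; rewrite sx; case: (s z0).
- split; first by rewrite addr_gt0.
  move=> x [/Tr xr|/= sx]; first by rewrite (le_lt_trans xr)// ltrDl.
  rewrite ltNge; apply/negP => xr; have : s x = s z0 by apply: far => //; lra.
  by rewrite sx; case: (s z0).
- by move=> [].
- by move=> x; split; exact: GN.
Qed.

End Sides.

(** * Invariant subgroups of lattices *)

Section Saturation.
Context {n : nat}.
Implicit Types (V : set 'rV[int]_n) (v : 'rV[int]_n).

Lemma subgroup_scale V : (forall u v, V u -> V v -> V (u - v)) ->
  forall (d : int) v, V v -> V (d *: v).
Proof.
move=> VB d v Vv.
have V0 : V 0 by rewrite -(subrr v); exact: VB.
have VN w : V w -> V (- w) by rewrite -[- w]add0r; exact: VB.
have VMn i : V (v *+ i).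
  elim: i => [|i IH]; first by rewrite mulr0n.
  by rewrite mulrSr -[X in _ + X]opprK; apply: VB => //; exact: VN.
have -> : d *: v = v *~ d by rewrite -scaler_int intz.
case: (d) => i; first exact: VMn.
exact: (VN (v *+ i.+1) (VMn i.+1)).
Qed.

Lemma subgroup_sum V : (forall u v, V u -> V v -> V (u - v)) -> V 0 ->
  forall (m : nat) (f : 'I_m -> 'rV[int]_n), (forall i, V (f i)) -> V (\sum_i f i).
Proof.
move=> VB V0 m f Vf; apply: (big_ind V) => // u w Vu Vw.
by rewrite -[w]opprK; apply: (VB) => //; rewrite -[- w]add0r; exact: VB.
Qed.

End Saturation.

Lemma common_denominator (n : nat) (c : 'rV[rat]_n) :
  exists (d : int) (b : 'rV[int]_n), d != 0 /\ map_mx intr b = d%:~R *: c.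
Proof.
pose d := \prod_i denq (c 0 i).
exists d, (\row_i (numq (c 0 i) * \prod_(j | j != i) denq (c 0 j))); split.
  by apply/prodf_neq0 => i _; exact: denq_neq0.
apply/rowP => i; rewrite !mxE; set q := \prod_(j | _) _; set x := c 0 i.
have -> : d = denq x * q by rewrite /d (bigD1 i).
by rewrite !intrM numqE; ring.
Qed.

(** A linear dependence is a nonzero polynomial of degree at most [n] in [A] that kills [v]. It is
    coprime to the characteristic polynomial, which kills [v] by Cayley-Hamilton, so a Bezout
    relation gives [v = 0]. *)
Lemma krylov_unit (F : fieldType) (n : nat) (A : 'M[F]_n.+1) (v : 'rV[F]_n.+1) :
  irreducible_poly (char_poly A) -> v != 0 ->
  (\matrix_(i < n.+1) (v *m A ^+ i) : 'M[F]_n.+1) \in unitmx.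
Proof.
move=> [_ irr] v0; rewrite -row_free_unit; apply: inj_row_free => w wP.
apply/eqP/negPn/negP => w0.
pose p := rVpoly w.
have pA : v *m horner_mx A p = 0.
  rewrite -wP /p.
  have -> : rVpoly w = \sum_i w 0 i *: 'X^i.
    rewrite /rVpoly poly_def; apply: eq_bigr => i _; case: insubP => [j _ /val_inj ->|] //=.
    by rewrite ltn_ord.
  rewrite linear_sum mulmx_sumr mulmx_sum_row; apply: eq_bigr => i _.
  by rewrite linearZ /= rmorphXn /= horner_mx_X rowK -scalemxAr.
have p0 : p != 0 by apply: contra_neq w0 => p0; rewrite -[w]rVpolyK -/p p0 linear0.
have cop : coprimep p (char_poly A).
  apply/negPn/negP => ncop; have := irr _ ncop (dvdp_gcdr _ _) => /eqp_size.
  rewrite size_char_poly => sg; have := dvdp_leq p0 (dvdp_gcdl p (char_poly A)).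
  rewrite sg; have := size_poly n.+1 (fun i => oapp (w 0) 0 (insub i)).
  by rewrite -/(rVpoly w) -/p => h1 /leq_trans/(_ h1); rewrite ltnn.
have [[a b] /= ab] := Bezout_eq1_coprimepP _ _ cop.
move/negP: v0; apply; apply/eqP.
rewrite -[v]mulmx1 -[1%:M]/(1 : 'M[F]_n.+1) -(rmorph1 (horner_mx A)) -ab.
rewrite rmorphD !rmorphM /= Cayley_Hamilton mulr0 addr0.
by rewrite (comm_horner_mx2 A a p) -mulmxE mulmxA pA mul0mx.
Qed.

(** The images of [v] under the powers of [A] span the rational space; clearing denominators writes
    a multiple of [u] as an integer combination of them. *)
Theorem irreducible_saturation (n : nat) (A : 'M[int]_n) :
  irreducible_poly (map_poly intr (char_poly A) : {poly rat}) ->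
  forall V : set 'rV[int]_n,
  (forall u v, V u -> V v -> V (u - v)) -> (forall v, V v -> V (v *m A)) ->
  forall v, V v -> v != 0 -> forall u, exists2 d : int, d != 0 & V (d *: u).
Proof.
case: n A => [|n] A irr V VB VA v Vv v0 u.
  by move: v0; rewrite (_ : v = 0) ?eqxx//; apply/rowP => -[].
pose i2q := @map_mx int rat intr.
have Airr : irreducible_poly (char_poly (i2q n.+1 n.+1 A)) by rewrite -map_char_poly.
have inj a b : injective (i2q a b).
  move=> x y xy; apply/matrixP => i j; apply: (@intr_inj rat).
  by have := congr1 (fun z : 'M[rat]_(a, b) => z i j) xy; rewrite !mxE.
have vq0 : i2q _ _ v != 0.
  by apply: contra_neq v0 => h; apply: inj; rewrite h /i2q map_mx0.
have uP := krylov_unit Airr vq0; set P := (X in X \in unitmx) in uP.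
have [d [b [d0 bE]]] := common_denominator (i2q _ _ u *m invmx P).
exists d => //.
have -> : d *: u = \sum_i b 0 i *: (v *m A ^+ i).
  apply: inj; rewrite /i2q map_mxZ -[map_mx intr u](mulmxKV uP).
  rewrite scalemxAl -bE mulmx_sum_row raddf_sum; apply: eq_bigr => i _.
  by rewrite /= map_mxZ map_mxM rmorphXn /= mxE rowK.
have V0 : V 0 by rewrite -(subrr v); exact: VB.
apply: subgroup_sum => // i; apply: subgroup_scale => //.
elim: (i : nat) => [|j IH]; first by rewrite expr0 mulmx1.
by rewrite exprSr -[_ * _]/(_ *m _) mulmxA; exact: VA.
Qed.

(** * Cohomology classes on the two sides of a torus *)

Section NoTorus.
Context {R : realType} {k : nat}.
Let n := k.+2.
Let m := n.+1.
Variables (T : topologicalType) (e : 'rV[R]_n -> T) (l : T -> 'rV[R]_m) (E : 'rV[R]_n -> 'rV[R]_m).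
Hypotheses (ce : continuous e) (cl : continuous l).
Hypothesis leE : forall y, l (e y) = E y.
Hypothesis lT : forall t, range E (l t).
Hypothesis eP : forall x z, e (x + int_row z) = e x.
Hypothesis EP : forall x y, E x = E y <-> exists z, y = x + int_row z.
Variables (G H : 'rV[R]_m -> 'rV[R]_m) (gT : continuousType T T).
Hypotheses (cG : continuous G) (cH : continuous H) (GK : cancel G H) (HK : cancel H G).
Hypothesis GT : forall z, range E (G z) <-> range E z.
Hypothesis Gl : forall t, G (l t) = l (gT t).
Variables (y0 : 'rV[R]_n) (x : T) (xE : e y0 = x) (c : path R x (gT x)).
Variables (phi : pi1 R x -> 'cV[int]_n) (A : 'M[int]_n).
Hypothesis phi_bij : bijective phi.
Hypothesis phiM : {morph phi : a b / (a * b)%g >-> a + b}.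
Hypothesis phiA : forall p : path R x x,
  phi (pi1_class (path_cat (path_cat c (path_map gT p)) (path_inv c))) = A *m phi (pi1_class p).
Hypothesis irr : forall V : set 'rV[int]_n,
  (forall u v, V u -> V v -> V (u - v)) -> (forall v, V v -> V (v *m A)) ->
  forall v, V v -> v != 0 -> forall u, exists2 d : int, d != 0 & V (d *: u).

Let cE : continuous E.
Proof.
have -> : E = l \o e by apply/funext => y; rewrite /= leE.
exact: continuous_compfun.
Qed.

Section Classes.
Variable (N : set 'rV[R]_m).
Hypothesis lN : forall t, N (l t).
Hypothesis GN : forall z, N z -> N (G z).

Let mod1_l (F : 'rV[R]_m -> R) : mod1_on N F -> mod1_on setT (F \o l).
Proof.
move=> Fm t _; apply: (@mod1_comp R _ _ N) => //; first exact: cl.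
exact: Fm.
Qed.

(** [v] is the class of [F] in the first cohomology of the torus, in the basis dual to the one given
    by [phi]. *)
Definition has_class (F : 'rV[R]_m -> R) (v : 'rV[int]_n) :=
  forall p : path R x x, winding (F \o l) p = ((v *m phi (pi1_class p)) 0 0)%:~R.

Lemma class_exists (F : 'rV[R]_m -> R) : mod1_on N F -> exists v, has_class F v.
Proof.
move=> /mod1_l Fm; have [psi phiK psiK] := phi_bij.
have /choice[chi chiP] u : exists w : int, winding (F \o l) (repr (psi u)) = w%:~R.
  by apply/intrP; exact: winding_loop.
have chiE p : winding (F \o l) p = (chi (phi (pi1_class p)))%:~R.
  rewrite -chiP phiK; apply: winding_homotopic => //; apply: homotopic_sym.
  exact: pi1_repr_class.
have chiD : {morph chi : a b / a + b}.
  move=> a b; apply: (@intr_inj R); rewrite rmorphD /= -!chiP -winding_cat// [RHS]chiE.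
  rewrite -pi1_mulE !pi1_reprK -[pi1_mul _ _]/(psi a * psi b)%g phiM !psiK.
  exact: chiP.
have [v vP] := int_additive_row chiD; exists v => p.
by rewrite chiE vP.
Qed.

Definition classes : set 'rV[int]_n :=
  [set v | exists2 F : 'rV[R]_m -> R, mod1_on N F & has_class F v].

Lemma classesB u v : classes u -> classes v -> classes (u - v).
Proof.
move=> [F Fm Fu] [F' F'm F'v]; exists (fun z => F z - F' z).
  by move=> z Nz; apply: mod1D; [exact: Fm|apply: mod1N; exact: F'm].
move=> p; have -> : winding ((fun z => F z - F' z) \o l) p =
    winding (F \o l) p - winding (F' \o l) p.
  by apply: windingB; exact: mod1_l.
by rewrite Fu F'v -rmorphB /= mulmxBl !mxE.
Qed.

(** Composition with [G] restricts to composition with [gT] on the torus, and the windings along [c]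
    and its inverse cancel. *)
Lemma classesA v : classes v -> classes (v *m A).
Proof.
move=> [F Fm Fv]; exists (F \o G).
  move=> z Nz; apply: (@mod1_comp R _ _ N) => //; first exact: cG.
  by apply: Fm; exact: GN.
move=> p; rewrite -mulmxA -phiA -Fv.
have -> : (F \o G) \o l = (F \o l) \o gT by apply/funext => t; rewrite /= Gl.
rewrite !winding_cat; try exact: mod1_l.
rewrite winding_inv; last exact: mod1_l.
rewrite winding_map; last exact: mod1_l.
by ring.
Qed.

(** The winding vanishes along the loops given by lattice vectors, so the real lift of [F \o E] is
    periodic. *)
Lemma class0_lift (F : 'rV[R]_m -> R) : mod1_on N F -> has_class F 0 ->
  exists K : 'rV[R]_n -> R, [/\ continuous K, forall y z, K (y + int_row z) = K y &
    forall y, K y - F (E y) \is a Num.int].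
Proof.
move=> Fm F0; have Flm := mod1_l Fm.
have [K cK KP] : exists2 K : 'rV[R]_n -> R, continuous K & forall y, K y - F (E y) \is a Num.int.
  apply: mod1_lift => y _; apply: (@mod1_comp R _ _ N) => //; first exact: cE.
    by move=> y' _; rewrite -leE.
  by apply: Fm; rewrite -leE.
exists K; split=> // y z.
pose Kz u := K (u + int_row z).
have cs : continuous (fun u : 'rV[R]_n => u + int_row z).
  by move=> u; exact: cvgD cvg_id (cvg_cst _).
have Eper u : E (u + int_row z) = E u by apply/esym/EP; exists z.
(* The increment of the lift under a translation is constant, and at [y0] it is the winding along a
   loop based at [x]. *)
have KzK : Kz y - K y = Kz y0 - K y0.
  apply: (@lift_eq R _ Kz K) => //; first exact: (continuous_compfun cK cs).
  move=> u; have -> : Kz u - K u = (K (u + int_row z) - F (E (u + int_row z))) - (K u - F (E u)).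
    by rewrite Eper /Kz; ring.
  exact: rpredB.
pose line (t : R) : 'rV[R]_n := y0 + clamp t *: int_row z.
have cline : continuous line.
  by move=> t; exact: (cvgD (cvg_cst _) (cvgZr_tmp (@clamp_continuous R t))).
have p0 t : t <= 0 -> e (line t) = x.
  by move=> t0; rewrite /line clamp_le0// scale0r addr0.
have p1 t : 1 <= t -> e (line t) = x.
  by move=> t1; rewrite /line clamp_ge1// scale1r eP.
pose p := Path (continuous_compfun ce cline) p0 p1.
have := F0 p; rewrite mul0mx mxE.
rewrite (@windingP _ _ _ _ _ _ (K (line 1) - K (line 0))); last first.
  exists (K \o line); split=> //; first exact: (continuous_compfun cK cline).
  by move=> t; rewrite /= leE.
rewrite /line clamp_ge1// clamp_le0// scale1r scale0r addr0 => h.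
by apply/eqP; rewrite -subr_eq0 -/(Kz y) KzK /Kz h.
Qed.

End Classes.

Variables (N1 N2 : set 'rV[R]_m).
Hypotheses (clN1 : closed N1) (clN2 : closed N2).
Hypothesis cover : forall z, N1 z \/ N2 z.
Hypothesis meet : forall z, N1 z -> N2 z -> range E z.
Hypothesis sub : forall y, N1 (E y) /\ N2 (E y).

Let lN1 t : N1 (l t). Proof. by have [y _ <-] := lT t; case: (sub y). Qed.
Let lN2 t : N2 (l t). Proof. by have [y _ <-] := lT t; case: (sub y). Qed.

(* A class that extends to both sides comes from the simply connected space
   [R^m]. *)
Lemma classes_meet v : classes N1 v -> classes N2 v -> v = 0.
Proof.
move=> [F1 F1m F1v] [F2 F2m F2v].
have mT (N : set 'rV[R]_m) (F : 'rV[R]_m -> R) : (forall y, N (E y)) ->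
      mod1_on N F -> mod1_on (range E) F.
  move=> NE Fm _ [y _ <-]; apply: (@mod1_sub R _ N) => [_ [u _ <-]|]; first exact: NE.
  exact: Fm.
have F1T := mT N1 F1 (fun y => (sub y).1) F1m.
have F2T := mT N2 F2 (fun y => (sub y).2) F2m.
have Dm : mod1_on (range E) (fun z => F1 z - F2 z).
  by move=> z Tz; apply: mod1D; [exact: F1T|apply: mod1N; exact: F2T].
have [K [cK perK KP]] : exists K : 'rV[R]_n -> R, [/\ continuous K,
    forall y z, K (y + int_row z) = K y & forall y, K y - (F1 (E y) - F2 (E y)) \is a Num.int].
  apply: (class0_lift lT Dm) => p.
  have -> : winding ((fun z => F1 z - F2 z) \o l) p = winding (F1 \o l) p - winding (F2 \o l) p.
    apply: windingB => t _; apply: (@mod1_comp R _ _ (range E)) => //; try exact: cl.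
      exact: F1T.
    exact: F2T.
  by rewrite F1v F2v subrr mul0mx mxE.
have [Th cTh ThE] := torus_function_extension cE EP cK perK.
(* On the torus [Th] is a real lift of the difference of [F1] and [F2], so the two pieces match
   modulo the integers. The real lift of the resulting function on the whole space shows that [F1]
   has no winding. *)
pose F z := if `[< N1 z >] then F1 z else F2 z + Th z.
have Fm : mod1_on setT F.
  move=> z _; have -> : setT = N1 `|` N2.
    by apply/seteqP; split=> // w _; case: (cover w); [left|right].
  apply: mod1_closed_cover => // zN.
    apply: (mod1_eq zN) (F1m z zN) => w w1; rewrite /F.
    by case: asboolP => // _; rewrite subrr rpred0.
  apply: (@mod1_eq R _ N2 (F2 \+ Th)) => //; last first.
    by apply: mod1D; [exact: F2m|apply: continuous_mod1; exact: cTh].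
  move=> w w2; rewrite /F; case: asboolP => [w1|_]; last by rewrite subrr rpred0.
  have [y _ <-] := meet w1 w2; rewrite /= ThE -rpredN.
  have -> : - (F1 (E y) - (F2 (E y) + K y)) = K y - (F1 (E y) - F2 (E y)) by ring.
  exact: KP.
have [L cL LP] := mod1_lift Fm.
have F1z (p : path R x x) : winding (F1 \o l) p = 0.
  rewrite (@windingP _ _ _ x x p (L (l (p 1)) - L (l (p 0)))); first by rewrite path1 path0 subrr.
  exists (fun t => L (l (p t))); split=> //.
    exact: (continuous_compfun cL (continuous_compfun cl (path_cts (p := p)))).
  move=> t; have := LP (l (p t)); rewrite /F asboolT//.
have [psi phiK psiK] := phi_bij.
apply/rowP => j; rewrite mxE; apply: (@intr_inj R).
have := F1v (repr (psi (delta_mx j 0))).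
rewrite F1z pi1_reprK psiK -[_ *m _]/(v *m delta_mx j 0) -colE mxE => <-.
by [].
Qed.

Variables (r : R) (q : 'rV[R]_m).
Hypothesis r0 : 0 < r.
Hypothesis far : forall z, N2 z -> `|z| < r.
Hypothesis N1q : ~ N1 q.
Hypothesis GN : forall z, (N1 z -> N1 (G z)) /\ (N2 z -> N2 (G z)).

Theorem no_irreducible_torus : False.
Proof.
(* Given a nonzero class on [N1], saturation makes a nonzero multiple of any class on [N2] extend to
   [N1] as well, hence vanish. *)
have trivial_or : (forall v, classes N1 v -> v = 0) \/ (forall v, classes N2 v -> v = 0).
  have [|nz] := pselect (forall v, classes N1 v -> v = 0); first by left.
  right=> v v2; move/existsNP: nz => [u /not_implyP[u1 /eqP un0]].
  have [d d0 dv] := irr (classesB lN1) (classesA lN1 (fun z => (GN z).1)) u1 un0 v.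
  have dv2 : classes N2 (d *: v) by apply: subgroup_scale => //; exact: classesB.
  have dv0 : d *: v = 0 := classes_meet dv dv2.
  apply/rowP => j; have := congr1 (fun w : 'rV[int]_n => w 0 j) dv0; rewrite !mxE.
  by move=> /eqP; rewrite mulf_eq0 (negbTE d0) /= => /eqP.
have far1 z : r <= `|z| -> N1 z.
  by move=> zr; case: (cover z) => // /far; rewrite ltNge zr.
have /choice[F12 F12P] (j : 'I_n) : exists F : ('rV[R]_m -> R) * ('rV[R]_m -> R),
    [/\ mod1_on N1 F.1, mod1_on N2 F.2 &
        forall y, F.1 (E y) + F.2 (E y) - y 0 j \is a Num.int].
  have fm := @torus_coordinate_mod1 R n m E cE EP j.
  set f := (X in mod1_on _ X) in fm.
  have fm' : mod1_on (N1 `&` N2) f.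
    suff -> : N1 `&` N2 = range E by [].
    by apply/seteqP; split=> [z []|_ [y _ <-]]; [exact: meet|exact: sub].
  have [F1 [F2 [h1 h2 h]]] := circle_sum clN1 clN2 cover fm' r0 far1 (fun z zN => ltW (far zN)).
  exists (F1, F2); split=> // y /=; have [y1 y2] := sub y.
  have := h (E y) y1 y2; have := torus_coordinateE EP j y; rewrite -/f -/(f (E y)) => a b.
  have -> : F1 (E y) + F2 (E y) - y 0 j = (f (E y) - y 0 j) - (f (E y) - (F1 (E y) + F2 (E y))).
    by ring.
  exact: rpredB.
have perE z w : E (z + int_row w) = E z by exact: torus_map_periodic.
(* On the side [N] without nonzero classes the summand [F] lifts on the torus to a periodic real
   function. Its Tietze extension [Th] is defined everywhere and takes the place of [F] on the other
   side. *)
have trans (N : set 'rV[R]_m) (lN : forall t, N (l t)) (F F' : 'rV[R]_m -> R) (N' : set 'rV[R]_m) j :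
    (forall v, classes N v -> v = 0) -> mod1_on N F -> mod1_on N' F' ->
    (forall y, F (E y) + F' (E y) - y 0 j \is a Num.int) ->
    exists F'' : 'rV[R]_m -> R, mod1_on N' F'' /\ forall y, F'' (E y) - y 0 j \is a Num.int.
  move=> N0 Fm F'm FE; have [v Fv] := class_exists lN Fm.
  have v0 : v = 0 by apply: N0; exists F.
  rewrite v0 in Fv; have [K [cK perK KP]] := class0_lift lN Fm Fv.
  have [Th cTh ThE] := torus_function_extension cE EP cK perK.
  exists (F' \+ Th); split.
    by move=> z zN; apply: mod1D; [exact: F'm|apply: continuous_mod1; exact: cTh].
  move=> y; rewrite /= ThE.
  have -> : F' (E y) + K y - y 0 j = (F (E y) + F' (E y) - y 0 j) + (K y - F (E y)) by ring.
  exact: rpredD.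
case: trivial_or => N0.
  have /choice[F FP] j : exists F : 'rV[R]_m -> R,
      mod1_on N2 F /\ forall y, F (E y) - y 0 j \is a Num.int.
    by have [h1 h2 h] := F12P j; exact: (trans N1 lN1 _ _ N2 j N0 h1 h2 h).
  exact: (no_bounded_retraction cE perE clN1 clN2 cover meet sub far N1q
    (fun j => (FP j).1) (fun j => (FP j).2)).
have /choice[F FP] j : exists F : 'rV[R]_m -> R,
    mod1_on N1 F /\ forall y, F (E y) - y 0 j \is a Num.int.
  have [h1 h2 h] := F12P j; apply: (trans N2 lN2 _ _ N1 j N0 h2 h1) => y.
  by rewrite [X in X - _]addrC; exact: h.
exact: (no_unbounded_retraction cE perE clN1 clN2 cover meet sub r0 far N1q
  (fun j => (FP j).1) (fun j => (FP j).2)).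
Qed.

End NoTorus.

(** * Induced maps on fundamental groups *)

Lemma subspace_map_continuous (X Y : topologicalType) (A : set Y) (f : X -> A) :
  continuous (fun x => val (f x)) -> continuous f.
Proof.
move=> cf; apply/continuousP => _ [V oV <-].
by move/continuousP: cf; exact.
Qed.

Section Transport.
Context {R : realType} {X : topologicalType}.

Lemma homotopic_conjK (x y : X) (c : path R x y) (q : path R x x) :
  homotopic (path_cat (path_cat c (path_cat (path_cat (path_inv c) q) c)) (path_inv c)) q.
Proof.
have hA := homotopic_catA; have hr := @homotopic_refl; have hs := homotopic_sym.
have step1 : homotopic (path_cat c (path_cat (path_cat (path_inv c) q) c)) (path_cat q c).
  apply: homotopic_trans (hA _ _ _ _ _ _ _ _ _) _.
  apply: homotopic_cat; last exact: hr.
  apply: homotopic_trans (hA _ _ _ _ _ _ _ _ _) _.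
  apply: homotopic_trans (homotopic_cat (homotopic_catV c) (hr _ _ _ _ _)) _.
  exact: homotopic_cst_cat.
apply: homotopic_trans (homotopic_cat step1 (hr _ _ _ _ _)) _.
apply: homotopic_trans (hs _ _ _ _ _ _ (hA _ _ _ _ _ _ _ _ _)) _.
apply: homotopic_trans (homotopic_cat (hr _ _ _ _ _) (homotopic_catV c)) _.
exact: homotopic_cat_cst.
Qed.

Lemma homotopic_conj_cst (x y : X) (c : path R x y) (q : path R y y) :
  homotopic q (path_cst y) ->
  homotopic (path_cat (path_cat c q) (path_inv c)) (path_cst x).
Proof.
move=> q1; apply: homotopic_trans (homotopic_catV c).
apply: homotopic_cat; last exact: homotopic_refl.
apply: homotopic_trans (homotopic_cat_cst c).
by apply: homotopic_cat; [exact: homotopic_refl|].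
Qed.

Lemma homotopic_conj_cst_inv (x y : X) (c : path R x y) (q : path R y y) :
  homotopic (path_cat (path_cat c q) (path_inv c)) (path_cst x) ->
  homotopic q (path_cst y).
Proof.
move=> h; have hA := homotopic_catA; have hr := @homotopic_refl; have hs := homotopic_sym.
have h1 : homotopic (path_cat c q) c.
  apply: homotopic_trans (homotopic_cst_cat c).
  apply: homotopic_trans (homotopic_cat h (hr _ _ _ _ c)).
  apply: homotopic_trans (hA _ _ _ _ _ _ _ _ _).
  apply: homotopic_trans (homotopic_cat (hr _ _ _ _ _) (hs _ _ _ _ _ _ (homotopic_catVl c))).
  exact/hs/homotopic_cat_cst.
apply: homotopic_trans (homotopic_catVl c).
apply: homotopic_trans (homotopic_cat (hr _ _ _ _ (path_inv c)) h1).
apply: homotopic_trans (hs _ _ _ _ _ _ (hA _ _ _ _ _ _ _ _ _) : homotopic _ _).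
  apply: hs.
  apply: homotopic_trans (homotopic_cat (homotopic_catVl c) (hr _ _ _ _ _)) _.
  exact: homotopic_cst_cat.
Qed.

End Transport.

Lemma path_map_cat (R : realType) (X Y : topologicalType) (f : continuousType X Y)
    (x y z : X) (p : path R x y) (q : path R y z) :
  homotopic (path_map f (path_cat p q)) (path_cat (path_map f p) (path_map f q)).
Proof. by apply: homotopic_eqfun => t /=; rewrite /path_cat_fun; case: ifP. Qed.

Lemma pi1_map1 (R : realType) (X Y : topologicalType) (f : continuousType X Y) (x : X)
    (p : path R x x) :
  pi1_map f (pi1_class p) = 1%g <-> homotopic (path_map f p) (path_cst (f x)).
Proof. by rewrite pi1_mapE; exact: pi1_classP. Qed.

Section InducedMorphism.
Context {R : realType} {X Y : topologicalType} (f : continuousType X Y) (x : X).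
Implicit Types a : pi1 R x.

Lemma pi1_map_one : pi1_map f (1%g : pi1 R x) = 1%g.
Proof. by apply: (mulgI (pi1_map f (1%g : pi1 R x))); rewrite -pi1_mapM !mulg1. Qed.

Lemma pi1_mapV a : pi1_map f a^-1%g = (pi1_map f a)^-1%g.
Proof. by apply: (mulgI (pi1_map f a)); rewrite -pi1_mapM !mulgV pi1_map_one. Qed.

Lemma pi1_mapX a k : pi1_map f (a ^+ k)%g = (pi1_map f a ^+ k)%g.
Proof. by elim: k => [|k IH]; rewrite ?expg0 ?pi1_map_one// !expgS pi1_mapM IH. Qed.

End InducedMorphism.

Section AnosovAction.
Context {R : realType} {T : topologicalType} {n : nat}.
Variables (gT gTi : continuousType T T).
Hypotheses (gK : cancel gTi gT) (gK' : cancel gT gTi).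
Variables (x : T) (c : path R x (gT x)) (phi : pi1 R x -> 'cV[int]_n) (A : 'M[int]_n).
Hypothesis phi_bij : bijective phi.
Hypothesis phiA : forall p : path R x x,
  phi (pi1_class (path_cat (path_cat c (path_map gT p)) (path_inv c))) = A *m phi (pi1_class p).

(** Applying the inverse map to a loop transported along [c] yields a preimage of its class, so [A]
    is onto over the integers, hence unimodular. *)
Lemma homeo_action_unit : A \in unitmx.
Proof.
have [psi phiK psiK] := phi_bij.
have surj (u : 'cV[int]_n) : exists w : 'cV[int]_n, A *m w = u.
  pose q := repr (psi u); pose q' := path_cat (path_cat (path_inv c) q) c.
  have cq : continuous (gTi \o q').
    by apply: (continuous_compfun (@cts_fun _ _ gTi)); exact: path_cts.
  have q0 t : t <= 0 -> (gTi \o q') t = x by move=> t0; rewrite -[LHS]/(gTi (q' t)) path_le0.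
  have q1 t : 1 <= t -> (gTi \o q') t = x by move=> t0; rewrite -[LHS]/(gTi (q' t)) path_ge1.
  pose p := Path cq q0 q1.
  exists (phi (pi1_class p)); rewrite -phiA -[u]psiK -[psi u]pi1_reprK; congr phi.
  apply/pi1_classP; apply: homotopic_trans (homotopic_conjK c q).
  apply: homotopic_cat; last exact: homotopic_refl.
  apply: homotopic_cat; first exact: homotopic_refl.
  by apply: homotopic_eqfun => t /=; rewrite gK.
have /choice[b bP] (j : 'I_n) : exists w : 'cV[int]_n, A *m w = delta_mx j 0 by exact: surj.
have : A *m (\matrix_(i, j) b j i 0) = 1%:M.
  apply/matrixP => i j; have := congr1 (fun w : 'cV[int]_n => w i 0) (bP j).
  rewrite !mxE eqxx andbT => <-; apply: eq_bigr => k' _; congr (_ * _).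
  by rewrite mxE.
by case/mulmx1_unit.
Qed.

End AnosovAction.

(** * Compressible tori *)

Theorem no_irreducible_hypersurface (R : realType) (n : nat) (T : topologicalType) :
  (2 <= n)%N ->
  forall (e : 'rV[R]_n -> T) (l : T -> 'rV[R]_n.+1) (E : 'rV[R]_n -> 'rV[R]_n.+1)
    (G H : 'rV[R]_n.+1 -> 'rV[R]_n.+1) (gT : continuousType T T)
    (y0 : 'rV[R]_n) (x : T) (c : path R x (gT x)) (phi : pi1 R x -> 'cV[int]_n) (A : 'M[int]_n),
  continuous e -> continuous l -> (forall y, l (e y) = E y) -> (forall t, range E (l t)) ->
  (forall y z, e (y + int_row z) = e y) ->
  (forall y y', E y = E y' <-> exists z, y' = y + int_row z) ->
  (forall y, flat_at (range E) (E y)) ->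
  continuous G -> continuous H -> cancel G H -> cancel H G ->
  (forall z, range E (G z) <-> range E z) -> (forall t, G (l t) = l (gT t)) ->
  e y0 = x -> bijective phi -> {morph phi : a b / (a * b)%g >-> a + b} ->
  (forall p : path R x x, phi (pi1_class (path_cat (path_cat c (path_map gT p)) (path_inv c))) =
     A *m phi (pi1_class p)) ->
  irreducible_poly (map_poly intr (char_poly A) : {poly rat}) -> False.
Proof.
case: n => [|[|k]] // _ e l E G H gT y0 x c phi A ce cl leE lT eP EP flat cG cH GK HK GT Gl xE.
move=> phi_bij phiM phiA irr.
have cE : continuous E.
  have -> : E = l \o e by apply/funext => y; rewrite /= leE.
  exact: continuous_compfun.
have clT : closed (range E).
  by apply: compact_closed; [exact: norm_hausdorff|exact: torus_image_compact].
have two y : range E y -> two_sided_at (range E) y.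
  by move=> [u _ <-]; exact: flat_two_sided.
have side := separation clT two.
have [N1 [N2 [r [q [[c1 c2] [cover [meet sub]] [r0 far] N1q GN]]]]] :=
  torus_sides cE EP side two cG cH GK HK GT.
exact: (no_irreducible_torus ce cl leE lT eP EP cG Gl xE phi_bij phiM phiA
  (irreducible_saturation irr) c1 c2 cover meet sub r0 far N1q GN).
Qed.

Lemma normed_path (R : realType) (V : normedModType R) (u v : V) : inhabited (path R u v).
Proof.
pose f (t : R) := u + clamp t *: (v - u).
have cf : continuous f.
  by move=> t; exact: (cvgD (cvg_cst _) (cvgZr_tmp (@clamp_continuous R t))).
have f0 t : t <= 0 -> f t = u by move=> t0; rewrite /f clamp_le0// scale0r addr0.
have f1 t : 1 <= t -> f t = v.
  by move=> t1; rewrite /f clamp_ge1// scale1r addrC subrK.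
by constructor; exact: (Path cf f0 f1).
Qed.

Section Compressible.
Context {R : realType} {n : nat} {M : manifold R n.+1}.
Variables (p : euclidean R n.+1 -> M) (T : set M) (e : 'rV[R]_n -> M).
Hypothesis ucov : universal_covering p.
Hypothesis tfree : forall x : M, torsion_free (pi1 R x).
Hypotheses (emb : torus_embedding e) (eT : range e = T).
Variables (g h : M -> M) (gT : continuousType T T).
Hypotheses (cg : continuous g) (ch : continuous h) (gK : cancel g h) (hK : cancel h g).
Hypotheses (gTT : g @` T = T) (gTE : forall x : T, val (gT x) = g (val x)).
Variables (x : T) (c : path R x (gT x)) (phi : pi1 R x -> 'cV[int]_n) (A : 'M[int]_n).
Hypothesis phi_bij : bijective phi.
Hypothesis phiM : {morph phi : a b / (a * b)%g >-> a + b}.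
Hypothesis phiA : forall p : path R x x,
  phi (pi1_class (path_cat (path_cat c (path_map gT p)) (path_inv c))) = A *m phi (pi1_class p).
Hypothesis hyp : hyperbolic A.
Hypothesis irr : irreducible_poly (map_poly intr (char_poly A) : {poly rat}).

Local Notation incl := (@set_incl M T).

Let ce : continuous e. Proof. exact: torus_embedding_continuous. Qed.

Lemma torus_point (t : T) : exists y, e y = val t.
Proof.
have rT u : T u -> range e u by rewrite eT.
by have [y _ <-] := rT _ (set_mem (valP t)); exists y.
Qed.

Definition torus_param (y : 'rV[R]_n) : T :=
  exist _ (e y) (mem_set (eq_ind (range e) (fun S => S (e y)) (imageT e y) T eT)).

Lemma torus_param_continuous : continuous torus_param.
Proof. exact: subspace_map_continuous. Qed.

Lemma torus_param_surj t : exists y, torus_param y = t.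
Proof. by have [y yt] := torus_point t; exists y; apply: val_inj. Qed.

Lemma torus_param_periodic y z : torus_param (y + int_row z) = torus_param y.
Proof. by apply: val_inj => /=; apply/esym; case: emb => _ ->; exists z. Qed.

Lemma torus_path (t t' : T) : inhabited (path R t t').
Proof.
have [y yt] := torus_param_surj t; have [y' yt'] := torus_param_surj t'.
have [q] := normed_path y y'.
have cq : continuous (torus_param \o q).
  by apply: (continuous_compfun torus_param_continuous); exact: path_cts.
have q0 s : s <= 0 -> (torus_param \o q) s = t by move=> s0; rewrite /= path_le0.
have q1 s : 1 <= s -> (torus_param \o q) s = t' by move=> s0; rewrite /= path_ge1.
by constructor; exact: (Path cq q0 q1).
Qed.

Lemma homeo_torus_inverse : exists gTi : continuousType T T, cancel gTi gT /\ cancel gT gTi.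
Proof.
have hT (t : T) : h (val t) \in T.
  have rT u : T u -> (g @` T) u by rewrite gTT.
  by have [y Ty <-] := rT _ (set_mem (valP t)); apply: mem_set; rewrite gK.
pose f (t : T) : T := exist _ (h (val t)) (hT t).
have cf : continuous f.
  apply: subspace_map_continuous; apply: (continuous_compfun ch).
  exact: (@set_incl_continuous M T).
pose fc : continuousType T T := HB.pack f (isContinuous.Build T T f cf).
exists fc; split=> t; apply: val_inj; first by rewrite gTE /= hK.
by rewrite /= gTE gK.
Qed.

(** For [n] equal to 0 the characteristic polynomial is constant, hence not irreducible; a
    unimodular matrix of size 1 is 1 or -1, hence not hyperbolic. *)
Lemma dimension_ge2 : (2 <= n)%N.
Proof.
have uA : A \in unitmx.
  have [gTi [K1 K2]] := homeo_torus_inverse.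
  exact: (homeo_action_unit K1 K2 phi_bij phiA).
have sz : size (char_poly A) = n.+1 by exact: size_char_poly.
case: n A uA hyp irr sz => [|[|//]] B uB hB iB sB.
  by case: iB; rewrite size_map_inj_poly ?sB//; exact: intr_inj.
pose b := B 0 0.
have bB : B = b%:M by apply/matrixP => i j; rewrite !ord1 !mxE.
have detB : \det B = b by rewrite bB det_scalar1.
have bn : `|b| = 1.
  have : b \is a GRing.unit by rewrite -detB -unitmxE.
  by move=> /orP[] /eqP ->.
suff : `|(b%:~R : algC)| != 1 by rewrite -intr_norm bn eqxx.
apply: hB; apply/eigenvalueP; exists (const_mx 1).
  rewrite bB; apply/rowP => j; rewrite !mxE big_ord1 !mxE !ord1 /=.
  by rewrite mulr1 mul1r.
by apply/eqP => /rowP/(_ 0)/eqP; rewrite !mxE oner_eq0.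
Qed.

Let null (t : T) (q : path R t t) := homotopic (path_map incl q) (path_cst (incl t)).

Lemma kernel_subgroup (a b : pi1 R x) : pi1_map incl a = 1%g -> pi1_map incl b = 1%g ->
  pi1_map incl (a * b^-1)%g = 1%g.
Proof. by move=> a1 b1; rewrite pi1_mapM pi1_mapV a1 b1 mul1g invg1. Qed.

Lemma kernel_invariant (q : path R x x) : null q ->
  null (path_cat (path_cat c (path_map gT q)) (path_inv c)).
Proof.
move=> [K [cK K0 K1 Kx Ky]].
have gq : null (path_map gT q).
  exists (g \o K); split.
  - exact: (continuous_compfun cg cK).
  - by move=> t; rewrite /= K0; exact/esym/gTE.
  - by move=> t; rewrite /= K1; exact/esym/gTE.
  - by move=> s t t0; rewrite /= Kx//; exact/esym/gTE.
  - by move=> s t t0; rewrite /= Ky//; exact/esym/gTE.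
apply: homotopic_trans (path_map_cat _ _ _) _.
apply: homotopic_trans (homotopic_cat (path_map_cat _ _ _) (homotopic_refl _)) _.
exact: (homotopic_conj_cst (path_map incl c) gq).
Qed.

(** Compressibility may be witnessed at another base point; conjugation by a path in the torus moves
    the kernel element to [x]. *)
Lemma compressible_kernel : ~ incompressible R T -> exists2 a : pi1 R x,
  pi1_map incl a = 1%g & a <> 1%g.
Proof.
move=> /existsNP[t ninj].
have [a [b [ab nab]]] : exists a b : pi1 R t, pi1_map incl a = pi1_map incl b /\ a <> b.
  apply: contrapT => hn; apply: ninj => a b ab; apply: contrapT => nab.
  by apply: hn; exists a, b.
pose d := (a * b^-1)%g.
have d1 : pi1_map incl d = 1%g by rewrite pi1_mapM pi1_mapV ab mulgV.
have dn1 : d <> 1%g.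
  move=> d1'; apply: nab; have -> : a = (d * b)%g by rewrite /d -mulgA mulVg mulg1.
  by rewrite d1' mul1g.
pose q := repr d; have [s] := torus_path x t.
have nq : null q by apply/pi1_map1; rewrite pi1_reprK.
exists (pi1_class (path_cat (path_cat s q) (path_inv s))).
  apply/pi1_map1.
  apply: homotopic_trans (path_map_cat _ _ _) _.
  apply: homotopic_trans (homotopic_cat (path_map_cat _ _ _) (homotopic_refl _)) _.
  exact: (homotopic_conj_cst (path_map incl s) nq).
move=> /pi1_classP h1; apply: dn1; rewrite -[d]pi1_reprK; apply/pi1_classP.
exact: homotopic_conj_cst_inv h1.
Qed.

(* The kernel is invariant under [A]; torsion-freeness of [pi_1 M] makes it
   saturated, so irreducibility leaves no proper nonzero choice. *)
Lemma all_null : ~ incompressible R T -> forall q : path R x x, null q.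
Proof.
move=> /compressible_kernel[a a1 an1].
have [psi phiK psiK] := phi_bij.
have phi1 : phi 1%g = 0 by apply: (addIr (phi 1%g)); rewrite -phiM mulg1 add0r.
have phiV b : phi b^-1%g = - phi b.
  by apply: (addIr (phi b)); rewrite -phiM mulVg phi1 addNr.
have phiX b i : phi (b ^+ i)%g = phi b *+ i.
  by elim: i => [|i IH]; rewrite ?expg0 ?phi1// expgS phiM IH mulrS.
(* [irreducible_saturation] is about rows with the matrix on the right, hence the transposes. *)
pose V : set 'rV[int]_n := [set v | pi1_map incl (psi v^T) = 1%g].
have psiB u v : psi (u - v) = (psi u * (psi v)^-1)%g.
  by apply: (can_inj phiK); rewrite psiK phiM phiV !psiK.
have VB u v : V u -> V v -> V (u - v).
  by rewrite /V /= linearB /= psiB; exact: kernel_subgroup.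
have VA v : V v -> V (v *m A^T).
  rewrite /V /= trmx_mul trmxK => v1.
  pose q := repr (psi v^T).
  have -> : v^T = phi (pi1_class q) by rewrite pi1_reprK psiK.
  rewrite -phiA phiK; apply/pi1_map1.
  by apply: kernel_invariant; apply/pi1_map1; rewrite pi1_reprK.
have irrT : irreducible_poly (map_poly intr (char_poly A^T) : {poly rat}).
  suff -> : char_poly A^T = char_poly A by [].
  rewrite /char_poly -[RHS]det_tr; congr (\det _).
  by rewrite /char_poly_mx linearB /= tr_scalar_mx map_trmx.
have Va : V (phi a)^T by rewrite /V /= trmxK phiK.
have an0 : (phi a)^T != 0.
  apply/eqP => a0; apply: an1; apply: (can_inj phiK).
  by rewrite phi1 -[phi a]trmxK a0 trmx0.
move=> q; apply/pi1_map1; set b := pi1_class q.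
have [d d0 Vd] := irreducible_saturation irrT VB VA Va an0 (phi b)^T.
have Vd' : V (`|d|%:Z *: (phi b)^T).
  have V0 : V 0 by rewrite -(subrr (phi a)^T); exact: VB.
  have [->//|->] : `|d|%:Z = d \/ `|d|%:Z = - d by lia.
  by rewrite scaleNr -[X in V X]add0r; exact: VB.
apply: (tfree (k := `|d|%N)); first by rewrite absz_gt0.
rewrite -pi1_mapX; move: Vd'; rewrite /V /= linearZ /= trmxK.
suff -> : psi (`|d|%:Z *: phi b) = (b ^+ `|d|)%g by [].
by apply: (can_inj phiK); rewrite psiK phiX -scaler_nat natz.
Qed.

Theorem anosov_incompressible : incompressible R T.
Proof.
apply: contrapT => comp; have nullq := all_null comp.
have [scov _] := ucov; have [_ psurj _] := scov.
have tcov := smooth_covering_topological scov.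
have cp := tcov.1.
have [y0 y0x] := torus_param_surj x.
have [w0 _ pw0] := psurj (e y0) I.
have [E [cE pE E0]] := @lift_map R _ _ p tcov 'rV[R]_n e y0 w0 ce pw0.
have eE y z : e (y + int_row z) = e y := congr1 val (torus_param_periodic y z).
(* The segment from [y0] to its translate is a loop in the torus, null-homotopic in [M], so its lift
   closes up. Uniqueness of lifts carries this from [y0] to [y]. *)
have Eper y z : E (y + int_row z) = E y.
  have [s] := normed_path y0 y.
  have cs : continuous (fun u : 'rV[R]_n => u + int_row z).
    by move=> u; exact: cvgD cvg_id (cvg_cst _).
  refine (@lift_unique R (euclidean R n.+1) M p tcov 'rV[R]_n
    (fun u => E (u + int_row z)) (E) (y0) y _ _ _ _ s) => //.
  - exact: (continuous_compfun cE cs).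
  - by move=> u; rewrite !pE eE.
  pose line (t : R) : 'rV[R]_n := y0 + clamp t *: int_row z.
  have cline : continuous line.
    by move=> t; exact: (cvgD (cvg_cst _) (cvgZr_tmp (@clamp_continuous R t))).
  have p0 t : t <= 0 -> (torus_param \o line) t = x.
    by move=> t0; rewrite /= /line clamp_le0// scale0r addr0.
  have p1 t : 1 <= t -> (torus_param \o line) t = x.
    by move=> t1; rewrite /= /line clamp_ge1// scale1r torus_param_periodic.
  pose q := Path (continuous_compfun torus_param_continuous cline) p0 p1.
  have := @homotopic_lift R _ _ p tcov _ _ _ _ (E \o line) (fun=> E y0) (nullq q).
  have l0 : line 0 = y0 by rewrite /line clamp_le0// scale0r addr0.
  have l1 : line 1 = y0 + int_row z by rewrite /line clamp_ge1// scale1r.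
  rewrite /= l0 l1; apply.
  - exact: (continuous_compfun cE cline).
  - exact: cst_continuous.
  - by move=> t; rewrite pE.
  - by move=> t; rewrite pE -y0x.
  - by [].
have EP y y' : E y = E y' <-> exists z, y' = y + int_row z.
  split=> [yy'|[z ->]]; last by rewrite Eper.
  by case: emb => _ /(_ y y')[+ _]; apply; rewrite -!pE yy'.
have /choice[pre preP] (t : T) : exists y, torus_param y = t := torus_param_surj t.
pose l (t : T) : 'rV[R]_n.+1 := E (pre t).
have lE y : l (torus_param y) = E y.
  have : e (pre (torus_param y)) = e y := congr1 val (preP (torus_param y)).
  by case: emb => _ ee /ee[z yz]; rewrite /l [in RHS]yz Eper.
have cl : continuous l.
  apply: (torus_quotient (@manifold_hausdorff _ _ M) ce eE eT cE) => t y ty.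
  by rewrite -lE; congr l; apply: val_inj.
have pl t : p (l t) = val t by rewrite /l pE -[in RHS](preP t).
have cgp : continuous (g \o p) by exact: continuous_compfun.
have chp : continuous (h \o p) by exact: continuous_compfun.
have e0x : e y0 = val x by rewrite -y0x.
have G0 : p (l (gT x)) = (g \o p) (E y0) by rewrite pl gTE /= pE e0x.
(* Among the lifts of [g], this initial value selects one that maps the lifted torus to itself
   rather than to another lift. *)
have [G [cG pG GE0]] := @lift_map R _ _ p tcov 'rV[R]_n.+1 (g \o p) (E y0) (l (gT x)) cgp G0.
have H0 : p (E y0) = (h \o p) (G (E y0)) by rewrite /= pG /= gK.
have [H [cH pH HE0]] := @lift_map R _ _ p tcov 'rV[R]_n.+1 (h \o p) (G (E y0)) (E y0) chp H0.
have idV : continuous (fun z : 'rV[R]_n.+1 => z) by move=> z; exact: cvg_id.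
have GK : cancel G H.
  move=> z; have [s] := normed_path (E y0) z.
  refine (@lift_unique R (euclidean R n.+1) M p tcov 'rV[R]_n.+1
    (H \o G) (id) (E y0) z _ _ _ _ s) => //.
  - exact: continuous_compfun.
  - by move=> u; rewrite /= pH /= pG /= gK.
have HK : cancel H G.
  move=> z; have [s] := normed_path (G (E y0)) z.
  refine (@lift_unique R (euclidean R n.+1) M p tcov 'rV[R]_n.+1
    (G \o H) (id) (G (E y0)) z _ _ _ _ s) => //.
  - exact: continuous_compfun.
  - by move=> u; rewrite /= pG /= pH /= hK.
  - by rewrite /= HE0.
have Gl t : G (l t) = l (gT t).
  rewrite -(preP t) lE; have [s] := normed_path y0 (pre t).
  refine (@lift_unique R (euclidean R n.+1) M p tcov 'rV[R]_n
    (G \o E) (l \o gT \o torus_param) (y0) (pre t) _ _ _ _ s) => //.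
  - exact: continuous_compfun.
  - apply: (continuous_compfun cl); apply: (continuous_compfun (@cts_fun _ _ gT)).
    exact: torus_param_continuous.
  - by move=> u; rewrite /= pG /= pE pl gTE.
  - by rewrite /= GE0 y0x.
have lT t : range E (l t) by exists (pre t).
have GT z : range E (G z) <-> range E z.
  split=> [[y _ yz]|[y _ <-]]; last by rewrite -lE Gl.
  have rT u : T u -> (g @` T) u by rewrite gTT.
  have [u Tu ut] := rT _ (set_mem (valP (torus_param y))).
  pose t : T := exist _ u (mem_set Tu).
  have tE : gT t = torus_param y by apply: val_inj; rewrite gTE.
  by rewrite -[z]GK -yz -lE -tE -Gl GK.
exact: (no_irreducible_hypersurface dimension_ge2 torus_param_continuous cl lE lT
  torus_param_periodic EP (lifted_torus_flat scov emb cE pE EP) cG cH GK HK GT Gl y0x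
  phi_bij phiM phiA irr).
Qed.

End Compressible.

(** * Codimension one *)

Section Kronecker.
Variable C : numClosedFieldType.

Lemma coef_prod_XsubC_bound (s : seq C) j : (forall z, z \in s -> `|z| <= 1) ->
  `|(\prod_(z <- s) ('X - z%:P))`_j| <= 2 ^+ size s.
Proof.
elim: s j => [|w s IH] j h /=.
  by rewrite big_nil coef1 expr0; case: j => [|j]; rewrite ?normr1 ?normr0 ?ler01.
have IHs i := IH i (fun z zs => h z (mem_behead (s := w :: s) zs)).
rewrite big_cons mulrBl coefB coefXM coefCM exprS mulr_natl mulr2n.
apply: le_trans (ler_normB _ _) _; apply: lerD.
  case: eqP => _; first by rewrite normr0 exprn_ge0.
  exact (IHs j.-1).
rewrite normrM -[leRHS]mul1r; apply: ler_pM => //.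
by apply: h; rewrite mem_head.
Qed.

(** Splitting X^(k+1) - mu into linear factors shows that [mu] is a power of an eigenvalue of
    [A]. *)
Lemma eigenvalue_power_unit (d : nat) (A : 'M[C]_d.+1) (k : nat) (mu : C) :
  (forall w, eigenvalue A w -> `|w| = 1) -> eigenvalue (A ^+ k.+1) mu -> `|mu| = 1.
Proof.
move=> A1 /eigenvalueP[v vA v0].
have [s sE] := closed_field_poly_normal ('X^(k.+1) - mu%:P).
rewrite (monicP (monicXnsubC _ _)) ?scale1r// in sE.
have : \det (\prod_(z <- s) (A - z%:M)) == 0.
  have -> : \prod_(z <- s) (A - z%:M) = A ^+ k.+1 - mu%:M.
    have := congr1 (horner_mx A) sE; rewrite rmorphB rmorphXn /= horner_mx_X horner_mx_C => ->.
    rewrite rmorph_prod; apply: eq_bigr => z _.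
    by rewrite rmorphB /= horner_mx_X horner_mx_C.
  by apply/det0P; exists v => //; rewrite mulmxBr vA mul_mx_scalar subrr.
rewrite (big_morph _ (@det_mulmx _ _) (det1 _ _)).
rewrite prodf_seq_eq0 => /hasP[z zs /= /det0P[w w0 wA]].
have z1 : `|z| = 1.
  apply: A1; apply/eigenvalueP; exists w => //.
  by apply/eqP; rewrite -subr_eq0 -mul_mx_scalar -mulmxBr wA.
have : root ('X^(k.+1) - mu%:P) z by rewrite sE root_prod_XsubC.
by rewrite rootE !hornerE subr_eq0 => /eqP <-; rewrite normrX z1 expr1n.
Qed.

(** The characteristic polynomials of the powers of [A] have integer coefficients bounded
    independently of the power, so they are finitely many. All powers of [z] are among their roots,
    and two of these powers coincide. *)
Theorem kronecker (d : nat) (A : 'M[int]_d.+1) (z : C) :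
  (forall w : C, eigenvalue (map_mx intr A) w -> `|w| = 1) ->
  eigenvalue (map_mx intr A) z -> exists2 N, (0 < N)%N & z ^+ N = 1.
Proof.
set Ac : 'M[C]_d.+1 := map_mx intr A => A1 zA.
pose f k := char_poly (A ^+ k.+1).
have fE k : map_poly intr (f k) = char_poly (Ac ^+ k.+1).
  by rewrite map_char_poly rmorphXn.
have froot k : root (map_poly intr (f k)) (z ^+ k.+1).
  rewrite fE -eigenvalue_root_char; have /eigenvalueP[v vA v0] := zA.
  apply/eigenvalueP; exists v => //; elim: k.+1 => [|i IH].
    by rewrite !expr0 mulmx1 scale1r.
  by rewrite exprSr -mulmxE mulmxA IH -scalemxAl vA scalerA exprSr.
pose B := (2 ^ d.+1)%N.
have fB k i : `|(f k)`_i| <= B%:Z.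
  have [s sE] := closed_field_poly_normal (map_poly intr (f k) : {poly C}).
  have mon : map_poly intr (f k) \is @monic C by rewrite fE char_poly_monic.
  rewrite (monicP mon) scale1r in sE.
  have ss : size s = d.+1.
    by have := congr1 (fun q : {poly C} => size q) sE; rewrite fE size_char_poly size_prod_XsubC => -[].
  have s1 w : w \in s -> `|w| <= 1.
    move=> ws; rewrite (@eigenvalue_power_unit d Ac k)//.
    by rewrite eigenvalue_root_char -fE sE root_prod_XsubC.
  have := coef_prod_XsubC_bound i s1; rewrite -sE coef_map /= ss -intr_norm.
  have -> : 2 ^+ d.+1 = (B%:Z)%:~R :> C by rewrite /B -natrX.
  by rewrite ler_int.
pose P (g : {ffun 'I_d.+2 -> 'I_(2 * B).+1}) : {poly int} :=
  \poly_(i < d.+2) ((g (inord i) : nat)%:Z - B%:Z).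
have fP k : exists g, f k = P g.
  have bound (a : int) : `|a| <= B%:Z -> (absz (a + B%:Z)%R < (2 * B).+1)%N /\
      a = (absz (a + B%:Z)%R)%:Z - B%:Z by lia.
  have le2B (i : 'I_d.+2) : (absz ((f k)`_i + B%:Z)%R < (2 * B).+1)%N.
    exact: (bound _ (fB k i)).1.
  exists [ffun i => Ordinal (le2B i)]; apply/polyP => i; rewrite coef_poly.
  case: ltnP => [id|id]; last by rewrite nth_default// size_char_poly.
  by rewrite ffunE /= inordK//; exact: (bound _ (fB k i)).2.
pose Q : {poly C} := \prod_(g | P g != 0) map_poly intr (P g).
have Q0 : Q != 0.
  by apply/prodf_neq0 => g g0; rewrite map_poly_eq0_id0// intr_eq0 lead_coef_eq0.
have Qroot k : root Q (z ^+ k.+1).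
  have [g gE] := fP k; rewrite /Q (bigD1 g) /=; last first.
    by rewrite -gE monic_neq0// char_poly_monic.
  by rewrite rootM -gE froot.
(* One more power than [Q] can have distinct roots. *)
pose rs := [seq z ^+ k.+1 | k <- iota 0 (size Q)].
have : ~~ uniq rs.
  apply/negP => urs; have := max_poly_roots Q0 _ urs.
  rewrite size_map size_iota ltnn => h; have : false; last by [].
  by apply: h; apply/allP => _ /mapP[k _ ->].
move=> /(uniqPn 0)[i [j [ij]]]; rewrite size_map size_iota => jQ.
rewrite !(nth_map 0%N) ?size_iota ?(ltn_trans ij)// !nth_iota ?(ltn_trans ij)// !add0n => zij.
have z0 : z != 0 by rewrite -normr_gt0 A1// ltr01.
exists (j - i)%N; first by rewrite subn_gt0.
apply: (mulfI (expf_neq0 i.+1 z0)); rewrite mulr1 -exprD zij; congr (_ ^+ _); lia.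
Qed.

End Kronecker.

(** Hyperbolicity is stated over [algC]. A common root with X^N - 1 means that two rational
    polynomials are not coprime, which does not depend on the field, so they have a common root in
    [algC] too. *)
Lemma hyperbolic_no_unity_root (C : numClosedFieldType) (n : nat) (A : 'M[int]_n) (z : C) N :
  hyperbolic A -> root (map_poly intr (char_poly A)) z -> (0 < N)%N -> z ^+ N != 1.
Proof.
move=> hA zA N0; apply/eqP => zN.
pose chi : {poly rat} := map_poly intr (char_poly A); pose u : {poly rat} := 'X^N - 1%:P.
have chiE (F : numFieldType) : map_poly intr (char_poly A) = map_poly ratr chi :> {poly F}.
  by rewrite /chi -map_poly_comp; apply: eq_map_poly => a; rewrite /= ratr_int.
have uE (F : numFieldType) : 'X^N - 1%:P = map_poly ratr u :> {poly F}.
  by rewrite /u rmorphB /= map_polyXn !polyC1 rmorph1.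
have ncop : ~~ coprimep chi u.
  rewrite -(coprimep_map (ratr : {rmorphism rat -> C})) -uE -chiE.
  apply/negP => /coprimep_root/(_ zA); rewrite !hornerE zN subrr.
  by rewrite eqxx.
have : ~~ coprimep (map_poly intr (char_poly A) : {poly algC}) ('X^N - 1%:P).
  by rewrite chiE uE coprimep_map.
move=> /closed_rootP[w]; rewrite root_gcd => /andP[wA].
rewrite rootE !hornerE subr_eq0 => /eqP wN.
have /hA : eigenvalue (map_mx intr A) w by rewrite eigenvalue_root_char -map_char_poly.
by rewrite -(@pexpr_eq1 _ _ N)// -normrX wN normr1 eqxx.
Qed.

Lemma prod_norm1 (F : numFieldType) (s : seq F) :
  \prod_(z <- s) `|z| = 1 ->
  (forall z, z \in s -> 1 <= `|z|) \/ (forall z, z \in s -> `|z| <= 1) ->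
  forall z, z \in s -> `|z| = 1.
Proof.
move=> s1 h z zs; have zr := zs; rewrite (big_rem z)//= in s1.
have nz w : w \in rem z s -> w \in s by exact: mem_rem.
apply/eqP; rewrite eq_le; case: h => h; rewrite h// ?andbT -s1.
  rewrite ler_peMr// big_seq; elim/big_ind: _ => //; first exact: mulr_ege1.
  by move=> w /nz; exact: h.
rewrite ler_piMr// big_seq.
have : 0 <= \prod_(i <- rem z s | i \in rem z s) `|i| <= (1 : F).
  elim/big_ind: _ => [|a b /andP[a0 a1] /andP[b0 b1]|w /nz ws]; first by rewrite ler01 lexx.
    by rewrite mulr_ge0//= mulr_ile1.
  by rewrite normr_ge0 h.
by case/andP.
Qed.

(* If all roots lay on the unit circle, they would be roots of unity by
   Kronecker's theorem, which hyperbolicity excludes. *)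
Lemma unimodular_factor_roots (C : numClosedFieldType) (n : nat) (A : 'M[int]_n)
    (p r : {poly int}) :
  hyperbolic A -> char_poly A = p * r -> p \is monic -> (1 < size p)%N -> `|p`_0| = 1 ->
  (exists2 z : C, root (map_poly intr p) z & `|z| < 1) /\
  (exists2 z : C, root (map_poly intr p) z & 1 < `|z|).
Proof.
move=> hA AE pm sp p0.
have sizeC : size (map_poly intr p : {poly C}) = size p.
  by rewrite size_map_inj_poly//; exact: intr_inj.
have [s sE] := closed_field_poly_normal (map_poly intr p : {poly C}).
have mon : map_poly intr p \is @monic C by exact: monic_map.
rewrite (monicP mon) scale1r in sE.
have rootE z : root (map_poly intr p) z = (z \in s) by rewrite sE root_prod_XsubC.
have s1 : \prod_(z <- s) `|z| = 1.
  have : (map_poly intr p : {poly C}).[0] = (p`_0)%:~R by rewrite horner_coef0 coef_map.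
  rewrite sE horner_prod => /(congr1 (fun z : C => `|z|)).
  rewrite -intr_norm p0 mulr1z normr_prod => sE0; rewrite -[RHS]sE0.
  by apply: eq_bigr => z _; rewrite !hornerE normrN.
have [z0 z0s] : exists z0, z0 \in s.
  have : size s = (size p).-1.
    by rewrite -sizeC sE size_prod_XsubC.
  case: (s) => [|z0 s'] /= ss; last by exists z0; rewrite mem_head.
  by move: sp ss; case: (size p) => [|[|]].
have nall : ~ (forall z, z \in s -> `|z| = 1).
  move=> all1.
  (* The companion matrix brings [p] into the form that [kronecker] treats. *)
  have [d [B BE]] : exists d (B : 'M[int]_d), char_poly B = p.
    by exists _, (companionmx p); exact: companionmxK.
  case: d B BE => [|d] B BE.
    by move: sp; rewrite -BE size_char_poly.
  have eigE w : eigenvalue (map_mx intr B : 'M[C]_d.+1) w = (w \in s).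
    by rewrite eigenvalue_root_char -map_char_poly BE rootE.
  have [|N N0 zN] := @kronecker C d B z0 _ (etrans (eigE z0) z0s).
    by move=> w; rewrite eigE; exact: all1.
  have := @hyperbolic_no_unity_root C n A z0 N hA _ N0.
  by rewrite AE rmorphM rootM rootE z0s => /(_ isT); rewrite zN eqxx.
have side (P : C -> bool) : (forall z, P z = (`|z| < 1)) \/ (forall z, P z = (1 < `|z|)) ->
    exists2 z, root (map_poly intr p) z & P z.
  move=> hP; apply: contrapT => np; apply: nall; apply: prod_norm1 => //.
  have nP z : z \in s -> ~~ P z.
    by move=> zs; apply/negP => Pz; apply: np; exists z; rewrite ?rootE.
  case: hP => hP; [left|right] => z /nP; rewrite hP.
    by rewrite -real_leNgt ?normr_real ?real1.
  by rewrite -real_leNgt ?normr_real ?real1.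
split.
  by apply: (side (fun z => `|z| < 1)); left.
by apply: (side (fun z => 1 < `|z|)); right.
Qed.

(** * Two roots on the same side of the unit circle *)

Lemma char_poly_conj (F : fieldType) (n : nat) (P W : 'M[F]_n) : P \in unitmx ->
  char_poly (P *m W *m invmx P) = char_poly W.
Proof.
move=> uP; rewrite /char_poly.
have -> : char_poly_mx (P *m W *m invmx P) =
    map_mx polyC P *m char_poly_mx W *m map_mx polyC (invmx P).
  rewrite /char_poly_mx mulmxBr mulmxBl -!map_mxM; congr (_ - _).
  by rewrite scalar_mxC -mulmxA -map_mxM mulmxV// map_mx1 mulmx1.
by rewrite !det_mulmx mulrAC -det_mulmx -map_mxM mulmxV// map_mx1 det1 mul1r.
Qed.

(** Modulo an eigenvector for [l], the second factor gives an eigenvalue of the remaining block. The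
    entry [c] allows for a Jordan block, since [l] and [m] may coincide. *)
Lemma triangular_pair (F : fieldType) (n : nat) (W : 'M[F]_n) (l m : F) :
  ('X - l%:P) * ('X - m%:P) %| char_poly W ->
  exists (u1 u2 : 'rV[F]_n) (c : F),
    [/\ u1 *m W = l *: u1, u2 *m W = m *: u2 + c *: u1 &
        forall a b, a *: u1 + b *: u2 = 0 -> a = 0 /\ b = 0].
Proof.
case: n W => [|n] W dv.
  have := dvdp_leq (monic_neq0 (char_poly_monic W)) dv.
  by rewrite size_char_poly size_mul ?polyXsubC_eq0// !size_XsubC.
move: W dv; rewrite -[n.+1]/(1 + n)%N => W dv.
have /eigenvalueP[w wW w0] : eigenvalue W l.
  by rewrite eigenvalue_root_char -dvdp_XsubCl (dvdp_trans (dvdp_mulIl _ _) dv).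
(* Up to a nonzero scalar [w] is the first row of [P], so that [W] becomes block triangular in the
   basis formed by the rows of [P]. *)
pose P := row_ebase w; have uP : P \in unitmx := row_ebase_unit w.
pose e : 'rV[F]_(1 + n) := pid_mx 1.
have wE : w = col_ebase w *m (e *m P).
  rewrite mulmxA -[LHS]mulmx_ebase; congr (_ *m pid_mx _ *m _).
  by apply/eqP; rewrite eqn_leq rank_leq_row lt0n mxrank_eq0.
pose W' := P *m W *m invmx P.
have PW : P *m W = W' *m P by rewrite /W' -[RHS]mulmxA mulVmx// mulmx1.
have eW : e *m W' = l *: e.
  have : e *m P *m W = l *: (e *m P).
    apply: (can_inj (mulKmx (col_ebase_unit w))).
    by rewrite -scalemxAr mulmxA -wE.
  move=> /(congr1 (mulmx^~ (invmx P))); rewrite -scalemxAl mulmxK// => <-.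
  by rewrite /W' !mulmxA.
have eE : e = row_mx 1%:M 0 by exact: pid_mx_row.
pose D := drsubmx W'; pose k := dlsubmx W'.
have W'E : W' = block_mx l%:M 0 k D.
  rewrite -[LHS]submxK; move: eW; rewrite eE -[W' in LHS]submxK mul_row_block.
  rewrite !mul1mx !mul0mx !addr0 scale_row_mx scaler0 scalemx1.
  by move=> /eq_row_mx[-> ->].
have : 'X - m%:P %| char_poly D.
  move: dv; rewrite -(char_poly_conj W uP) -/W' W'E.
  rewrite /char_poly /char_poly_mx map_block_mx map_mx0 (scalar_mx_block 1 n).
  rewrite opp_block_mx add_block_mx oppr0 addr0 add0r det_lblock.
  rewrite det_mx11 !mxE mulr1n dvdp_mul2l ?polyXsubC_eq0//.
rewrite dvdp_XsubCl -eigenvalue_root_char => /eigenvalueP[d dD d0].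
exists (e *m P), (row_mx 0 d *m P), ((d *m k) 0 0); split.
- by rewrite -mulmxA PW mulmxA eW scalemxAl.
- rewrite -mulmxA PW mulmxA W'E mul_row_block !mul0mx !add0r dD.
  rewrite scalemxAl [X in _ + X]scalemxAl -mulmxDl eE !scale_row_mx add_row_mx.
  by rewrite !scaler0 add0r addr0 scalemx1 -mx11_scalar.
move=> a b; rewrite !scalemxAl -mulmxDl eE !scale_row_mx add_row_mx.
move=> /(congr1 (mulmx^~ (invmx P))); rewrite mulmxK// mul0mx -row_mx0 => /eq_row_mx.
rewrite !scaler0 addr0 add0r scalemx1 => -[/matrixP/(_ 0 0) a0 /eqP].
rewrite scaler_eq0 (negPf d0) orbF => /eqP ->; split=> //.
by move: a0; rewrite !mxE.
Qed.
Lemma char_poly_tr (S : comNzRingType) (n : nat) (W : 'M[S]_n) : char_poly W^T = char_poly W.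
Proof.
by rewrite /char_poly -[RHS]det_tr /char_poly_mx linearB /= tr_scalar_mx map_trmx.
Qed.

Section StableLine.
Import Normc.
Local Notation Re := complex.Re.
Local Notation Im := complex.Im.
Context {R : realType} {n : nat}.
Local Notation C := R[i].
Local Notation toC := (map_mx (real_complex R)).
Implicit Types (B : 'M[R]_n) (x : 'cV[C]_n).

Lemma stable_space_bound B v (K : 'I_n -> R) (s : R) : 0 <= s < 1 ->
  (forall k i, `|(B ^+ k *m v) i 0| <= K i * s ^+ k) -> stable_space B v.
Proof.
move=> /andP[s0 s1] Bv; apply/cvg_ballP => e e0.
have : \forall k \near \oo, forall i, K i * s ^+ k < e.
  apply: filter_forall => i; have s1' : `|s| < 1 by rewrite ger0_norm.
  have /cvgrPdist_lt/(_ e e0) := @cvg_geometric R (K i) s s1'; apply: filterS => k.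
  by rewrite sub0r normrN; apply: le_lt_trans; exact: ler_norm.
apply: filterS => k Kk; split=> // i j; rewrite !mxE ord1 /ball /= sub0r normrN.
by apply: le_lt_trans (Kk i); have := Bv k i; rewrite !mxE.
Qed.

Lemma normc_ge0 (z : C) : 0 <= normc z.
Proof. by case: z => a b; exact: sqrtr_ge0. Qed.

Lemma Re_le_normc (z : C) : `|Re z| <= normc z.
Proof.
by case: z => a b; rewrite /= -sqrtr_sqr ler_wsqrtr// lerDl sqr_ge0.
Qed.

Lemma Im_le_normc (z : C) : `|Im z| <= normc z.
Proof.
by case: z => a b; rewrite /= -sqrtr_sqr ler_wsqrtr// lerDr sqr_ge0.
Qed.

Lemma mulmx_Re (B : 'M[R]_n) x : map_mx (@Re R) (toC B *m x) = B *m map_mx (@Re R) x.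
Proof.
apply/matrixP => i j; rewrite !mxE.
rewrite (big_morph (@Re R) (id1 := 0) (op1 := +%R))//; last by case=> ? ? [].
by apply: eq_bigr => k _; rewrite !mxE; case: (x k j) => a b /=; rewrite mul0r subr0.
Qed.

Lemma mulmx_Im (B : 'M[R]_n) x : map_mx (@Im R) (toC B *m x) = B *m map_mx (@Im R) x.
Proof.
apply/matrixP => i j; rewrite !mxE.
rewrite (big_morph (@Im R) (id1 := 0) (op1 := +%R))//; last by case=> ? ? [].
by apply: eq_bigr => k _; rewrite !mxE; case: (x k j) => a b /=; rewrite mul0r addr0.
Qed.

(** The real and imaginary parts of [x] have decaying orbits as well, so both lie on the real line
    spanned by [v]. *)
Lemma stable_line_decay B v x (K : 'I_n -> R) (s : R) : stable_space B = range (fun a => a *: v) ->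
  0 <= s < 1 -> (forall k i, normc ((toC B ^+ k *m x) i 0) <= K i * s ^+ k) ->
  exists z : C, x = z *: toC v.
Proof.
move=> Bv s01 xK.
have toCX k : toC B ^+ k = toC (B ^+ k).
  elim: k => [|k IH]; first by rewrite !expr0 map_mx1.
  by rewrite !exprS IH map_mxM.
have [a _ aE] : range (fun a => a *: v) (map_mx (@Re R) x).
  rewrite -Bv; apply: (stable_space_bound s01) => k i.
  rewrite -mulmx_Re -toCX mxE; apply: le_trans (xK k i); exact: Re_le_normc.
have [b _ bE] : range (fun a => a *: v) (map_mx (@Im R) x).
  rewrite -Bv; apply: (stable_space_bound s01) => k i.
  rewrite -mulmx_Im -toCX mxE; apply: le_trans (xK k i); exact: Im_le_normc.
exists (Complex a b); apply/matrixP => i j.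
have := congr1 (fun w : 'cV[R]_n => w i j) aE; have := congr1 (fun w : 'cV[R]_n => w i j) bE.
rewrite !mxE /=; case: (x i j) => c d /= <- <-.
by congr Complex; rewrite /= mulr0 ?subr0 ?add0r.
Qed.

Lemma stable_line_pair B x1 x2 (l m c : C) : one_dimensional (stable_space B) ->
  toC B *m x1 = l *: x1 -> toC B *m x2 = m *: x2 + c *: x1 ->
  normc l < 1 -> normc m < 1 -> exists a b : C, (a != 0) || (b != 0) /\ a *: x1 + b *: x2 = 0.
Proof.
move=> [v v0 Bv] x1E x2E l1 m1.
(* A rate strictly between [s0] and 1 absorbs the linear growth factor that a Jordan block adds to
   the geometric decay. *)
pose s0 := Num.max (normc l) (normc m); pose s := (1 + s0) / 2.
have s01 : 0 <= s0 < 1 by rewrite le_max normc_ge0 gt_max l1 m1.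
have s1 : s0 < s < 1 by rewrite /s; lra.
have s_ge0 : 0 <= s < 1 by lra.
have ls : normc l <= s0 by rewrite le_max lexx.
have ms : normc m <= s0 by rewrite le_max lexx orbT.
have pw (z : C) k : normc z <= s0 -> normc (z ^+ k) <= s ^+ k.
  move=> zs; elim: k => [|k IH]; first by rewrite !expr0 normc1.
  by rewrite !exprS normcM ler_pM ?normc_ge0//; lra.
have p1 k : toC B ^+ k *m x1 = l ^+ k *: x1.
  elim: k => [|k IH]; first by rewrite !expr0 mul1mx scale1r.
  by rewrite exprS -[_ * _]/(_ *m _) -mulmxA IH -scalemxAr x1E scalerA -exprSr.
(* Chosen as the solution of [s0 * K + normc c = s * K], which makes the bound on the coefficient of
   [x1] pass from each power to the next. *)
pose K := normc c / (s - s0).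
have sK : s0 * K + normc c = s * K 
  by rewrite /K mulrC -[X in _ + X](divfK (_ : s - s0 != 0))
    -?mulrDr ?subrKC 1?mulrC// subr_eq0 gt_eqF//; lra.
have p2 k : exists2 b : C, toC B ^+ k *m x2 = m ^+ k *: x2 + b *: x1 & normc b <= K * s ^+ k.
  elim: k => [|k [b bE bK]].
    exists 0; first by rewrite !expr0 mul1mx scale1r scale0r addr0.
    by rewrite normc0 expr0 mulr1 divr_ge0 ?normc_ge0//; lra.
  exists (m ^+ k * c + b * l).
    rewrite exprS -[_ * _]/(_ *m _) -mulmxA bE mulmxDr -!scalemxAr x1E x2E.
    by rewrite scalerDr !scalerA -exprSr -addrA -scalerDl.
  apply: le_trans (le_normcD _ _) _; rewrite !normcM.
  have h1 : normc (m ^+ k) * normc c <= s ^+ k * normc c by rewrite ler_wpM2r ?normc_ge0 ?pw.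
  have h2 : normc b * normc l <= K * s ^+ k * s0 by rewrite ler_pM ?normc_ge0.
  apply: le_trans (lerD h1 h2) _; rewrite exprS mulrCA mulrA -sK.
  by rewrite le_eqVlt; apply/orP; left; apply/eqP; ring.
have [z1 x1v] : exists z : C, x1 = z *: toC v.
  apply: (stable_line_decay (K := fun i => normc (x1 i 0)) Bv s_ge0) => k i.
  by rewrite p1 mxE normcM mulrC ler_wpM2l ?normc_ge0 ?pw.
have [z2 x2v] : exists z : C, x2 = z *: toC v.
  apply: (stable_line_decay (K := fun i => normc (x2 i 0) + K * normc (x1 i 0)) Bv s_ge0) => k i.
  have [b -> bK] := p2 k; rewrite !mxE; apply: le_trans (le_normcD _ _) _.
  rewrite !normcM mulrDl; apply: lerD.
    by rewrite mulrC ler_wpM2l ?normc_ge0 ?pw.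
  by rewrite mulrAC ler_wpM2r ?normc_ge0.
case: (z1 =P 0) => [z10|/eqP z10].
  by exists 1, 0; rewrite oner_neq0 x1v z10 !scale0r scaler0 addr0.
by exists z2, (- z1); rewrite oppr_eq0 z10 orbT x1v x2v !scalerA mulNr scaleNr mulrC subrr.
Qed.

End StableLine.

Section CodimensionOne.
Import Normc.
Context {R : realType} {n : nat}.
Local Notation C := R[i].
Local Notation toC := (map_mx (real_complex R)).
Implicit Types (B : 'M[R]_n).

Lemma norm_normc (z : C) : `|z| = (normc z)%:C%C.
Proof. by []. Qed.

Lemma stable_line_roots B (l m : C) : one_dimensional (stable_space B) ->
  ('X - l%:P) * ('X - m%:P) %| char_poly (toC B) -> normc l < 1 -> normc m < 1 -> False.
Proof.
move=> B1; rewrite -char_poly_tr => /triangular_pair[u1 [u2 [c [u1E u2E ind]]]] l1 m1.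
have x1E : toC B *m u1^T = l *: u1^T by rewrite -[toC B]trmxK -trmx_mul u1E linearZ.
have x2E : toC B *m u2^T = m *: u2^T + c *: u1^T.
  by rewrite -[toC B]trmxK -trmx_mul u2E linearD !linearZ.
have [a [b [ab]]] := stable_line_pair B1 x1E x2E l1 m1.
rewrite -!linearZ -linearD -[0]trmx0 => /trmx_inj/ind[a0 b0].
by rewrite a0 b0 eqxx in ab.
Qed.

Lemma unstable_line_roots B (l m : C) : B \in unitmx -> one_dimensional (unstable_space B) ->
  ('X - l%:P) * ('X - m%:P) %| char_poly (toC B) -> 1 < normc l -> 1 < normc m -> False.
Proof.
move=> uB B1; rewrite -char_poly_tr => /triangular_pair[u1 [u2 [c [u1E u2E ind]]]] l1 m1.
have x1E : toC B *m u1^T = l *: u1^T by rewrite -[toC B]trmxK -trmx_mul u1E linearZ.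
have x2E : toC B *m u2^T = m *: u2^T + c *: u1^T.
  by rewrite -[toC B]trmxK -trmx_mul u2E linearD !linearZ.
have nz (z : C) : 1 < normc z -> z != 0.
  by move=> z1; apply/eqP => z0; rewrite z0 normc0 ltr10 in z1.
have inv1 (z : C) : 1 < normc z -> normc z^-1 < 1.
  by move=> z1; rewrite normcV invf_lt1// (lt_trans ltr01).
have invK (x : 'cV[C]_n) : toC (invmx B) *m (toC B *m x) = x.
  by rewrite mulmxA -map_mxM mulVmx// map_mx1 mul1mx.
have y1E : toC (invmx B) *m u1^T = l^-1 *: u1^T.
  by rewrite -[in RHS](invK u1^T) x1E -scalemxAr scalerA mulVf ?nz// scale1r.
have y2E : toC (invmx B) *m u2^T = m^-1 *: u2^T + (- (m^-1 * c * l^-1)) *: u1^T.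
  apply/eqP; rewrite scaleNr eq_sym subr_eq -[in X in X == _](invK u2^T) x2E.
  by rewrite mulmxDr -!scalemxAr y1E scalerDr !scalerA mulVf ?nz// scale1r.
have [a [b [ab]]] := stable_line_pair B1 y1E y2E (inv1 _ l1) (inv1 _ m1).
rewrite -!linearZ -linearD -[0]trmx0 => /trmx_inj/ind[a0 b0].
by rewrite a0 b0 eqxx in ab.
Qed.

Theorem one_dimensional_irreducible (A : 'M[int]_n) : A \in unitmx -> hyperbolic A ->
  one_dimensional (stable_space (map_mx intr A : 'M[R]_n)) \/
  one_dimensional (unstable_space (map_mx intr A : 'M[R]_n)) ->
  irreducible_poly (map_poly intr (char_poly A) : {poly rat}).
Proof.
move=> uA hA line; set B : 'M[R]_n := map_mx intr A in line *.
have uB : B \in unitmx by rewrite unitmxE det_map_mx rmorph_unit -?unitmxE.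
have szA : size (char_poly A) = n.+1 by exact: size_char_poly.
have n0 : (0 < n)%N.
  rewrite lt0n; apply/eqP => n0; have v0 (v : 'cV[R]_n) : v = 0.
    by apply/matrixP => i; have i0 := leq_ltn_trans (leq0n i) (ltn_ord i); rewrite n0 in i0.
  by case: line => -[v /eqP]; rewrite (v0 v).
have sQ (q : {poly int}) : size (map_poly intr q : {poly rat}) = size q.
  by rewrite size_map_inj_poly//; exact: intr_inj.
split=> [|q q1 qA]; first by rewrite sQ szA.
rewrite -dvdp_size_eqp//; apply/negPn/negP => qn.
have [p [a a0 qE] [r AE]] := dvdpP_rat_int qA.
have szq : size q = size p by rewrite qE size_scale// sQ.
have A0 : char_poly A != 0 by rewrite monic_neq0// char_poly_monic.
have [p0 r0] : p != 0 /\ r != 0 by move: A0; rewrite AE mulf_eq0 negb_or => /andP.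
have p2 : (1 < size p)%N by rewrite ltn_neqAle lt0n size_poly_eq0 p0 -szq eq_sym q1.
have r2 : (1 < size r)%N.
  rewrite ltnNge; apply/negP => rs; move/negP: qn; apply.
  rewrite sQ szq AE size_mul//; move: rs r0; rewrite -size_poly_gt0; case: (size r) => [|[|//]]//.
  by rewrite addn1.
have lead : lead_coef p * lead_coef r = 1.
  by rewrite -lead_coefM -AE; apply/monicP; exact: char_poly_monic.
(* Both leading coefficients equal the same sign; multiplying each factor by it makes the factors
   monic without changing their product. *)
pose e := lead_coef p.
have e2 : e * e = 1.
  have : lead_coef p \is a GRing.unit by apply/unitrP; exists (lead_coef r); rewrite mulrC lead.
  by rewrite /e => /orP[] /eqP ->.
have re : e = lead_coef r by rewrite -[RHS]mul1r -e2 -mulrA lead mulr1.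
have pm : e *: p \is monic by apply/monicP; rewrite lead_coefZ.
have rm : e *: r \is monic by apply/monicP; rewrite lead_coefZ -re.
have AE' : char_poly A = (e *: p) * (e *: r).
  by rewrite -scalerAl -scalerAr scalerA e2 scale1r.
have coef0 : `|(e *: p)`_0| = 1 /\ `|(e *: r)`_0| = 1.
  have : (e *: p)`_0 * (e *: r)`_0 \is a GRing.unit.
    by rewrite -coef0M -AE' char_poly_det unitrM unitrX ?unitrN1.
  by rewrite unitrM => /andP[/orP[] /eqP -> /orP[] /eqP ->].
have sz0 : e != 0 by apply/eqP => e0; rewrite e0 in e2.
have [[l lp l1] [l' lp' l1']] := @unimodular_factor_roots C n A _ _ hA AE' pm
  (etrans (congr1 _ (size_scale _ sz0)) p2) coef0.1.
have [[m mr m1] [m' mr' m1']] := @unimodular_factor_roots C n A _ _ hA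
  (etrans AE' (mulrC _ _)) rm (etrans (congr1 _ (size_scale _ sz0)) r2) coef0.2.
have cE : char_poly (toC B) = map_poly intr (e *: p) * map_poly intr (e *: r).
  rewrite -rmorphM -AE' /= map_char_poly; congr char_poly; apply/matrixP => i j.
  by rewrite !mxE rmorph_int.
(* The roots come from different factors, so the product of their linear factors divides even when
   they coincide. *)
have dv (z w : C) : root (map_poly intr (e *: p)) z -> root (map_poly intr (e *: r)) w ->
    ('X - z%:P) * ('X - w%:P) %| char_poly (toC B).
  by move=> zp wr; rewrite cE dvdp_mul// dvdp_XsubCl.
have lt1 (z : C) : `|z| < 1 -> normc z < 1 by rewrite norm_normc -ltcR.
have gt1 (z : C) : 1 < `|z| -> 1 < normc z by rewrite norm_normc -ltcR.
case: line => line.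
  exact: (stable_line_roots line (dv _ _ lp mr) (lt1 _ l1) (lt1 _ m1)).
exact: (unstable_line_roots uB line (dv _ _ lp' mr') (gt1 _ l1') (gt1 _ m1')).
Qed.

End CodimensionOne.

Theorem theorem1p11 (R : realType) (n : nat) (M : manifold R n.+1)
    (g : riemannian_metric M) (p : euclidean R n.+1 -> M) (T : set M) :
  universal_covering p ->
  (forall x : M, torsion_free (pi1 R x)) ->
  (codimension_one_anosov_torus n T -> irreducible_anosov_torus n T) /\
  (irreducible_anosov_torus n T ->
   incompressible R T \/
   [/\ (3 <= n)%N,
       totally_compressible R T,
       (exists l : T -> euclidean R n.+1, is_lift p l /\ embeds_in_sphere l) &
       forall l : T -> euclidean R n.+1, is_lift p l -> embeds_in_sphere l ->
       exists C1 C2 : set (sphere R n),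
         splits_into (range (to_sphere l)) C1 C2 /\
         let N1 := closure C1 in
         let N2 := closure C2 in
         [/\ bd N1 = range (to_sphere l) /\ bd N2 = range (to_sphere l),
             simply_connected R N1,
             incompressible_bd R N2,
             zmod_iso (H1 R N2) (H1 R (bd N2)) &
             forall b : bd N2,
               let act := conj_action (bd_pi1 R b) in
               group_iso (semidirect act) (pi1 R (sub_incl (@bd_sub _ N2) b)) /\
               normally_generates (range (sd_inr act))]]).
Proof.
move=> ucov tfree.
have diffeo (f : M -> M) : diffeomorphism f -> exists f', [/\ continuous f, continuous f',
    cancel f f' & cancel f' f].
  move=> [[cf _] [f' [cf' _] [fK f'K]]].
  by exists f'; split=> // x; [exact: cf|exact: cf'].
split=> [[A TA line]|[A TA irr]].
  exists A => //; case: TA => _ hyp [f [/diffeo[f' [cf cf' fK f'K]] fT [gT gTE]]].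
  move=> [x [c [phi [phi_bij phiM phiA]]]].
  have [gTi [gTK gTiK]] := homeo_torus_inverse cf' fK f'K fT gTE.
  exact: one_dimensional_irreducible (homeo_action_unit gTK gTiK phi_bij phiA) hyp line.
case: TA => [[e [emb eT]] hyp [f [/diffeo[f' [cf cf' fK f'K]] fT [gT gTE]]]].
move=> [x [c [phi [phi_bij phiM phiA]]]]; left.
exact: (anosov_incompressible ucov tfree emb eT cf cf' fK f'K fT gTE phi_bij phiM phiA hyp irr).
Qed.
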